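(* Let $a<b$, $c<d$ and $N=\left[\begin{smallmatrix}0&N_{01}&N_{02}\\0&N_{11}&N_{12}\\0&N_{21}&N_{22}\end{smallmatrix}\right]\in\mathcal N_{2D}^{n\times m}$ where $N_{01},N_{02}\in H_1^{n\times m}[x,y,\nu]$ and $N_{11},N_{12},N_{21},N_{22}\in H_1^{n\times m}[x,y,\theta,\nu]$. Define $M=(M_{ij})_{i,j=0}^2\in\mathcal N_{2D}^{n\times m}$ by $$\begin{aligned}&M_{00}(x,y)=N_{01}(x,y,y)-N_{02}(x,y,y),\\&M_{10}(x,y,\theta)=N_{11}(x,y,\theta,y)-N_{12}(x,y,\theta,y),\\&M_{20}(x,y,\theta)=N_{21}(x,y,\theta,y)-N_{22}(x,y,\theta,y),\\&M_{0j}(x,y,\nu)=\partial_yN_{0j}(x,y,\nu),\quad M_{ij}(x,y,\theta,\nu)=\partial_yN_{ij}(x,y,\theta,\nu)\qquad(i,j\in\{1,2\}).\end{aligned}$$ Then for any $u\in L_2^m([a,b]\times[c,d])$, $$\partial_y(\mathcal P[N]u)(x,y)=(\mathcal P[M]u)(x,y).$$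
   Context: $\mathcal N_{2D}^{n\times m}$ is the set of $3\times3$ arrays $(N_{ij})_{i,j\in\{0,1,2\}}$ of square-integrable $\mathbb R^{n\times m}$-valued functions $N_{00}(x,y)$, $N_{01}(x,y,\nu)$, $N_{02}(x,y,\nu)$, $N_{10}(x,y,\theta)$, $N_{20}(x,y,\theta)$, and $N_{11},N_{12},N_{21},N_{22}$ of $(x,y,\theta,\nu)$, with $x,\theta\in[a,b]$, $y,\nu\in[c,d]$. The 2D-PI operator is $$\begin{aligned}(\mathcal P[N]u)(x,y)=\;&N_{00}(x,y)u(x,y)+\int_a^xN_{10}(x,y,\theta)u(\theta,y)d\theta+\int_x^bN_{20}(x,y,\theta)u(\theta,y)d\theta\\&+\int_c^yN_{01}(x,y,\nu)u(x,\nu)d\nu+\int_y^dN_{02}(x,y,\nu)u(x,\nu)d\nu\\&+\int_a^x\!\!\int_c^yN_{11}(x,y,\theta,\nu)u(\theta,\nu)d\nu d\theta+\int_x^b\!\!\int_c^yN_{21}(x,y,\theta,\nu)u(\theta,\nu)d\nu d\theta\\&+\int_a^x\!\!\int_y^dN_{12}(x,y,\theta,\nu)u(\theta,\nu)d\nu d\theta+\int_x^b\!\!\int_y^dN_{22}(x,y,\theta,\nu)u(\theta,\nu)d\nu d\theta.\end{aligned}$$ $H_1$ denotes the space of functions all of whose mixed (weak) partial derivatives of order at most one in each variable separately are in $L_2$; e.g. $H_1[x,y]=\{u:\partial_x^{\alpha_1}\partial_y^{\alpha_2}u\in L_2\ \forall\,\max(\alpha_1,\alpha_2)\le1\}$,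 and likewise in three and four variables. Derivatives are weak derivatives and equalities hold almost everywhere. *)

(* Defs.v *)
From HB Require Import structures.
From mathcomp Require Import all_boot all_order all_algebra.
From mathcomp Require Import all_classical all_reals all_analysis.

Set Implicit Arguments.
Unset Strict Implicit.
Unset Printing Implicit Defensive.

Import Order.TTheory GRing.Theory Num.Theory.
Import numFieldNormedType.Exports.

Local Open Scope classical_set_scope.
Local Open Scope ring_scope.

(* Function spaces are needed on R * R, R * R * R and R * R * R * R; joining
   the normed-module and measurable structures lets one definition serve all
   three. *)
#[short(type="measurableNormedModType")]
HB.structure Definition MeasurableNormedModule (R : realType) d :=
  { V of Measurable d V & NormedModule R V }.

(* measurableTypeR R is R with the sigma-algebra carrying lebesgue_measure; it
   receives the usual norm of R. *)
HB.instance Definition _ (R : realType) :=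
  NormedModule.copy (measurableTypeR R) (Real.sort R).
HB.instance Definition _ (R : realType) := Measurable.on (measurableTypeR R).

HB.instance Definition _ (R : realType) d1 d2
    (V1 : measurableNormedModType R d1) (V2 : measurableNormedModType R d2) :=
  Measurable.on (V1 * V2)%type.

Notation leb1 := lebesgue_measure.
Notation leb2 := (leb1 \x leb1)%E.
Notation leb3 := (leb2 \x leb1)%E.
Notation leb4 := (leb3 \x leb1)%E.

Section WeakDerivatives.
Context (R : realType) (d : measure_display) (V : measurableNormedModType R d).
Implicit Types (mu : {measure set V -> \bar R}) (D : set V) (f g phi : V -> R).

(* Measurability is Borel measurability: an L2 class is represented by its
   Borel members. *)
Definition L2 mu D f : Prop := f \_ D \in Lfun mu 2%:E.

Definition iter_derive (s : seq V) phi : V -> R :=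
  foldr (fun v h => 'D_v h) phi s.

Definition smooth phi : Prop := forall s : seq V,
  continuous (iter_derive s phi) /\
  forall x v, derivable (iter_derive s phi) x v.

Definition test_function D phi : Prop := smooth phi /\
  exists K : set V, [/\ compact K, K `<=` D° & forall x, ~ K x -> phi x = 0].

Definition locally_integrable_on mu D f : Prop :=
  measurable_fun D f /\
  forall K : set V, compact K -> K `<=` D° -> mu.-integrable K (EFin \o f).

(* g is the weak derivative of f, in the interior of D, along the list of
   directions s *)
Definition weak_derivative mu D (s : seq V) f g : Prop :=
  [/\ locally_integrable_on mu D f,
      locally_integrable_on mu D g &
      forall phi, test_function D phi ->
        \int[mu]_(z in D) (f z * iter_derive s phi z) =
        (-1) ^+ size s * \int[mu]_(z in D) (g z * phi z)].

(* E lists the coordinate directions, so that its subsequences are the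
   multi-indices with entries at most one; the empty one puts f itself in L2 *)
Definition H1 mu D (E : seq V) f : Prop :=
  forall s : seq V, subseq s E ->
    exists g, L2 mu D g /\ weak_derivative mu D s f g.

Definition continuous_representative mu D f g : Prop :=
  {within D, continuous g} /\ ae_eq mu D f g.

End WeakDerivatives.

Section MatrixValued.
Context (R : realType) (d : measure_display) (V : measurableNormedModType R d).
Context (n m : nat).
Implicit Types (mu : {measure set V -> \bar R}) (D : set V).
Implicit Types (F G : V -> 'M[R]_(n, m)).

Definition L2mx mu D F : Prop :=
  forall i j, L2 mu D (fun z => F z i j).

Definition H1mx mu D (E : seq V) F : Prop :=
  forall i j, H1 mu D E (fun z => F z i j).

Definition weak_derivative_mx mu D (s : seq V) F G : Prop :=
  forall i j, weak_derivative mu D s (fun z => F z i j) (fun z => G z i j).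

Definition continuous_representative_mx mu D F G : Prop :=
  forall i j,
    continuous_representative mu D (fun z => F z i j) (fun z => G z i j).

End MatrixValued.

(* Arguments are ordered (x, y), (x, y, nu), (x, y, theta) and
   (x, y, theta, nu). *)
Record kernels2D (R : realType) (n m : nat) := Kernels2D {
  k00 : R * R -> 'M[R]_(n, m);
  k01 : R * R * R -> 'M[R]_(n, m);
  k02 : R * R * R -> 'M[R]_(n, m);
  k10 : R * R * R -> 'M[R]_(n, m);
  k20 : R * R * R -> 'M[R]_(n, m);
  k11 : R * R * R * R -> 'M[R]_(n, m);
  k12 : R * R * R * R -> 'M[R]_(n, m);
  k21 : R * R * R * R -> 'M[R]_(n, m);
  k22 : R * R * R * R -> 'M[R]_(n, m)
}.

Section PI2D.
Context (R : realType) (a b c d : R).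

Definition box_xy : set (R * R) := `[a, b] `*` `[c, d].
Definition box_xynu : set (R * R * R) := box_xy `*` `[c, d].
Definition box_xytheta : set (R * R * R) := box_xy `*` `[a, b].
Definition box_xythetanu : set (R * R * R * R) := box_xytheta `*` `[c, d].

Definition basis3 : seq (R * R * R) := [:: (1, 0, 0); (0, 1, 0); (0, 0, 1)].
Definition basis4 : seq (R * R * R * R) :=
  [:: (1, 0, 0, 0); (0, 1, 0, 0); (0, 0, 1, 0); (0, 0, 0, 1)].

Definition dy2 : seq (R * R) := [:: (0, 1)].
Definition dy3 : seq (R * R * R) := [:: (0, 1, 0)].
Definition dy4 : seq (R * R * R * R) := [:: (0, 1, 0, 0)].

Definition integral_mx (p q : nat) (I : set R) (F : R -> 'M[R]_(p, q)) :
    'M[R]_(p, q) :=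
  \matrix_(i, j) \int[leb1]_(t in I) F t i j.

Context (n m : nat).
Implicit Types (N M : kernels2D R n m).

Definition in_N2D N : Prop :=
  [/\ L2mx leb2 box_xy (k00 N),
      L2mx leb3 box_xynu (k01 N) /\ L2mx leb3 box_xynu (k02 N),
      L2mx leb3 box_xytheta (k10 N) /\ L2mx leb3 box_xytheta (k20 N),
      L2mx leb4 box_xythetanu (k11 N) /\ L2mx leb4 box_xythetanu (k12 N) &
      L2mx leb4 box_xythetanu (k21 N) /\ L2mx leb4 box_xythetanu (k22 N)].

Definition PI2D N (u : R * R -> 'cV[R]_m) : R * R -> 'cV[R]_n :=
  fun z => let x := z.1 in let y := z.2 in
    k00 N (x, y) *m u (x, y)
  + integral_mx `[a, x] (fun theta => k10 N (x, y, theta) *m u (theta, y))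
  + integral_mx `[x, b] (fun theta => k20 N (x, y, theta) *m u (theta, y))
  + integral_mx `[c, y] (fun nu => k01 N (x, y, nu) *m u (x, nu))
  + integral_mx `[y, d] (fun nu => k02 N (x, y, nu) *m u (x, nu))
  + integral_mx `[a, x] (fun theta => integral_mx `[c, y] (fun nu =>
      k11 N (x, y, theta, nu) *m u (theta, nu)))
  + integral_mx `[x, b] (fun theta => integral_mx `[c, y] (fun nu =>
      k21 N (x, y, theta, nu) *m u (theta, nu)))
  + integral_mx `[a, x] (fun theta => integral_mx `[y, d] (fun nu =>
      k12 N (x, y, theta, nu) *m u (theta, nu)))
  + integral_mx `[x, b] (fun theta => integral_mx `[y, d] (fun nu =>
      k22 N (x, y, theta, nu) *m u (theta, nu))).

(* The set nu = y is negligible, so the values of H1 kernels on it are those of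
   their continuous representatives. *)
Definition diagonal_jump3 (F1 F2 : R * R * R -> 'M[R]_(n, m))
    (J : R * R -> 'M[R]_(n, m)) : Prop :=
  exists G1 G2, [/\ continuous_representative_mx leb3 box_xynu F1 G1,
    continuous_representative_mx leb3 box_xynu F2 G2 &
    ae_eq leb2 box_xy J
      (fun z => G1 (z.1, z.2, z.2) - G2 (z.1, z.2, z.2))].

Definition diagonal_jump4 (F1 F2 : R * R * R * R -> 'M[R]_(n, m))
    (J : R * R * R -> 'M[R]_(n, m)) : Prop :=
  exists G1 G2, [/\ continuous_representative_mx leb4 box_xythetanu F1 G1,
    continuous_representative_mx leb4 box_xythetanu F2 G2 &
    ae_eq leb3 box_xytheta J
      (fun z => G1 (z.1.1, z.1.2, z.2, z.1.2)
              - G2 (z.1.1, z.1.2, z.2, z.1.2))].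

(* Weak derivatives and traces are determined up to null sets only, so M is
   specified by a relation. *)
Definition y_derivative_kernels N M : Prop :=
  [/\ in_N2D M,
      [/\ diagonal_jump3 (k01 N) (k02 N) (k00 M),
          diagonal_jump4 (k11 N) (k12 N) (k10 M) &
          diagonal_jump4 (k21 N) (k22 N) (k20 M)],
      weak_derivative_mx leb3 box_xynu dy3 (k01 N) (k01 M) /\
      weak_derivative_mx leb3 box_xynu dy3 (k02 N) (k02 M),
      weak_derivative_mx leb4 box_xythetanu dy4 (k11 N) (k11 M) /\
      weak_derivative_mx leb4 box_xythetanu dy4 (k12 N) (k12 M) &
      weak_derivative_mx leb4 box_xythetanu dy4 (k21 N) (k21 M) /\
      weak_derivative_mx leb4 box_xythetanu dy4 (k22 N) (k22 M)].

End PI2D.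

(* Main.v *)
(* Fubini turns the pairing of P[N]u with the y-derivative of a test function
   into integrals over lines parallel to the y-axis.  Along almost all of them an
   H1 kernel F is absolutely continuous in y, so integrating the product rule for
   F phi over {y >= nu} (resp. {y <= nu}) leaves the boundary term -F phi (resp.
   F phi) at y = nu; the two boundary terms combine into the jump of the kernels
   across nu = y, which is the multiplier or partial-integral part of P[M].

   The trace on nu = y makes sense because a function with square-integrable mixed
   derivatives of order at most one in each variable has a continuous
   representative: if w_i is a bump of integral 1 with primitive W_i, then
     f(z) = sum over J of the integral of
            d_J f(s) prod_(i in J) (W_i(s_i) - 1_{z_i <= s_i}) prod_(i notin J) w_i(s_i),
   and the right-hand side depends continuously on z.  Only products of
   one-variable test functions are ever needed, because they determine an
   integrable function almost everywhere. *)
Require Import Defs.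
From HB Require Import structures.
From mathcomp Require Import all_boot all_order all_algebra.
From mathcomp Require Import all_classical all_reals all_analysis.
From mathcomp Require Import measurable_realfun lra ring.

Set Implicit Arguments.
Unset Strict Implicit.
Unset Printing Implicit Defensive.

Import Order.TTheory GRing.Theory Num.Theory.
Import numFieldNormedType.Exports.

Local Open Scope classical_set_scope.
Local Open Scope ring_scope.

(** The weight [u] is only square-integrable and the cut along nu = y is sharp, so the product of
    [u], phi and the indicator of y >= nu is not an admissible test function for the weak derivative
    of a kernel. The integration by parts is therefore done on single lines, where [u] is a constant
    factor. On a line, absolute continuity comes from the weak derivative in y: the kernel minus the
    primitive of that derivative annihilates the y-derivatives of test functions, hence is constant
    in y. Testing with the countable family [bumps] keeps the exceptional lines in one null set. The
    continuous representative then gives the value at the single point y = nu, which an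
    almost-everywhere class does not determine, and continuity identifies it with the value of the
    absolutely continuous function there.

    In the formula for the representative, the sum over J comes from splitting each factor b_i of a
    product test function as (b_i - c_i w_i) + c_i w_i, with c_i the integral of b_i. The first
    summand has integral 0, so it is the derivative of a test function, and the product of the sums
    expands over the subsets J. *)

Notation intble mu f := (mu.-integrable [set: _] (EFin \o f)).
Notation leb R := (lebesgue_measure : {sigma_finite_measure set (measurableTypeR R) -> \bar R}).

(** * Integrable functions on products *)

Section Integral.
Context d (T : measurableType d) (R : realType) (mu : {measure set T -> \bar R}).
Implicit Types f g : T -> R.

Lemma intble_meas f : intble mu f -> measurable_fun setT f.
Proof. by move=> /integrableP[/measurable_EFinP]. Qed.

Lemma intble_le f g : measurable_fun setT f -> (forall x, `|f x| <= g x) ->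
  intble mu g -> intble mu f.
Proof.
move=> mf fg ig; apply: le_integrable ig => //; first exact/measurable_EFinP.
by move=> x _ /=; rewrite lee_fin (le_trans (fg x))// ler_norm.
Qed.

Lemma intbleD f g : intble mu f -> intble mu g -> intble mu (fun x => f x + g x).
Proof. by move=> i1 i2; have := integrableD measurableT i1 i2. Qed.

Lemma intbleZ c f : intble mu f -> intble mu (fun x => c * f x).
Proof. by move=> i1; have := integrableZl measurableT c i1. Qed.

Lemma intbleN f : intble mu f -> intble mu (fun x => - f x).
Proof.
move=> /(intbleZ (-1)); apply: eq_integrable => // x _ /=.
by rewrite mulN1r.
Qed.

Lemma intbleB f g : intble mu f -> intble mu g -> intble mu (fun x => f x - g x).
Proof. by move=> i1 i2; apply: intbleD => //; exact: intbleN. Qed.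

Lemma eq_intble f g : (forall x, f x = g x) -> intble mu f -> intble mu g.
Proof. by move=> /funext ->. Qed.

Lemma intble0 : intble mu (fun=> 0 : R).
Proof. exact: integrable0. Qed.

Lemma intble_sum I (s : seq I) (P : pred I) (h : I -> T -> R) :
  (forall i, P i -> intble mu (h i)) -> intble mu (fun x => \sum_(i <- s | P i) h i x).
Proof.
move=> ih; elim: s => [|i s IH].
  by apply: eq_intble intble0 => x; rewrite big_nil.
case Pi : (P i); last by apply: eq_intble IH => x; rewrite big_cons Pi.
by apply: eq_intble (intbleD (ih i Pi) IH) => x; rewrite big_cons Pi.
Qed.

Lemma intble_bM f g (M : R) : intble mu f -> measurable_fun setT g ->
  (forall x, `|g x| <= M) -> intble mu (fun x => f x * g x).
Proof.
move=> i1 mg gM; have /intbleZ -/(_ M) : intble mu (fun x => `|f x|) by exact: integrable_norm.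
apply: intble_le; first by apply: measurable_funM => //; exact: intble_meas i1.
by move=> x /=; rewrite normrM mulrC ler_wpM2r.
Qed.

Lemma RID f g : intble mu f -> intble mu g ->
  \int[mu]_x (f x + g x) = \int[mu]_x f x + \int[mu]_x g x.
Proof. by move=> *; rewrite RintegralD. Qed.

Lemma RIZ c f : intble mu f -> \int[mu]_x (c * f x) = c * \int[mu]_x f x.
Proof. by move=> *; rewrite RintegralZl. Qed.

Lemma RIZr c f : intble mu f -> \int[mu]_x (f x * c) = (\int[mu]_x f x) * c.
Proof. by move=> *; rewrite RintegralZr. Qed.

Lemma RIN f : intble mu f -> \int[mu]_x (- f x) = - \int[mu]_x f x.
Proof.
move=> i1; rewrite -mulN1r -RIZ//; apply: eq_Rintegral => x _.
by rewrite mulN1r.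
Qed.

Lemma RIB f g : intble mu f -> intble mu g ->
  \int[mu]_x (f x - g x) = \int[mu]_x f x - \int[mu]_x g x.
Proof. by move=> i1 i2; rewrite RID ?RIN//; exact: intbleN. Qed.

Lemma RI0 : \int[mu]_x (0 : R) = 0.
Proof. by rewrite /Rintegral integral0. Qed.

Lemma RI_sum I (s : seq I) (P : pred I) (h : I -> T -> R) :
  (forall i, P i -> intble mu (h i)) ->
  \int[mu]_x (\sum_(i <- s | P i) h i x) = \sum_(i <- s | P i) \int[mu]_x h i x.
Proof.
move=> ih; elim: s => [|i s IH].
  by under eq_Rintegral do rewrite big_nil; rewrite big_nil RI0.
under eq_Rintegral do rewrite big_cons; rewrite big_cons.
case: ifPn => // Pi; rewrite RID ?IH//; first exact: ih.
exact: intble_sum.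
Qed.

Lemma RI_ae f g : measurable_fun setT f -> measurable_fun setT g ->
  {ae mu, forall x, f x = g x} -> \int[mu]_x f x = \int[mu]_x g x.
Proof.
move=> mf mg fg; congr fine; apply: ae_eq_integral => //.
- exact/measurable_EFinP.
- exact/measurable_EFinP.
- by apply: filterS fg => x /= -> _.
Qed.

Lemma intble_ae f g : measurable_fun setT g ->
  {ae mu, forall x, f x = g x} -> intble mu f -> intble mu g.
Proof.
move=> mg fg /integrableP[mf foo]; apply/integrableP; split.
  exact/measurable_EFinP.
rewrite (le_lt_trans _ foo)// le_eqVlt; apply/orP; left; apply/eqP.
apply: ge0_ae_eq_integral => //.
- exact/measurableT_comp/measurable_EFinP.
- exact/measurableT_comp.
- by apply: filterS fg => x /= -> _.
Qed.

Lemma le_norm_RI f : intble mu f -> `|\int[mu]_x f x| <= \int[mu]_x `|f x|.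
Proof. by move=> *; apply: le_normr_Rintegral. Qed.

Lemma RI_abs_eq0 f : intble mu f -> \int[mu]_x `|f x| = 0 -> {ae mu, forall x, f x = 0}.
Proof.
move=> intf f0.
have /integrable_norm in1 := intf.
have := integrable_fin_num measurableT in1.
move=> /fineK; rewrite -/(Rintegral mu setT (fun x => `|f x|)) f0.
move=> /esym i0.
have mf := intble_meas intf.
have /ae_eq_integral_abs : measurable_fun setT (EFin \o f) by exact/measurable_EFinP.
move=> /(_ mu measurableT)[+ _] => /(_ i0).
by apply: filterS => x /(_ I) [].
Qed.

Lemma DCT (f_ : nat -> T -> R) f g : (forall n, measurable_fun setT (f_ n)) ->
  measurable_fun setT f ->
  {ae mu, forall x, f_ n x @[n --> \oo] --> f x} ->
  intble mu g -> (forall n x, `|f_ n x| <= g x) ->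
  intble mu f /\ \int[mu]_x f_ n x @[n --> \oo] --> \int[mu]_x f x.
Proof.
move=> mf_ mf cf ig fg.
have [||/=||fi _ h] := @dominated_convergence _ _ _ mu _ measurableT
   (fun n => EFin \o f_ n) (EFin \o f) (EFin \o g) _ _ _ ig.
- by move=> n; exact/measurable_EFinP.
- exact/measurable_EFinP.
- by apply: filterS cf => x h _; apply: cvg_EFin; [exact: nearW|exact: h].
- by apply: nearW => x n _; rewrite lee_fin.
split=> //; apply: fine_cvg; rewrite fineK//.
by have := integrable_fin_num measurableT fi.
Qed.

End Integral.

Lemma ae_and d (T : measurableType d) (R : realType) (mu : {measure set T -> \bar R})
  (P Q : T -> Prop) : {ae mu, forall x, P x} -> {ae mu, forall x, Q x} ->
  {ae mu, forall x, P x /\ Q x}.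
Proof. by apply: filterS2 => x. Qed.

Lemma ae_forall d (T : measurableType d) (R : realType) (mu : {measure set T -> \bar R})
  (I : countType) (P : I -> T -> Prop) : (forall i, {ae mu, forall x, P i x}) ->
  {ae mu, forall x, forall i, P i x}.
Proof.
move=> h; pose Q n x := if unpickle n is Some i then P i x else True.
have : forall n, mu.-negligible [set x | ~ Q n x].
  move=> n; rewrite /Q; case: (unpickle n) => [i|]; first exact: h.
  by rewrite (_ : [set _ | _] = set0) ?seteqP//; [exact: negligible_set0|split => x //= /(_ I)].
move=> /negligible_bigcup.
apply: negligibleS => x /= /existsNP[i Pi]; exists (pickle i) => //=.
by rewrite /Q pickleK.
Qed.

(** * Product measures and Fubini's theorem for real-valued integrals *)

Section ProductMeasure.
Context d1 d2 (T1 : measurableType d1) (T2 : measurableType d2) (R : realType).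
Variable m1 : {sigma_finite_measure set T1 -> \bar R}.
Variable m2 : {sigma_finite_measure set T2 -> \bar R}.

Lemma product_measure_sigma_finite : sigma_finite setT (m1 \x m2)%E.
Proof.
have /sigma_finiteP[F [TF ndF Foo]] := sigma_finiteT m1.
have /sigma_finiteP[G [TG ndG Goo]] := sigma_finiteT m2.
exists (fun n => F n `*` G n).
  rewrite -setXTT TF TG predeqE => -[x y]; split.
    move=> [/= [n _ Fnx] [k _ Gky]]; exists (maxn n k) => //; split.
    - by move: x Fnx; exact/subsetPset/ndF/leq_maxl.
    - by move: y Gky; exact/subsetPset/ndG/leq_maxr.
  by move=> [n _ []/= ? ?]; split; exists n.
move=> k; have [mF Fk] := Foo k; have [mG Gk] := Goo k.
split; first exact: measurableX.
by rewrite product_measure1E// lte_mul_pinfty// ge0_fin_numE.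
Qed.

(* The library's canonical sigma-finite structure on [\x] is attached to
   products of subprobabilities only. *)
Definition prodm : {sigma_finite_measure set (T1 * T2)%type -> \bar R} :=
  HB.pack_for (SigmaFiniteMeasure.type (T1 * T2)%type R) (product_measure1 m1 m2)
    (Measure_isSigmaFinite.Build _ _ _ (product_measure1 m1 m2)
      product_measure_sigma_finite).

Lemma prodm_rect A B : measurable A -> measurable B ->
  prodm (A `*` B) = (m1 A * m2 B)%E.
Proof. exact: product_measure1E. Qed.

End ProductMeasure.
Arguments prodm : simpl never.

Section Fubini.
Context d1 d2 (T1 : measurableType d1) (T2 : measurableType d2) (R : realType).
Variable m1 : {sigma_finite_measure set T1 -> \bar R}.
Variable m2 : {sigma_finite_measure set T2 -> \bar R}.
Local Notation m12 := (prodm m1 m2).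
Implicit Types f : T1 * T2 -> R.

Lemma meas_sec1 f x : measurable_fun setT f -> measurable_fun setT (fun y => f (x, y)).
Proof. by move=> mf; exact: measurableT_comp. Qed.

Lemma meas_pint f : measurable_fun setT f ->
  measurable_fun setT (fun x => \int[m2]_y f (x, y)).
Proof.
move=> mf; apply: measurableT_comp => //.
have -> : (fun x => \int[m2]_y (f (x, y))%:E)%E = (fun x =>
    \int[m2]_y ((EFin \o f)^\+ (x, y)) - \int[m2]_y ((EFin \o f)^\- (x, y)))%E.
  apply/funext => x; rewrite integralE.
  under eq_integral do rewrite (funepos_comp (EFin \o f) (fun y => (x, y))).
  by under [X in (_ - X)%E = _]eq_integral do rewrite (funeneg_comp (EFin \o f) (fun y => (x, y))).
have mf' : measurable_fun setT (EFin \o f) by exact/measurable_EFinP.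
apply: emeasurable_funB.
  by apply: measurable_fun_fubini_tonelli_F => //; exact: measurable_funepos.
by apply: measurable_fun_fubini_tonelli_F => //; exact: measurable_funeneg.
Qed.

Lemma intble_sec1 f : intble m12 f -> {ae m1, forall x, intble m2 (fun y => f (x, y))}.
Proof. exact: ae_integrable1. Qed.

Lemma intble_sec2 f : intble m12 f -> {ae m2, forall y, intble m1 (fun x => f (x, y))}.
Proof. exact: ae_integrable2. Qed.

(** A real-valued integral is the [fine] part of the extended one, so an infinite inner integral is
    read as 0. The two versions agree only where the section is integrable, hence almost everywhere;
    this is what the real-valued Fubini statements below have to absorb. *)
Let fineF f : intble m12 f ->
  {ae m1, forall x, (\int[m2]_y f (x, y))%:E = (\int[m2]_y (f (x, y))%:E)%E}.
Proof.
move=> i1; apply: filterS (intble_sec1 i1) => x ix.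
by rewrite fineK//; have := integrable_fin_num measurableT ix.
Qed.

Let fineG f : intble m12 f ->
  {ae m2, forall y, (\int[m1]_x f (x, y))%:E = (\int[m1]_x (f (x, y))%:E)%E}.
Proof.
move=> i1; apply: filterS (intble_sec2 i1) => x ix.
by rewrite fineK//; have := integrable_fin_num measurableT ix.
Qed.

Lemma intble_pint f : intble m12 f -> intble m1 (fun x => \int[m2]_y f (x, y)).
Proof.
move=> i1; have i2 := integrable_fubini_F i1.
have mf := meas_pint (intble_meas i1).
move: i2 => /integrableP[mF Foo]; apply/integrableP; split; first exact/measurable_EFinP.
rewrite (le_lt_trans _ Foo)// le_eqVlt; apply/orP; left; apply/eqP.
apply: ge0_ae_eq_integral => //.
- exact/measurableT_comp/measurable_EFinP.
- exact/measurableT_comp.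
- by apply: filterS (fineF i1) => x h _; exact: (congr1 abse h).
Qed.

Lemma RI_fubini1 f : intble m12 f ->
  \int[m1]_x \int[m2]_y f (x, y) = \int[m12]_z f z.
Proof.
move=> i1; congr fine; rewrite -(integral12_prod_meas1 i1).
apply: ae_eq_integral => //.
- exact/measurable_EFinP/meas_pint/intble_meas/i1.
- exact: (measurable_fubini_F i1).
- by apply: filterS (fineF i1) => x /= h _.
Qed.

Lemma RI_fubini2 f : intble m12 f ->
  \int[m2]_y \int[m1]_x f (x, y) = \int[m12]_z f z.
Proof.
move=> i1; congr fine; rewrite -(integral21_prod_meas1 i1).
have mf' : measurable_fun setT (EFin \o f) by exact/measurable_EFinP/intble_meas/i1.
apply: ae_eq_integral => //.
- apply/measurable_EFinP; apply: measurableT_comp => //.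
  exact: (measurable_fubini_G i1).
- exact: (measurable_fubini_G i1).
- by apply: filterS (fineG i1) => x /= h _.
Qed.

Lemma intble_prod (f : T1 -> R) (g : T2 -> R) : intble m1 f -> intble m2 g ->
  intble m12 (fun z => f z.1 * g z.2).
Proof.
move=> i1 i2.
have mf := intble_meas i1; have mg := intble_meas i2.
apply/integrable12ltyP.
  by apply/measurable_EFinP/measurable_funM; exact: measurableT_comp.
under eq_integral => x _.
  rewrite (_ : (fun y => _) = (fun y => (`|f x|)%:E * (`|g y|)%:E)%E); last first.
    by apply/funext => y /=; rewrite normrM EFinM.
  rewrite ge0_integralZl//; last exact/measurable_EFinP/measurableT_comp.
  rewrite muleC.
  over.
rewrite ge0_integralZl//=.
- apply: lte_mul_pinfty; first exact: integral_ge0.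
    have /integrable_norm i2' := i2.
    exact: (integrable_fin_num measurableT i2').
  by move: i1 => /integrableP[].
- exact/measurable_EFinP/measurableT_comp.
- exact: integral_ge0.
Qed.

Lemma RI_prod (f : T1 -> R) (g : T2 -> R) : intble m1 f -> intble m2 g ->
  \int[m12]_z (f z.1 * g z.2) = \int[m1]_x f x * \int[m2]_y g y.
Proof.
move=> i1 i2; rewrite -RI_fubini1/=; last exact: intble_prod.
under eq_Rintegral do rewrite RIZ//.
by rewrite RIZr.
Qed.

Lemma ae_prod1 (P : T1 * T2 -> Prop) : {ae m12, forall z, P z} ->
  {ae m1, forall x, {ae m2, forall y, P (x, y)}}.
Proof.
move=> [N [mN N0 PN]].
have : {ae m1, forall x, m2 (xsection N x) = 0%E}.
  have mx : measurable_fun setT (m2 \o xsection N) by exact: measurable_fun_xsection.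
  have /(ae_eq_integral_abs m1 measurableT)[h _] := mx.
  have /h : (\int[m1]_x `|(m2 \o xsection N) x| = 0)%E.
    rewrite -[RHS]N0; apply: eq_integral => x _ /=.
    by rewrite gee0_abs.
  by apply: filterS => x /(_ I).
apply: filterS => x Nx; exists (xsection N x); split=> //.
  exact: measurable_xsection.
move=> y /= nP; rewrite /xsection/= inE; exact: PN.
Qed.

(** The measure of the complement of [P] is the integral of the measures of its sections, which
    vanish almost everywhere. *)
Lemma ae_prodr (P : T1 * T2 -> Prop) : measurable [set z | P z] ->
  {ae m1, forall x, {ae m2, forall y, P (x, y)}} -> {ae m12, forall z, P z}.
Proof.
move=> mP h; exists (~` [set z | P z]); split=> //; first exact: measurableC.
rewrite /product_measure1/= -[RHS](integral0 m1 setT).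
apply: ae_eq_integral => //.
- by apply: measurable_fun_xsection; exact: measurableC.
- apply: filterS h => x [N [mN N0 PN]] _ /=.
  apply/eqP; rewrite eq_le measure_ge0 andbT -[leRHS]N0.
  apply: le_measure; rewrite ?inE//.
    by apply: measurable_xsection; exact: measurableC.
  by move=> y; rewrite /xsection/= inE => nP; exact: PN.
Qed.

End Fubini.

(** * Measure-preserving maps and permutations of coordinates *)

Section MeasurePreserving.
Context d1 d2 (X : measurableType d1) (Y : measurableType d2) (R : realType).

Definition measure_preserving (m1 : {measure set X -> \bar R})
    (m2 : {measure set Y -> \bar R}) (phi : X -> Y) :=
  measurable_fun setT phi /\ forall A, measurable A -> m1 (phi @^-1` A) = m2 A.

Variables (m1 : {measure set X -> \bar R}) (m2 : {measure set Y -> \bar R}).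
Variable phi : X -> Y.
Hypothesis mphi : measure_preserving m1 m2 phi.

Let pre_meas A : measurable A -> measurable (phi @^-1` A).
Proof. by move=> mA; rewrite -[X in measurable X]setTI; exact: mphi.1. Qed.

Lemma mpres_ae (P : Y -> Prop) : {ae m2, forall y, P y} -> {ae m1, forall x, P (phi x)}.
Proof.
move=> [N [mN N0 PN]]; exists (phi @^-1` N); split.
- exact: pre_meas.
- by rewrite mphi.2.
- by move=> x /= h; apply: PN.
Qed.

Lemma ge0_mpres (f : Y -> \bar R) : measurable_fun setT f -> (forall y, 0 <= f y)%E ->
  (\int[m1]_x f (phi x) = \int[m2]_y f y)%E.
Proof.
move=> mf f0.
have := ge0_integral_pushforward mphi.1 m1 measurableT mf (fun y _ => f0 y).
rewrite preimage_setT => <-; apply: eq_measure_integral => [|? A mA _ /=].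
  by move=> ?; exact: mphi.1.
by rewrite /pushforward mphi.2.
Qed.

Lemma mpres_intble (f : Y -> R) : intble m2 f -> intble m1 (fun x => f (phi x)).
Proof.
move=> /integrableP[mf foo]; apply/integrableP; split.
  exact: (measurableT_comp mf mphi.1).
by rewrite (ge0_mpres (f := fun y => `|(f y)%:E|%E))//; exact: measurableT_comp.
Qed.

Lemma mpres_RI (f : Y -> R) : intble m2 f -> \int[m1]_x f (phi x) = \int[m2]_y f y.
Proof.
move=> /[dup] i2 /mpres_intble i1; congr fine.
have mf := measurable_int _ i2.
rewrite integralE [RHS]integralE.
under eq_integral do rewrite (funepos_comp (EFin \o f) phi).
under [X in (_ - X)%E = _]eq_integral do rewrite (funeneg_comp (EFin \o f) phi).
by rewrite !ge0_mpres//; [exact: measurable_funeneg|exact: measurable_funepos].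
Qed.

End MeasurePreserving.

Lemma mpres_comp d1 d2 d3 (X : measurableType d1) (Y : measurableType d2)
  (Z : measurableType d3) (R : realType) (m1 : {measure set X -> \bar R})
  (m2 : {measure set Y -> \bar R}) (m3 : {measure set Z -> \bar R})
  (phi : X -> Y) (psi : Y -> Z) : measure_preserving m1 m2 phi ->
  measure_preserving m2 m3 psi -> measure_preserving m1 m3 (psi \o phi).
Proof.
move=> [mp p] [mq q]; split; first exact: measurableT_comp.
move=> A mA; rewrite comp_preimage p ?q//.
by rewrite -[X in measurable X]setTI; exact: mq.
Qed.

(** Uniqueness of the product measure, applied to the pushforward of [m] along [phi], reduces the
    claim to rectangles. *)
Lemma mpres_rect d1 d2 d3 (X : measurableType d1) (Y : measurableType d2)
  (W : measurableType d3) (R : realType) (m1 : {sigma_finite_measure set X -> \bar R})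
  (m2 : {sigma_finite_measure set Y -> \bar R}) (m : {measure set W -> \bar R})
  (phi : W -> X * Y) : measurable_fun setT phi ->
  (forall A B, measurable A -> measurable B -> m (phi @^-1` (A `*` B)) = (m1 A * m2 B)%E) ->
  measure_preserving m (prodm m1 m2) phi.
Proof.
move=> mphi h; split => // S mS; apply/esym.
pose nu := measure_function_pushforward__canonical__measure_function_Measure m mphi.
exact: (@product_measure_unique _ _ _ _ _ m1 m2 nu h _ mS).
Qed.

Section Swap.
Context d1 d2 d3 (X : measurableType d1) (Y : measurableType d2)
  (Z : measurableType d3).

Definition swap23 (A B C : Type) (v : A * B * C) : A * C * B := (v.1.1, v.2, v.1.2).

Lemma meas_swap23 : measurable_fun [set: X * Y * Z] (@swap23 X Y Z).
Proof.
apply: measurable_fun_pair; first apply: measurable_fun_pair.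
- exact: measurableT_comp.
- exact: measurable_snd.
- exact: measurableT_comp.
Qed.

End Swap.

(** The first side [A] of the rectangle is an arbitrary measurable subset of X * Z, so its preimage
    need not be a product; its measure is computed by sections in Z and Tonelli in X * Y. *)
Lemma mpres_swap23 d1 d2 d3 (X : measurableType d1) (Y : measurableType d2)
  (Z : measurableType d3) (R : realType) (m1 : {sigma_finite_measure set X -> \bar R})
  (m2 : {sigma_finite_measure set Y -> \bar R})
  (m3 : {sigma_finite_measure set Z -> \bar R}) :
  measure_preserving (prodm (prodm m1 m2) m3) (prodm (prodm m1 m3) m2) (@swap23 X Y Z).
Proof.
have mm : measurable_fun [set: X * Y * Z] (@swap23 X Y Z) by exact: meas_swap23.
apply: (mpres_rect mm) => A B mA mB.
set S' := _ @^-1` _.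
have mA' : measurable_fun setT (m3 \o xsection A) by exact: measurable_fun_xsection.
transitivity (\int[prodm m1 m2]_z (m3 (xsection A z.1) * (\1_B z.2)%:E))%E.
  have mS' : measurable S'.
    by rewrite -[S']setTI; apply: mm => //; exact: measurableX.
  transitivity (\int[prodm m1 m2]_z m3 (xsection S' z))%E.
    by [].
  apply: eq_integral => z _.
  have [zB|zB] := boolP (z.2 \in B).
    rewrite indicE zB mule1; congr (m3 _); apply/seteqP; split => t.
      by rewrite /xsection/= !inE => -[].
    by rewrite /xsection/= !inE => At; split => //=; exact/set_mem.
  rewrite indicE (negbTE zB) mule0 (_ : xsection _ _ = set0) ?measure0//.
  apply/seteqP; split => t //; rewrite /xsection/= inE => -[_ /=].
  by move=> /mem_set; rewrite (negbTE zB).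
rewrite fubini_tonelli1/=; last 2 first.
  apply: emeasurable_funM.
    exact: (measurableT_comp mA').
  by apply/measurable_EFinP; apply: measurableT_comp => //; exact: measurable_indic.
  by move=> z; rewrite mule_ge0// lee_fin indicE.
transitivity (\int[m1]_x (m3 (xsection A x) * m2 B))%E.
  apply: eq_integral => x _; rewrite /fubini_F/= ge0_integralZl//.
    by rewrite integral_indic// setIT.
  by apply/measurable_EFinP; exact: measurable_indic.
by rewrite ge0_integralZr.
Qed.

Lemma mpres_prod d1 d2 d3 (X : measurableType d1) (Y : measurableType d2)
  (Z : measurableType d3) (R : realType) (m1 : {sigma_finite_measure set X -> \bar R})
  (m2 : {sigma_finite_measure set Y -> \bar R})
  (m3 : {sigma_finite_measure set Z -> \bar R}) (phi : X -> Y) :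
  measure_preserving m1 m2 phi ->
  measure_preserving (prodm m1 m3) (prodm m2 m3) (fun z => (phi z.1, z.2)).
Proof.
move=> mphi.
have mm : measurable_fun [set: X * Z] (fun z => (phi z.1, z.2)).
  apply: measurable_fun_pair; last exact: measurable_snd.
  by apply: measurableT_comp => //; exact: mphi.1.
apply: (mpres_rect mm) => A B mA mB.
have mA' : measurable (phi @^-1` A).
  by rewrite -[X in measurable X]setTI; exact: mphi.1.
rewrite -[LHS]/(prodm m1 m3 ((phi @^-1` A) `*` B)).
by rewrite prodm_rect// mphi.2.
Qed.

(** * One-variable test functions *)

Section Bumps.
Variable R : realType.
Implicit Types x y c p q : R.

(** A smooth function is carried together with all its derivatives, [h n] being the n-th; smoothness
    then passes through sums, products and primitives without iterating an abstract derivative. *)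
Definition derivatives (h : nat -> R -> R) :=
  forall n x, is_derive x 1 (h n) (h n.+1 x).

Lemma derivatives_cont h n : derivatives h -> continuous (h n).
Proof.
move=> dh x; apply: differentiable_continuous; apply/derivable1_diffP.
by have [] := dh n x.
Qed.

Lemma poly_expRN_bounded (p : {poly R}) :
  exists C : R, forall t : R, 0 <= t -> `|p.[t] * expR (- t)| <= C.
Proof.
have : forall k, exists D : R, forall t : R, 0 <= t -> `|t ^+ k * expR (- t)| <= D.
  move=> k; exists (k`!%:R) => t t0.
  rewrite ger0_norm ?mulr_ge0 ?exprn_ge0 ?expR_ge0//.
  rewrite expRN ler_pdivrMr ?expR_gt0//.
  case: k => [|k]; first by rewrite expr0 mul1r (le_trans _ (expR_ge1Dx t))// lerDl.
  rewrite -ler_pdivrMl ?ltr0n ?fact_gt0//.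
  by rewrite mulrC (le_trans _ (expR_ge1Dxn k t0))// lerDr.
move=> /choice[D hD].
exists (\sum_(i < size p) `|p`_i| * D i) => t t0.
rewrite horner_coef !mulr_suml (le_trans (ler_norm_sum _ _ _))//.
by apply: ler_sum => i _; rewrite -!mulrA normrM ler_wpM2l// hD.
Qed.

(** The derivative of p(1/x) exp(-1/x) is q(1/x) exp(-1/x) with q = X^2 (p - p'), which is the
    recursion here. *)
Fixpoint flat_poly n : {poly R} :=
  if n is n'.+1 then 'X^2 * (flat_poly n' - (flat_poly n')^`()) else 1.

(* The derivatives of the smooth function equal to [exp (- 1 / x)] on [x > 0]
   and to 0 elsewhere. *)
Definition flat n x := if 0 < x then (flat_poly n).[x^-1] * expR (- x^-1) else 0.

Lemma flat_derivatives : derivatives flat.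
Proof.
move=> n x; have [x0|x0|<-] := ltgtP 0 x.
- apply: (@near_eq_is_derive _ _ _ (fun x => (flat_poly n).[x^-1] * expR (- x^-1))).
    near=> y; rewrite /flat ifT//; near: y; exact: lt_nbhsr.
  have xV : is_derive x 1 (fun y => y^-1) (- x ^- 2 *: 1).
    by apply: is_deriveV; rewrite gt_eqF.
  have d1 := @is_derive1_comp R (horner (flat_poly n)) (fun y => y^-1) x _ _
    (is_derive_poly _ _) xV.
  have xVN := is_deriveN xV.
  have d2 := @is_derive1_comp R expR _ x _ _ (is_derive_expR _) xVN.
  have d3 := is_deriveM d1 d2.
  apply: (is_derive_eq d3).
  rewrite -[LHS]/((flat_poly n).[x^-1] * (expR (- x^-1) * - (- x ^- 2 * 1))
     + expR (- x^-1) * ((flat_poly n)^`().[x^-1] * (- x ^- 2 * 1))).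
  rewrite /flat x0 /= hornerM hornerXn hornerD hornerN -exprVn; ring.
- apply: (@near_eq_is_derive _ _ _ (cst 0)).
    near=> y; rewrite /flat ifF//; apply/negbTE; rewrite -leNgt ltW//.
    by near: y; exact: lt_nbhsl.
  by rewrite /flat ltNge (ltW x0)/=; exact: is_derive_cst.
(* At 0 and for h > 0 the difference quotient is p(1/h) exp(-1/h) / h. The factor ['X^2] turns it
   into h times a bounded quantity, so it is squeezed to 0. *)
- have [C hC] := poly_expRN_bounded ('X^2 * flat_poly n).
  have C0 : 0 <= C by apply: le_trans (hC 0 (lexx _)).
  have : (fun h : R => C * `|h|) @ (0 : R)^' --> C * `|0 : R|.
    by apply: cvgMr; apply: cvg_norm; exact: cvg_within.
  rewrite normr0 mulr0 => cl.
  have cv : (fun h : R => h^-1 *: (flat n (h *: 1 + 0) - flat n 0)) @ 0^' --> (0 : R).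
    apply: (@squeeze_cvgr _ _ _ _ (fun h => - (C * `|h|)) (fun h => C * `|h|)).
    + near=> h; rewrite -ler_norml.
      rewrite {2}/flat ltxx subr0 addr0 [h *: 1]mulr1 /flat; case: ifPn => h0; last first.
        by rewrite scaler0 normr0 mulr_ge0.
      have hV : 0 <= h^-1 by rewrite invr_ge0 ltW.
      have := hC h^-1 hV; rewrite !hornerE/= => hb.
      rewrite [_ *: _](_ : _ = (h^-1 ^+ 2 * (flat_poly n).[h^-1] * expR (- h^-1)) * h); last first.
        rewrite -[LHS]/(h^-1 * ((flat_poly n).[h^-1] * expR (- h^-1))).
        by field; rewrite gt_eqF.
      by rewrite normrM ler_wpM2r.
    + by rewrite -[X in _ --> X]oppr0; exact: cvgN.
    + by [].
  have fl : flat n.+1 0 = 0 by rewrite /flat ltxx.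
  rewrite fl; constructor; first by apply/cvg_ex; exists 0.
  exact: cvg_lim cv.
Unshelve. all: by end_near. Qed.

Lemma derivatives_affine h a b : derivatives h ->
  derivatives (fun n x => a ^+ n * h n (a * x + b)).
Proof.
move=> dh n x.
have d1 : is_derive x 1 (fun y => a * y + b) a.
  have := is_deriveD (is_deriveZ a (is_derive_id x 1)) (is_derive_cst b x 1).
  by rewrite addr0 [a *: 1]mulr1.
have d2 := @is_derive1_comp R (h n) (fun y => a * y + b) x _ _ (dh n (a * x + b)) d1.
have := is_deriveZ (a ^+ n) d2.
by rewrite -[_ *: _]/(a ^+ n * (h n.+1 (a * x + b) * a)) mulrCA mulrC exprSr mulrAC.
Qed.

Lemma derivatives_lin h g a b : derivatives h -> derivatives g ->
  derivatives (fun n x => a * h n x + b * g n x).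
Proof.
move=> dh dg n x.
exact: (is_deriveD (is_deriveZ a (dh n x)) (is_deriveZ b (dg n x))).
Qed.

(** Leibniz's rule expanded into 2^n terms, free of binomial coefficients; the offsets [i] and [j]
    make the recursion close. *)
Fixpoint leibniz (f g : nat -> R -> R) n i j : R -> R :=
  if n is n'.+1 then fun x => leibniz f g n' i.+1 j x + leibniz f g n' i j.+1 x
  else fun x => f i x * g j x.

Lemma derivatives_mul f g : derivatives f -> derivatives g ->
  derivatives (fun n => leibniz f g n 0 0).
Proof.
move=> df dg n x.
suff: forall i j, is_derive x 1 (leibniz f g n i j) (leibniz f g n.+1 i j x) by [].
elim: n => [|n IH] i j.
  apply: (is_derive_eq (is_deriveM (df i x) (dg j x))).
  by rewrite -[LHS]/(f i x * g j.+1 x + g j x * f i.+1 x) addrC mulrC.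
exact: (is_deriveD (IH i.+1 j) (IH i j.+1)).
Qed.

Lemma leibniz_eq0 f g n i j x :
  (forall k, f k x = 0) \/ (forall k, g k x = 0) -> leibniz f g n i j x = 0.
Proof.
move=> h; elim: n i j => [|n IH] i j /=; last by rewrite !IH addr0.
by case: h => ->; rewrite ?mul0r ?mulr0.
Qed.

Definition test1 (lo hi : R) (h : nat -> R -> R) :=
  derivatives h /\
  exists p q, [/\ lo < p, q < hi & forall n x, ~~ (p <= x <= q) -> h n x = 0].

(** The function exp(-c/(x-p)) exp(-c/(q-x)) on ]p, q[ and 0 elsewhere. As c tends to 0 it tends to
    the indicator of ]p, q[, which is why the scale [c] is kept as a parameter. *)
Definition bump c p q n := leibniz
  (fun n x => c^-1 ^+ n * flat n (c^-1 * x + (- c^-1 * p)))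
  (fun n x => (- c^-1) ^+ n * flat n (- c^-1 * x + (c^-1 * q))) n 0 0.

Lemma bump_derivatives c p q : derivatives (bump c p q).
Proof. by apply: derivatives_mul; apply: derivatives_affine; exact: flat_derivatives. Qed.

Lemma bump_out c p q n x : 0 < c -> ~~ (p <= x <= q) -> bump c p q n x = 0.
Proof.
move=> c0; have cV : 0 < c^-1 by rewrite invr_gt0.
rewrite negb_and -!ltNge => /orP[xp|qx]; apply: leibniz_eq0; [left|right] => k.
  by rewrite /flat ifF ?mulr0//; apply/negbTE; rewrite -leNgt; nra.
by rewrite /flat ifF ?mulr0//; apply/negbTE; rewrite -leNgt; nra.
Qed.

Lemma bump_test1 c p q lo hi : 0 < c -> lo < p -> q < hi -> test1 lo hi (bump c p q).
Proof.
move=> c0 lp qh; split; first exact: bump_derivatives.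
by exists p, q; split => // n x; exact: bump_out.
Qed.

Lemma bump0E c p q x : 0 < c ->
  bump c p q 0 x = if p < x < q then expR (- (c / (x - p))) * expR (- (c / (q - x))) else 0.
Proof.
move=> c0; have cV : 0 < c^-1 by rewrite invr_gt0.
rewrite /bump/= !expr0 !mul1r /flat /= !hornerE.
have -> : (0 < c^-1 * x + - c^-1 * p) = (p < x).
  by rewrite mulNr -mulrBr pmulr_rgt0// subr_gt0.
have -> : (0 < - c^-1 * x + c^-1 * q) = (x < q).
  by rewrite mulNr addrC -mulrBr pmulr_rgt0// subr_gt0.
case: ltP => px; case: ltP => xq; rewrite ?(mul0r, mulr0)//=.
congr (expR (- _) * expR (- _)).
  by rewrite mulNr -mulrBr invfM invrK.
by rewrite mulNr addrC -mulrBr invfM invrK.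
Qed.

Lemma bump0_ge0 c p q x : 0 < c -> 0 <= bump c p q 0 x <= 1.
Proof.
move=> c0; rewrite bump0E//; case: ifPn => [/andP[px xq]|_]; last by rewrite lexx ler01.
have h y : 0 < y -> expR (- (c / y)) <= 1.
  by move=> y0; rewrite expR_le1 oppr_le0 ltW// divr_gt0.
by rewrite mulr_ge0 ?expR_ge0//= mulr_ile1 ?expR_ge0 ?h ?subr_gt0.
Qed.

Lemma compact_cont_bounded (V : topologicalType) (K : set V) (f : V -> R) :
  compact K -> {within K, continuous f} ->
  exists2 M : R, 0 < M & forall x : V, K x -> `|f x| <= M.
Proof.
move=> cK cf; have /compact_bounded[M [_ hM]] := continuous_compact cf cK.
exists (Num.max 0 M + 1); first by rewrite ltr_wpDl// le_max lexx.
move=> x Kx; apply: (hM (Num.max 0 M + 1)).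
  by rewrite ltr_pwDr// le_max lexx orbT.
by exists x.
Qed.

Lemma test1_bounded lo hi h n : test1 lo hi h -> exists2 M : R, 0 < M & forall x, `|h n x| <= M.
Proof.
move=> [dh [p [q [_ _ h0]]]].
have [M M0 hM] := @compact_cont_bounded _ _ (h n) (@segment_compact R p q)
  (continuous_subspaceT (derivatives_cont dh)).
exists M => // x; have [xpq|/h0 ->] := boolP (p <= x <= q).
  by apply: hM; rewrite /= in_itv.
by rewrite normr0 ltW.
Qed.

Local Notation L := (lebesgue_measure : {sigma_finite_measure set (measurableTypeR R) -> \bar R}).

Lemma itv_intble (p q : R) : intble L (\1_`[p, q] : R -> R).
Proof. exact: integrable_indic_itv. Qed.

Lemma cont_meas (f : R -> R) : continuous f -> measurable_fun [set: measurableTypeR R] f.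
Proof. exact: continuous_measurable_fun. Qed.

Lemma test1_intble lo hi h n : test1 lo hi h -> intble L (h n).
Proof.
move=> th; have [M M0 hM] := test1_bounded n th.
have [dh [p [q [_ _ h0]]]] := th.
apply: (@intble_le _ _ _ L _ (fun x => M * \1_`[p, q] x)).
- exact: (cont_meas (derivatives_cont dh)).
- move=> x; have [xpq|/h0 ->] := boolP (p <= x <= q); last first.
    by rewrite normr0 mulr_ge0 ?indic_ge0// ltW.
  by rewrite indicE mem_set/= ?in_itv// mulr1.
- exact/intbleZ/itv_intble.
Qed.

Definition prim (h : nat -> R -> R) x := \int[L]_(t in `]-oo, x]) h 0%N t.

Lemma prim_derive_cont (h : nat -> R -> R) x : continuous (h 0%N) -> intble L (h 0%N) ->
  is_derive x 1 (prim h) (h 0%N x).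
Proof.
move=> ch ih; have xx : x < x + 1 by rewrite ltrDl.
have i1 : lebesgue_measure.-integrable `]-oo, (x + 1)] (EFin \o h 0%N).
  by apply: (@integrableS _ _ _ L setT) => //.
have [||d1 d2] := continuous_FTC1 xx i1; first by rewrite ltNyr.
  exact: ch.
by rewrite derive1E in d2; exact: (DeriveDef d1 d2).
Qed.

Lemma prim_derive lo hi h x : test1 lo hi h -> is_derive x 1 (prim h) (h 0%N x).
Proof.
move=> th; apply: prim_derive_cont; last exact: (test1_intble 0 th).
exact: (derivatives_cont th.1).
Qed.

Lemma primE h x : prim h x = \int[L]_t (\1_(`]-oo, x]%classic) t * h 0%N t).
Proof.
rewrite /prim Rintegral_mkcond; apply: eq_Rintegral => t _.
by rewrite patchE indicE; case: ifPn => _; rewrite ?mul1r ?mul0r.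
Qed.

(* With [c] the integral of [h], [c w - h] has integral 0, so that its primitive
   again has compact support. *)
Definition corrector (w h : nat -> R -> R) n x :=
  if n is k.+1 then (\int[L]_t h 0%N t) * w k x - h k x
  else (\int[L]_t h 0%N t) * prim w x - prim h x.

Lemma corrector_test1 lo hi w h : test1 lo hi w -> \int[L]_t w 0%N t = 1 ->
  test1 lo hi h -> test1 lo hi (corrector w h).
Proof.
move=> tw w1 th; split.
  move=> [|n] x.
    exact: (is_deriveB (is_deriveZ _ (prim_derive x tw)) (prim_derive x th)).
  exact: (is_deriveB (is_deriveZ _ (tw.1 n x)) (th.1 n x)).
have [_ [p [q [lp qh w0]]]] := tw; have [_ [p' [q' [lp' qh' h0]]]] := th.
exists (Num.min p p'), (Num.max q q'); split; rewrite ?lt_min ?gt_max ?lp ?qh//.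
move=> n x; rewrite ge_min le_max => xpq.
have {xpq} [xp|qx] : (x < p /\ x < p') \/ (q < x /\ q' < x).
  move: xpq; rewrite negb_and !negb_or -!ltNge.
  by case/orP=> /andP[]; [left|right].
- have w0' k : w k x = 0 by rewrite w0// leNgt xp.1.
  have h0' k : h k x = 0 by rewrite h0// leNgt xp.2.
  case: n => [|n] /=; last by rewrite w0' h0' mulr0 subr0.
  suff pr0 g r : (forall y, y < r -> g 0%N y = 0) -> x < r -> prim g x = 0.
    rewrite (pr0 w p) ?(pr0 h p') ?mulr0 ?subr0//; [|exact: xp.2| |exact: xp.1].
      by move=> y yp; rewrite h0// leNgt yp.
    by move=> y yp; rewrite w0// leNgt yp.
  move=> g0 xr; rewrite primE -[RHS](RI0 L); apply: eq_Rintegral => t _.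
  rewrite indicE; have [/set_mem/=|_] := boolP (t \in _); last by rewrite mul0r.
  by rewrite in_itv/= => tx; rewrite g0 ?mulr0// (le_lt_trans tx).
(* To the right of both supports the primitive of [w] equals 1 and that of [h] equals its full
   integral, so the two terms of the corrector cancel. *)
- have w0' k : w k x = 0 by rewrite w0// (leNgt x) qx.1 andbF.
  have h0' k : h k x = 0 by rewrite h0// (leNgt x) qx.2 andbF.
  case: n => [|n] /=; last by rewrite w0' h0' mulr0 subr0.
  suff pr0 g r : (forall y, r < y -> g 0%N y = 0) -> r < x -> prim g x = \int[L]_t g 0%N t.
    rewrite (pr0 w q) ?(pr0 h q') ?w1 ?mulr1 ?subrr//; [|exact: qx.2| |exact: qx.1].
      by move=> y yp; rewrite h0// (leNgt y) yp andbF.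
    by move=> y yp; rewrite w0// (leNgt y) yp andbF.
  move=> g0 xr; rewrite primE; apply: eq_Rintegral => t _.
  rewrite indicE; have [_|] := boolP (t \in _); first by rewrite mul1r.
  rewrite notin_setE/= in_itv/= => /negP; rewrite -ltNge => xt.
  by rewrite g0 ?mulr0// (lt_trans xr).
Qed.

Lemma unit_test1 lo hi : lo < hi -> exists w, test1 lo hi w /\ \int[L]_t w 0%N t = 1.
Proof.
move=> lh; pose p := lo + (hi - lo) / 3; pose q := hi - (hi - lo) / 3.
have lp : lo < p by rewrite /p; lra.
have qh : q < hi by rewrite /q; lra.
have pq : p < q by rewrite /p /q; lra.
have tb : test1 lo hi (bump 1 p q) by exact: bump_test1.
pose I := \int[L]_t bump 1 p q 0%N t.
have I0 : I != 0.
  apply/eqP => I0.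
  have /(RI_abs_eq0 (test1_intble 0 tb)) : \int[L]_t `|bump 1 p q 0%N t| = 0.
    rewrite -[RHS]I0; apply: eq_Rintegral => t _.
    by rewrite ger0_norm//; have /andP[] := bump0_ge0 p q t ltr01.
  move=> [N [mN N0 hN]].
  have pqN : `]p, q[%classic `<=` N.
    move=> x; rewrite /= in_itv/= => /andP[px xq]; apply: hN => /=.
    rewrite bump0E// px xq/= => /eqP.
    by rewrite mulf_eq0 !expR_eq0.
  have : (L `]p, q[%classic <= L N)%E by apply: le_measure; rewrite ?inE//; exact: measurable_itv.
  rewrite N0 /= lebesgue_measure_itv/= lte_fin pq -EFinD lee_fin.
  by rewrite leNgt subr_gt0 pq.
(* Normalised bump; the summand with coefficient 0 puts it in the form expected by
   [derivatives_lin]. *)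
exists (fun n x => I^-1 * bump 1 p q n x + 0 * bump 1 p q n x); split.
  split; first by apply: derivatives_lin; exact: bump_derivatives.
  by exists p, q; split => // n x /bump_out ->; rewrite ?mulr0 ?addr0.
under eq_Rintegral do rewrite mul0r addr0.
by rewrite RIZ ?mulVf//; exact: (test1_intble 0 tb).
Qed.

(** A countable family of test functions: for fixed rational r they tend to the indicator of ]lo,
    min(hi, r)[. The margin 1/(n+1) keeps the support inside the open interval, and the bump is 0 if
    the margins cross. Countability lets a statement true almost everywhere for each index hold for
    all indices off one null set. *)
Definition bumps lo hi (i : nat * rat) := bump i.1.+1%:R^-1 (lo + i.1.+1%:R^-1)
  (Num.min hi (ratr i.2) - i.1.+1%:R^-1).

Lemma bumps_test1 lo hi i : test1 lo hi (bumps lo hi i).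
Proof.
have i0 : 0 < i.1.+1%:R^-1 :> R by rewrite invr_gt0 ltr0n.
apply: bump_test1 => //; first by rewrite ltrDl.
by rewrite ltrBlDr (@le_lt_trans _ _ hi)// ?ge_min ?lexx// ltrDl.
Qed.

Lemma bumps_cvg lo hi r x :
  bumps lo hi (n, r) 0%N x @[n --> \oo] --> (\1_(`]lo, Num.min hi (ratr r)[%classic) x : R).
Proof.
set s := Num.min hi (ratr r).
have i0 n : 0 < n.+1%:R^-1 :> R by rewrite invr_gt0 ltr0n.
have cn : n.+1%:R^-1 @[n --> \oo] --> (0 : R) by exact: cvg_harmonic.
rewrite indicE; have [/set_mem/=|] := boolP (x \in _); last first.
  rewrite notin_setE/= in_itv/= => /negP xls.
  apply: cvg_near_cst; apply: nearW => n.
  rewrite /bumps bump0E//= ifF//; apply/negbTE; apply: contra xls => /andP[h1 h2].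
  apply/andP; split; first by rewrite (lt_trans _ h1)// ltrDl.
  by rewrite (lt_trans h2)// gtrBl.
rewrite in_itv/= => /andP[lx xs].
have : expR (- (n.+1%:R^-1 / (x - (lo + n.+1%:R^-1)))) *
  expR (- (n.+1%:R^-1 / (s - n.+1%:R^-1 - x))) @[n --> \oo] --> (1 : R).
  have cexp (u : nat -> R) (l : R) : l != 0 -> u n @[n --> \oo] --> l ->
      expR (- (n.+1%:R^-1 / u n)) @[n --> \oo] --> (1 : R).
    move=> l0 ul; suff h : - (n.+1%:R^-1 / u n) @[n --> \oo] --> (0 : R).
      rewrite -[X in _ --> X]expR0.
      by apply: continuous_cvg; [exact: continuous_expR|exact: h].
    rewrite -[X in _ --> X]oppr0; apply: cvgN.
    by rewrite -[X in _ --> X](mul0r l^-1); apply: cvgM => //; exact: cvgV.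
  rewrite -[X in _ --> X]mulr1; apply: cvgM.
    apply: (cexp _ (x - lo)); first by rewrite subr_eq0 gt_eqF.
    by rewrite -[X in x - X]addr0; apply: cvgB; [exact: cvg_cst|apply: cvgD => //; exact: cvg_cst].
  apply: (cexp _ (s - x)); first by rewrite subr_eq0 gt_eqF.
  apply: cvgB; last exact: cvg_cst.
  by rewrite -[X in _ --> X]subr0; apply: cvgB => //; exact: cvg_cst.
apply: cvg_trans; apply: near_eq_cvg; near=> n.
rewrite /bumps bump0E//= -/s ifT//; apply/andP; split.
  rewrite -ltrBrDl; near: n; apply: (cvgr_lt _ cn); by rewrite subr_gt0.
rewrite ltrBrDl -ltrBrDr; near: n; apply: (cvgr_lt _ cn); by rewrite subr_gt0.
Unshelve. all: by end_near. Qed.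

Lemma RI_pr lo hi h r : intble L h -> (forall x, ~~ (lo <= x <= hi) -> h x = 0) ->
  (forall i, \int[L]_x (h x * bumps lo hi i 0%N x) = 0) ->
  \int[L]_x (h x * \1_(`]-oo, ratr r]%classic) x) = 0.
Proof.
move=> ih h0 hb.
have mh := intble_meas ih.
have [_ c1] : intble L (fun x => h x * \1_(`]lo, Num.min hi (ratr r)[%classic) x) /\
   \int[L]_x (h x * bumps lo hi (n, r) 0%N x) @[n --> \oo] -->
   \int[L]_x (h x * \1_(`]lo, Num.min hi (ratr r)[%classic) x).
  apply: (@DCT _ _ _ L _ _ (fun x => `|h x|)).
  - move=> n; apply: measurable_funM => //.
    exact: (cont_meas (derivatives_cont (bumps_test1 lo hi (n, r)).1)).
  - by apply: measurable_funM => //; exact: measurable_indic.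
  - by apply/nearW => x; apply: cvgMr; exact: bumps_cvg.
  - exact: integrable_norm.
  - move=> n x; rewrite normrM ler_piMr// ger0_norm.
      have n0 : 0 < n.+1%:R^-1 :> R by rewrite invr_gt0 ltr0n.
      by have /andP[] := bump0_ge0 (lo + n.+1%:R^-1) (Num.min hi (ratr r) - n.+1%:R^-1) x n0.
    have n0 : 0 < n.+1%:R^-1 :> R by rewrite invr_gt0 ltr0n.
    by have /andP[] := bump0_ge0 (lo + n.+1%:R^-1) (Num.min hi (ratr r) - n.+1%:R^-1) x n0.
have -> : \int[L]_x (h x * \1_(`]-oo, ratr r]%classic) x) =
    \int[L]_x (h x * \1_(`]lo, Num.min hi (ratr r)[%classic) x).
  apply: RI_ae.
  - by apply: measurable_funM => //; exact: measurable_indic.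
  - by apply: measurable_funM => //; exact: measurable_indic.
  - exists ([set lo] `|` [set hi] `|` [set ratr r]); split.
    + by apply: measurableU => //; apply: measurableU.
    + apply/eqP; rewrite eq_le measure_ge0 andbT.
      rewrite (le_trans (measureU2 _ _ _))//; first exact: measurableU.
      rewrite [X in (_ + X)%E]lebesgue_measure_set1 adde0.
      rewrite (le_trans (measureU2 _ _ _))//.
      by rewrite [X in (X + _)%E]lebesgue_measure_set1 [X in (_ + X)%E]lebesgue_measure_set1 adde0.
    + move=> x /= hx; apply: contrapT => /not_orP[/not_orP[/eqP xlo /eqP xhi] /eqP xr].
      apply: hx; rewrite !indicE !mem_setE !in_itv/=.
      have [/andP[lx xh]|/h0 ->] := boolP (lo <= x <= hi); last by rewrite !mul0r.
      by rewrite lt_min (lt_neqAle lo) eq_sym xlo lx (lt_neqAle x hi) xhi xh (lt_neqAle x) xr.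
rewrite (funext (fun n => hb (n, r))) in c1.
by apply: (cvg_unique _ c1); [exact: norm_hausdorff|exact: cvg_cst].
Qed.

(** The one-variable fundamental lemma. The primitive of [h] vanishes at rationals by [RI_pr], hence
    everywhere by dominated convergence; by Lebesgue's differentiation theorem [h] is almost
    everywhere the derivative of this zero primitive. *)
Lemma ae0_of_bumps lo hi h : intble L h -> (forall x, ~~ (lo <= x <= hi) -> h x = 0) ->
  (forall i, \int[L]_x (h x * bumps lo hi i 0%N x) = 0) ->
  {ae L, forall x, h x = 0}.
Proof.
move=> ih h0 hb; have mh := intble_meas ih.
have F0 x : \int[L]_(t in `]-oo, x]) h t = 0.
  (* Rationals strictly to the right of [x], so that the indicators of the closed half-lines
     converge at every point, [x] included. *)
  have /choice[r hr] : forall n, exists r : rat, x < ratr r < x + n.+1%:R^-1.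
    move=> n; have : x < x + n.+1%:R^-1 by rewrite ltrDl invr_gt0 ltr0n.
    by move=> /rat_in_itvoo[r]; rewrite in_itv/= => ?; exists r.
  have cr : ratr (r n) @[n --> \oo] --> x.
    apply: (@squeeze_cvgr _ _ _ _ (fun=> x) (fun n => x + n.+1%:R^-1)).
    - by apply: nearW => n; have /andP[/ltW -> /ltW ->] := hr n.
    - exact: cvg_cst.
    - rewrite -[X in _ --> X]addr0; apply: cvgD; [exact: cvg_cst|exact: cvg_harmonic].
  have [_ c1] : intble L (fun t => h t * \1_(`]-oo, x]%classic) t) /\
     \int[L]_t (h t * \1_(`]-oo, ratr (r n)]%classic) t) @[n --> \oo] -->
     \int[L]_t (h t * \1_(`]-oo, x]%classic) t).
    apply: (@DCT _ _ _ L _ _ (fun x => `|h x|)).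
    - by move=> n; apply: measurable_funM => //; exact: measurable_indic.
    - by apply: measurable_funM => //; exact: measurable_indic.
    - apply/nearW => t; apply: cvgMr; apply: cvg_near_cst.
      have [tx|xt] := leP t x.
        apply: nearW => n; rewrite !indicE !mem_setE !in_itv/= tx (le_trans tx)//.
        by have /andP[/ltW] := hr n.
      near=> n; rewrite !indicE !mem_setE !in_itv/= (leNgt t x) xt/= leNgt.
      suff -> : ratr (r n) < t by [].
      by near: n; apply: (cvgr_lt _ cr).
    - exact: integrable_norm.
    - by move=> n t; rewrite normrM ler_piMr// indicE; case: (_ \in _); rewrite ?normr1 ?normr0.
  rewrite Rintegral_mkcond (_ : \int[L]_t _ = \int[L]_t (h t * \1_(`]-oo, x]%classic) t)).
    rewrite (funext (fun n => RI_pr (r n) ih h0 hb)) in c1.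
    by apply: (cvg_unique _ c1); [exact: norm_hausdorff|exact: cvg_cst].
  by apply: eq_Rintegral => t _; rewrite patchE indicE; case: ifPn => _; rewrite ?mulr1 ?mulr0.
have ly y : L.-integrable `]-oo, y] (EFin \o h).
  by apply: (@integrableS _ _ _ L setT) => //; exact: ih.
have loc : locally_integrable [set: R] h.
  split=> //; first exact: openT.
  move=> K _ cK; have mK : measurable K by exact: compact_measurable.
  have /integrableP[_ h1] : L.-integrable K (EFin \o h).
    by apply: (@integrableS _ _ _ L setT) => //; exact: ih.
  exact: h1.
have := FTC1Ny ly loc; apply: filterS.
  exact: (ae_filter_ringOfSetsType lebesgue_measure).
move=> x [_ <-].
rewrite (_ : (fun _ => _) = cst 0) ?derive1_cst//.
by apply/funext => y; exact: F0.
Unshelve. all: by end_near. Qed.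

End Bumps.

(** * Boxes *)

Section BoxSpace.
Context (R : realType) (d : measure_display) (V : measurableNormedModType R d).
Variables (mu : {sigma_finite_measure set V -> \bar R}) (k : nat).
Variables (p : nat -> V -> R) (e : nat -> V) (lo hi : nat -> R) (D : set V).

(* What is needed of a box [D] with coordinates [p i] dual to the directions
   [e i], in a form that passes to the product with an interval. *)
Record box_space : Prop := BoxSpace {
  box_lt : forall i, (i < k)%N -> lo i < hi i;
  box_lin : forall i (h : R) (v x : V), (i < k)%N -> p i (h *: v + x) = h * p i v + p i x;
  box_cont : forall i, (i < k)%N -> continuous (p i);
  box_dual : forall i j, (i < k)%N -> (j < k)%N -> p i (e j) = (i == j)%:R;
  box_mem : forall v, D v <-> forall i, (i < k)%N -> lo i <= p i v <= hi i;
  box_compact : forall q r : nat -> R,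
    compact [set v | forall i, (i < k)%N -> q i <= p i v <= r i];
  box_prod : forall h : nat -> R -> R, (forall i, (i < k)%N -> intble (leb R) (h i)) ->
    intble mu (fun v => \prod_(i < k) h i (p i v)) /\
    \int[mu]_v (\prod_(i < k) h i (p i v)) = \prod_(i < k) \int[leb R]_x h i x;
  box_null : forall i t, (i < k)%N -> {ae mu, forall v, p i v != t};
  box_sep : forall h : V -> R, intble mu h -> (forall v, ~ D v -> h v = 0) ->
    (forall idx : nat -> nat * rat,
       \int[mu]_v (h v * \prod_(i < k) bumps (lo i) (hi i) (idx i) 0%N (p i v)) = 0) ->
    {ae mu, forall v, h v = 0};
  box_base : exists (I : countType) (B : I -> set V),
    (forall i, measurable (B i)) /\
    forall (U : set V) x, open U -> U x -> exists i, B i x /\ B i `<=` U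
}.

Lemma box0 i : box_space -> (i < k)%N -> p i 0 = 0.
Proof.
move=> H ik; have := box_lin H 1 0 0 ik.
by rewrite scale1r addr0 mul1r => /eqP; rewrite -subr_eq0 opprD addNKr oppr_eq0 => /eqP.
Qed.

End BoxSpace.

Section OpenMeasurable.
Context (R : realType) (d : measure_display) (V : measurableNormedModType R d).
Variables (I : countType) (B : I -> set V).
Hypothesis mB : forall i, measurable (B i).
Hypothesis baseB : forall (U : set V) x, open U -> U x -> exists i, B i x /\ B i `<=` U.

(** The sigma-algebra of a product is generated by rectangles; a countable base of measurable sets
    is what puts every open set, and hence every continuous function, within its reach. *)
Lemma base_open_measurable (U : set V) : open U -> measurable U.
Proof.
move=> oU; pose F i := if pselect (B i `<=` U) then B i else set0.
rewrite (_ : U = \bigcup_i F i); last first.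
  apply/seteqP; split=> x.
    move=> Ux; have [i [Bx BU]] := baseB oU Ux; exists i => //.
    by rewrite /F; case: pselect.
  by move=> [i _]; rewrite /F; case: pselect => // BU /BU.
apply: countable_bigcupT_measurable; first exact: countableP.
by move=> i; rewrite /F; case: pselect => ?; [exact: mB|exact: measurable0].
Qed.

Lemma base_within_measurable (D : set V) (f : V -> R) : measurable D ->
  {within D, continuous f} -> measurable_fun D f.
Proof.
move=> mD /continuousP cf; apply: (measurability _ (RGenOpens.measurableE R)).
move=> _ [_ [a [b ->] <-]].
have oab : open `]a, b[%classic by exact: interval_open.
have [W oW WE] := (open_subspaceP _ _).1 (cf _ oab).
rewrite setIC -WE setIC; apply: measurableI => //; exact: base_open_measurable.
Qed.

Lemma base_cont_measurable (f : V -> R) : continuous f -> measurable_fun setT f.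
Proof. by move=> cf; apply: base_within_measurable => //; exact: continuous_subspaceT. Qed.

End OpenMeasurable.

Section Instances.
Variable R : realType.
Local Notation L := (leb R).

Lemma box_space1 (lo hi : nat -> R) : lo 0%N < hi 0%N ->
  @box_space R _ (measurableTypeR R) L 1 (fun _ v => v) (fun=> 1) lo hi `[lo 0%N, hi 0%N].
Proof.
move=> lh; split.
- by case.
- by [].
- by move=> i _ x.
- by case=> [|//] [|//].
- move=> v; rewrite /= in_itv/=; split; first by move=> h [|//].
  by move=> /(_ 0%N); exact.
- move=> q r.
  rewrite (_ : [set _ | _] = `[q 0%N, r 0%N]%classic); first exact: segment_compact.
  apply/seteqP; split=> v /=; rewrite in_itv/=; first by move=> /(_ 0%N); exact.
  by move=> h [|//].
- move=> h ih; split.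
    by apply: eq_intble (ih 0%N isT) => v; rewrite big_ord1.
  by rewrite big_ord1; apply: eq_Rintegral => v _; rewrite big_ord1.
- move=> [|//] t _; exists [set t]; split => //; first exact: lebesgue_measure_set1.
  by move=> x /= /negP; rewrite negbK => /eqP.
- move=> h ih h0 hb; apply: (@ae0_of_bumps _ (lo 0%N) (hi 0%N) _ ih) => [x|i].
    by move=> nx; apply: h0; rewrite /= in_itv/=; exact/negP.
  rewrite -[RHS](hb (fun=> i)); apply: eq_Rintegral => v _.
  by rewrite big_ord1.
- exists (rat * rat)%type, (fun i => `]ratr i.1, ratr i.2[%classic); split.
    by move=> i; exact: measurable_itv.
  move=> U x oU Ux; have /nbhs_ballP[r /= r0 rU] : nbhs x U by exact: open_nbhs_nbhs.
  have /rat_in_itvoo[a] : x - r < x by rewrite ltrBlDr ltrDl.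
  have /rat_in_itvoo[b] : x < x + r by rewrite ltrDl.
  rewrite !in_itv/= => /andP[xb br] /andP[ra ax].
  exists (a, b); rewrite /= in_itv/= ax xb; split => // y /=.
  rewrite in_itv/= => /andP[ay yb]; apply: rU.
  by rewrite -ball_normE/= ltr_norml; lra.
Qed.

Variables (d : measure_display) (V : measurableNormedModType R d).
Variables (mu : {sigma_finite_measure set V -> \bar R}) (k : nat).
Variables (p : nat -> V -> R) (e : nat -> V) (lo hi : nat -> R) (D : set V).

(** The induction on dimension: every property of a box used later passes to its product with an
    interval, so the arguments below treat two, three and four variables at once. *)
Lemma box_spaceS : box_space mu k p e lo hi D -> lo k < hi k ->
  @box_space R _ (V * measurableTypeR R)%type (prodm mu L) k.+1
    (fun i v => if (i < k)%N then p i v.1 else v.2)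
    (fun i => if (i < k)%N then (e i, 0) else (0, 1)) lo hi (D `*` `[lo k, hi k]).
Proof.
move=> H lh.
have prodE (h : nat -> R -> R) (v : V * R) :
   \prod_(i < k.+1) h i (if (i < k)%N then p i v.1 else v.2) =
   (\prod_(i < k) h i (p i v.1)) * h k v.2.
  by rewrite big_ord_recr/= ltnn; congr (_ * _); apply: eq_bigr => i _; rewrite ltn_ord.
have [I [B [mB baseB]]] := box_base H.
have mp i : (i < k)%N -> measurable_fun setT (p i).
  by move=> ik; apply: (base_cont_measurable mB baseB); exact: (box_cont H ik).
have lt_cases i : (i < k.+1)%N -> (i < k)%N \/ i = k.
  by rewrite ltnS leq_eqVlt => /orP[/eqP ->|]; [right|left].
split.
- by move=> i /lt_cases[/(box_lt H)//|->].
- move=> i h v x /lt_cases[ik|->]; last by rewrite ltnn.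
  by rewrite ik -(box_lin H).
- move=> i /lt_cases[ik|->] x; last first.
    by rewrite ltnn; exact: cvg_snd.
  rewrite ik; apply: (@continuous_comp _ _ _ fst (p i)); first exact: cvg_fst.
  exact: (box_cont H ik).
- move=> i j /lt_cases[ik|->] /lt_cases[jk|->].
  + by rewrite ik jk (box_dual H).
  + rewrite ik ltnn/=.
    by rewrite (box0 H)// ltn_eqF.
  + by rewrite jk ltnn/= gtn_eqF.
  + by rewrite ltnn eqxx.
- move=> v; split.
    move=> [/= /(box_mem H) Dv]; rewrite in_itv/= => v2 i /lt_cases[ik|->].
      by rewrite ik; exact: Dv.
    by rewrite ltnn.
  move=> h; split; last by have := h k (ltnSn k); rewrite ltnn /= in_itv.
  by apply/(box_mem H) => i ik; have := h i (ltnW ik); rewrite ik.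
- move=> q r.
  rewrite (_ : [set _ | _] = [set v | forall i, (i < k)%N -> q i <= p i v <= r i] `*` `[q k, r k]).
    by apply: compact_setX; [exact: (box_compact H)|exact: segment_compact].
  apply/seteqP; split=> v /=.
    move=> h; split; last by have := h k (ltnSn k); rewrite ltnn /= in_itv.
    by move=> i ik; have := h i (ltnW ik); rewrite ik.
  move=> [h]; rewrite in_itv/= => v2 i /lt_cases[ik|->]; last by rewrite ltnn.
  by rewrite ik; exact: h.
- move=> h ih.
  have [i1 e1] := box_prod H (fun i ik => ih i (ltnW ik)).
  have i2 := ih k (ltnSn k).
  split; first by apply: eq_intble (intble_prod i1 i2) => v; rewrite prodE.
  rewrite [RHS]big_ord_recr/= -e1; rewrite -[RHS](RI_prod i1 i2).
  by apply: eq_Rintegral => v _; rewrite prodE.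
- have neqm (f : V * measurableTypeR R -> R) t : measurable_fun setT f ->
      measurable [set v | f v != t].
    move=> mf; rewrite (_ : [set _ | _] = ~` (f @^-1` [set t])); last first.
      by apply/seteqP; split=> v /= /eqP.
    by apply: measurableC; rewrite -[X in measurable X]setTI; exact: mf.
  move=> i t /lt_cases[ik|->].
    rewrite ik; apply: ae_prodr.
      by apply: neqm; exact: (measurableT_comp (mp i ik)).
    by apply: filterS (box_null H t ik) => v vt; exact: nearW.
  rewrite ltnn; apply: ae_prodr; first by apply: neqm; exact: measurable_snd.
  apply: nearW => v; exists [set t]; split => //; first exact: lebesgue_measure_set1.
  by move=> x /= /negP; rewrite negbK => /eqP.
- move=> h ih h0 hb.
  have mh := intble_meas ih.
  have mb i j : measurable_fun [set: measurableTypeR R] (bumps (lo i) (hi i) j 0%N).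
    exact: (cont_meas (derivatives_cont (bumps_test1 (lo i) (hi i) j).1)).
  have b01 i j x : 0 <= bumps (lo i) (hi i) j 0%N x <= 1.
    by apply: bump0_ge0; rewrite invr_gt0 ltr0n.
  have b1 i j x : `|bumps (lo i) (hi i) j 0%N x| <= 1.
    by have /andP[b0 bl] := b01 i j x; rewrite ger0_norm.
  have ihj j : intble (prodm mu L) (fun z => h z * bumps (lo k) (hi k) j 0%N z.2).
    apply: (@intble_bM _ _ _ _ _ _ 1) => //.
    by apply: measurableT_comp => //; exact: mb.
  (* Separation in one more variable: pairing the last variable with bump number j leaves a function
     of [v] annihilated by all products of bumps, hence zero almost everywhere. Off one null set
     this holds for all j, and the one-variable lemma applies to the section of [h]. *)
  pose g j v := \int[L]_t (h (v, t) * bumps (lo k) (hi k) j 0%N t).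
  have ig j : intble mu (g j) by exact: (intble_pint (ihj j)).
  have g0 j : {ae mu, forall v, g j v = 0}.
    apply: (box_sep H (ig j)).
      move=> v nD; rewrite /g -[RHS](RI0 L); apply: eq_Rintegral => t _.
      by rewrite h0 ?mul0r// => -[].
    move=> idx.
    rewrite -[RHS](hb (fun i => if (i < k)%N then idx i else j)).
    pose ch v := \prod_(i < k) bumps (lo i) (hi i) (idx i) 0%N (p i v).
    have mch : measurable_fun setT ch.
      apply: measurable_prod => i _.
      by apply: measurableT_comp; [exact: mb|exact: (mp i (ltn_ord i))].
    have bch v : `|ch v| <= 1.
      by rewrite normr_prod; apply: prodr_ile1 => i _; rewrite normr_ge0 b1.
    have i3 : intble (prodm mu L) (fun z => h z * bumps (lo k) (hi k) j 0%N z.2 * ch z.1).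
      by apply: (intble_bM (ihj j)) => //; exact: (measurableT_comp mch).
    transitivity (\int[prodm mu L]_z (h z * bumps (lo k) (hi k) j 0%N z.2 * ch z.1)).
      rewrite -(RI_fubini1 i3); apply: RI_ae.
      + apply: measurable_funM => //; exact: intble_meas (ig j).
      + exact: (intble_meas (intble_pint i3)).
      + by apply: filterS (intble_sec1 (ihj j)) => v iv; exact: (esym (RIZr (ch v) iv)).
    apply: eq_Rintegral => z _.
    rewrite big_ord_recr/= !ltnn -mulrA; congr (_ * _).
    by rewrite mulrC; congr (_ * _); apply: eq_bigr => i _; rewrite !ltn_ord.
  apply: ae_prodr.
    rewrite (_ : [set _ | _] = h @^-1` [set 0])//.
    by rewrite -[X in measurable X]setTI; exact: mh.
  have := ae_and (ae_forall g0) (intble_sec1 ih); apply: filterS => v [gv iv].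
  apply: (@ae0_of_bumps _ (lo k) (hi k) _ iv) => [x xk|j]; last exact: gv.
  by apply: h0 => -[_] /=; rewrite in_itv/=; exact/negP.
(* A countable base of the line is independent of the interval, so [0, 1] is taken. *)
- have [J [C [mC baseC]]] := box_base (box_space1 (lo := fun=> 0) (hi := fun=> 1) ltr01).
  exists (I * J)%type, (fun i => B i.1 `*` C i.2); split.
    by move=> i; apply: measurableX.
  move=> U [x y] oU Uxy.
  have : nbhs (x, y) U by exact: open_nbhs_nbhs.
  move=> [[/= P Q] [Px Qy] PQU].
  move: Px; rewrite nbhsE => -[P' [oP' P'x] P'P].
  move: Qy; rewrite nbhsE => -[Q' [oQ' Q'x] Q'Q].
  have [i [Bx BP]] := baseB _ _ oP' P'x.
  have [j [Cy CQ]] := baseC _ _ oQ' Q'x.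
  exists (i, j); split => //= z [/= /BP/P'P Pz /CQ/Q'Q Qz].
  by apply: PQU.
Qed.
End Instances.

(** * Tensor products of one-variable test functions on a box *)

Section BoxTest.
Context (R : realType) (d : measure_display) (V : measurableNormedModType R d).
Variables (mu : {sigma_finite_measure set V -> \bar R}) (k : nat).
Variables (p : nat -> V -> R) (e : nat -> V) (lo hi : nat -> R) (D : set V).
Hypothesis H : box_space mu k p e lo hi D.

Lemma box_open_measurable (U : set V) : open U -> measurable U.
Proof.
by have [I [B [mB baseB]]] := box_base H; exact: (base_open_measurable mB baseB).
Qed.

Lemma box_within_measurable (E : set V) (f : V -> R) : measurable E ->
  {within E, continuous f} -> measurable_fun E f.
Proof.
by have [I [B [mB baseB]]] := box_base H; exact: (base_within_measurable mB baseB).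
Qed.

Lemma box_cont_measurable (f : V -> R) : continuous f -> measurable_fun setT f.
Proof.
by have [I [B [mB baseB]]] := box_base H; exact: (base_cont_measurable mB baseB).
Qed.

Lemma coord_measurable i : (i < k)%N -> measurable_fun setT (p i).
Proof. by move=> ik; exact: box_cont_measurable (box_cont H ik). Qed.

(** By [box_lin] the coordinate is affine in h along h v + x, so a directional derivative is the
    one-variable chain rule at h = 0. *)
Lemma coord_derive i g n x v : (i < k)%N -> derivatives g ->
  is_derive x v (fun y => g n (p i y)) (p i v * g n.+1 (p i x)).
Proof.
move=> ik dg; pose w := p i v; pose psi h := g n (w * h + p i x).
have aff : is_derive (0 : R) 1 (fun h => w * h + p i x) w.
  have := is_deriveD (is_deriveZ w (is_derive_id (0 : R) 1)) (is_derive_cst (p i x) (0 : R) 1).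
  by rewrite addr0 [w *: 1]mulr1.
have := @is_derive1_comp R (g n) (fun h => w * h + p i x) 0 _ _ (dg n _) aff.
rewrite /= mulr0 add0r mulrC => -[d1 d2].
have E : (fun h => h^-1 *: (((fun y => g n (p i y)) \o shift x) (h *: v) - g n (p i x))) =
  (fun h => h^-1 *: (((g n \o (fun h => w * h + p i x)) \o shift 0) (h *: 1) -
     (g n \o (fun h => w * h + p i x)) 0)).
  apply/funext => h /=; rewrite (box_lin H)// mulr0 add0r addr0.
  by rewrite -/w [h *: 1]mulr1 [h * w]mulrC.
constructor; first by rewrite /derivable E.
by rewrite /derive E.
Qed.

(** The partial derivative of multi-index [al] of the tensor product of the [h i 0]; [bump_at]
    raises one entry of the multi-index. *)
Definition pd (h : nat -> nat -> R -> R) (al : nat -> nat) v :=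
  \prod_(i < k) h i (al i) (p i v).

Definition bump_at (j : nat) (al : nat -> nat) i := if i == j then (al i).+1 else al i.

Lemma pd_derive h al x v : (forall i, (i < k)%N -> derivatives (h i)) ->
  is_derive x v (pd h al) (\sum_(j < k) p j v * pd h (bump_at j al) x).
Proof.
move=> dh; rewrite /pd.
suff : forall n, (n <= k)%N ->
  is_derive x v (fun y => \prod_(i < n) h i (al i) (p i y))
   (\sum_(j < n) p j v * \prod_(i < n) h i (bump_at j al i) (p i x)) by exact.
elim=> [|n IH] nk.
  rewrite big_ord0 (_ : (fun _ => _) = cst 1); first exact: is_derive_cst.
  by apply/funext => y; rewrite big_ord0.
rewrite (_ : (fun _ => _) = (fun y => \prod_(i < n) h i (al i) (p i y)) * (fun y => h n (al n) (p n y))); last first.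
  by apply/funext => y; rewrite big_ord_recr.
have := is_deriveM (IH (ltnW nk)) (coord_derive (al n) x v nk (dh n nk)).
move=> /is_derive_eq; apply.
rewrite big_ord_recr/= addrC; congr (_ + _).
  rewrite -[LHS]/(_ * _) mulrCA; congr (_ * _).
  rewrite big_ord_recr/= /bump_at eqxx; congr (_ * _).
  by apply: eq_bigr => i _; rewrite ltn_eqF.
rewrite -[LHS]/(h n (al n) (p n x) * _) mulr_sumr; apply: eq_bigr => j _.
rewrite big_ord_recr/= /bump_at gtn_eqF//.
by rewrite mulrC -mulrA.
Qed.

Lemma pd_D h al j : (j < k)%N -> (forall i, (i < k)%N -> derivatives (h i)) ->
  'D_(e j) (pd h al) = pd h (bump_at j al).
Proof.
move=> jk dh; apply/funext => x.
have [_ ->] := pd_derive al x (e j) dh.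
rewrite (bigD1 (Ordinal jk))//= (box_dual H)// eqxx mul1r big1 ?addr0// => i ij.
by rewrite (box_dual H)// -[j]/(val (Ordinal jk)) val_eqE (negbTE ij) mul0r.
Qed.

Lemma pd_iter h (J : seq nat) al : all (fun i => i < k)%N J ->
  (forall i, (i < k)%N -> derivatives (h i)) ->
  iter_derive [seq e j | j <- J] (pd h al) = pd h (fun i => al i + count_mem i J)%N.
Proof.
move=> + dh; elim: J => [_|j J IH /= /andP[jk Jk]].
  by congr (pd h _); apply/funext => i; rewrite addn0.
rewrite IH// pd_D//; congr (pd h _); apply/funext => i; rewrite /bump_at.
by rewrite eq_sym; case: eqP => _; rewrite ?add0n// addnCA add1n.
Qed.

(** Smoothness quantifies over lists of arbitrary directions, and a derivative in such a direction
    is a combination of several [pd]. Their linear span is stable under all directional derivatives,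
    so the induction runs there. *)
Inductive pd_span h : (V -> R) -> Prop :=
| pd_span0 : pd_span h (fun=> 0)
| pd_spanD c al f : pd_span h f -> pd_span h (fun x => c * pd h al x + f x).

Lemma pd_span_sum h (I : Type) (s : seq I) (c : I -> R) al f : pd_span h f ->
  pd_span h (fun x => \sum_(i <- s) c i * pd h (al i) x + f x).
Proof.
move=> hf; elim: s => [|i s IH].
  by rewrite (_ : (fun _ => _) = f)//; apply/funext => x; rewrite big_nil add0r.
rewrite (_ : (fun _ => _) = (fun x => c i * pd h (al i) x +
   (\sum_(i <- s) c i * pd h (al i) x + f x))); first exact: pd_spanD.
by apply/funext => x; rewrite big_cons addrA.
Qed.

Lemma pd_span_derive h f x v : (forall i, (i < k)%N -> derivatives (h i)) -> pd_span h f ->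
  derivable f x v /\ pd_span h ('D_v f).
Proof.
move=> dh hf.
suff [g [hg dg]] : exists g, pd_span h g /\ forall x, is_derive x v f (g x).
  split; first by have [] := dg x.
  by rewrite (_ : 'D_v f = g)//; apply/funext => y; have [_ ->] := dg y.
elim: hf => [|c al {}f hf [g [hg dg]]].
  by exists (fun=> 0); split; [exact: pd_span0|move=> y; exact: is_derive_cst].
exists (fun y => \sum_(j < k) (c * p j v) * pd h (bump_at j al) y + g y); split.
  exact: pd_span_sum.
move=> y; have := is_deriveD (is_deriveZ c (pd_derive al y v dh)) (dg y).
move=> /is_derive_eq; apply; congr (_ + _).
by rewrite -[LHS]/(_ * _) mulr_sumr; apply: eq_bigr => j _; rewrite mulrA.
Qed.

Lemma pd_cont h al : (forall i, (i < k)%N -> derivatives (h i)) -> continuous (pd h al).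
Proof.
move=> dh; rewrite /pd; suff : forall n, (n <= k)%N ->
  continuous (fun y => \prod_(i < n) h i (al i) (p i y)) by exact.
elim=> [|n IH] nk x.
  rewrite (_ : (fun _ => _) = cst 1); first exact: cvg_cst.
  by apply/funext => y; rewrite big_ord0.
rewrite (_ : (fun _ => _) = (fun y => (\prod_(i < n) h i (al i) (p i y)) * (h n (al n) (p n y)))); last first.
  by apply/funext => y; rewrite big_ord_recr.
apply: cvgM; first exact: IH (ltnW nk) x.
apply: (@continuous_comp _ _ _ (p n) (h n (al n))); first exact: (box_cont H nk).
exact: derivatives_cont (dh n nk) _.
Qed.

Lemma pd_span_cont h f : (forall i, (i < k)%N -> derivatives (h i)) -> pd_span h f ->
  continuous f.
Proof.
move=> dh; elim=> [|c al {}f hf cf] x; first exact: cvg_cst.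
by apply: cvgD; [apply: cvgMr; exact: pd_cont|exact: cf].
Qed.

Lemma pd_smooth h al : (forall i, (i < k)%N -> derivatives (h i)) -> smooth (pd h al).
Proof.
move=> dh s; suff hs : pd_span h (iter_derive s (pd h al)).
  split; first exact: pd_span_cont hs.
  by move=> x v; exact: (pd_span_derive x v dh hs).1.
elim: s => [|v s IH] /=.
  rewrite (_ : pd h al = (fun x => 1 * pd h al x + 0)); last first.
    by apply/funext => x; rewrite mul1r addr0.
  by apply: pd_spanD; exact: pd_span0.
exact: (pd_span_derive 0 v dh IH).2.
Qed.

Lemma box_interior v : (forall i, (i < k)%N -> lo i < p i v < hi i) -> D° v.
Proof.
move=> hv; suff : forall n, (n <= k)%N ->
    \forall y \near v, forall i, (i < n)%N -> lo i < p i y < hi i.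
  move=> /(_ k (leqnn k)); apply: filterS => y hy; apply/(box_mem H) => i ik.
  by have /andP[/ltW -> /ltW ->] := hy i ik.
elim=> [_|n IH nk]; first exact: nearW.
have /andP[h1 h2] := hv n nk.
have cn := box_cont H nk (x := v).
near=> y; move=> i; rewrite ltnS leq_eqVlt => /orP[/eqP ->|]; last first.
  by move: i; near: y; exact: IH (ltnW nk).
apply/andP; split; near: y; [exact: (cvgr_gt _ cn)|exact: (cvgr_lt _ cn)].
Unshelve. all: by end_near. Qed.

Lemma pd_test h : (forall i, (i < k)%N -> test1 (lo i) (hi i) (h i)) ->
  test_function D (pd h (fun=> 0%N)).
Proof.
move=> th; split; first by apply: pd_smooth => i /th[].
have : forall i, exists PQ : R * R, (i < k)%N ->
    [/\ lo i < PQ.1, PQ.2 < hi i & forall n x, ~~ (PQ.1 <= x <= PQ.2) -> h i n x = 0].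
  move=> i; have [ik|_] := boolP (i < k)%N; last by exists (0, 0).
  by have [_ [P [Q h3]]] := th i ik; exists (P, Q).
move=> /choice[PQ hPQ].
exists [set v | forall i, (i < k)%N -> (PQ i).1 <= p i v <= (PQ i).2]; split.
- exact: (box_compact H).
- move=> v /= hv; apply: box_interior => i ik; have [lP Qh _] := hPQ i ik.
  have /andP[h1 h2] := hv i ik.
  by rewrite (lt_le_trans lP h1) (le_lt_trans h2 Qh).
- move=> v /existsNP[i] /not_implyP[ik /negP hv].
  have [_ _ h0] := hPQ i ik.
  by rewrite /pd (bigD1 (Ordinal ik))//= h0// mul0r.
Qed.

End BoxTest.

(** * Continuous representatives *)

Section SquareIntegrable.
Context (R : realType) (d : measure_display) (V : measurableNormedModType R d).
Variables (mu : {measure set V -> \bar R}) (D : set V).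
Implicit Types f g : V -> R.

Lemma L2_meas f : L2 mu D f -> measurable_fun setT (f \_ D).
Proof. by rewrite /L2 inE => /andP[+ _]; rewrite inE. Qed.

Lemma L2_sqr f : L2 mu D f -> intble mu (fun x => (f \_ D) x ^+ 2).
Proof. exact: Lfun2_integrable_sqr. Qed.

Lemma L2_intro f : measurable_fun setT (f \_ D) ->
  intble mu (fun x => (f \_ D) x ^+ 2) -> L2 mu D f.
Proof.
move=> mf /integrableP[_ i2]; rewrite /L2 inE; apply/andP; split; first by rewrite inE.
rewrite inE/= /finite_norm unlock; apply: poweR_lty.
apply: le_lt_trans i2; rewrite le_eqVlt; apply/orP; left; apply/eqP.
by apply: eq_integral => x _ /=; rewrite powR_mulrn// normrX.
Qed.

(** On a set of finite measure |f| <= 1 + f^2 is an integrable bound. *)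
Lemma L2_intble f : intble mu (\1_D : V -> R) -> L2 mu D f -> intble mu (f \_ D).
Proof.
move=> iD l2.
apply: (intble_le (L2_meas l2) _ (intbleD iD (L2_sqr l2))) => x.
rewrite indicE patchE; case: (x \in D); last by rewrite normr0 expr0n addr0.
have := sqr_ge0 (`|f x| - 1); rewrite -[X in _ <= _ + X](real_normK (num_real _)).
have := normr_ge0 (f x); rewrite /=; nra.
Qed.

Lemma patch_mul f phi : (fun z => f z * phi z) \_ D = (fun z => (f \_ D) z * phi z).
Proof. by apply/funext => z; rewrite !patchE; case: ifP => // _; rewrite mul0r. Qed.

Lemma RI_restrict f phi : \int[mu]_(z in D) (f z * phi z) = \int[mu]_z ((f \_ D) z * phi z).
Proof. by rewrite Rintegral_mkcond patch_mul. Qed.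

End SquareIntegrable.

(** Dominated convergence is about sequences, so continuity of parameter integrals is proved
    sequentially. *)
Lemma seq_cvg_at (R : realType) (V : normedModType R) (f : V -> R) (x : V) :
  (forall u : nat -> V, u n @[n --> \oo] --> x -> f (u n) @[n --> \oo] --> f x) ->
  f y @[y --> x] --> f x.
Proof.
move=> h; apply/cvgrPdist_lt => eps e0; apply: contrapT => nh.
have : forall n : nat, exists y : V, ball x n.+1%:R^-1 y /\ ~ (`|f x - f y| < eps).
  move=> n; apply: contrapT => /forallNP hn; apply: nh.
  apply/nbhs_ballP; exists n.+1%:R^-1 => /=; first by rewrite invr_gt0 ltr0n.
  by move=> y xy; apply: contrapT => ny; apply: (hn y).
move=> /choice[u hu].
have ux : u n @[n --> \oo] --> x.
  apply/cvgrPdist_lt => r r0.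
  have c0 : n.+1%:R^-1 @[n --> \oo] --> (0 : R) by exact: cvg_harmonic.
  near=> n; have [+ _] := hu n; rewrite -ball_normE/= => /lt_trans; apply.
  by near: n; exact: (cvgr_lt _ c0).
have /cvgrPdist_lt/(_ eps e0)[N _ hN] := h u ux.
by have [_] := hu N; apply; apply: hN => /=.
Unshelve. all: by end_near. Qed.

Lemma meas_sec2 d1 d2 (T1 : measurableType d1) (T2 : measurableType d2) (R : realType)
  (f : T1 * T2 -> R) y : measurable_fun setT f -> measurable_fun setT (fun x => f (x, y)).
Proof. by move=> mf; exact: measurableT_comp. Qed.

Lemma meas_ler d (T : measurableType d) (R : realType) (f g : T -> R) :
  measurable_fun setT f -> measurable_fun setT g ->
  measurable_fun setT (fun x => ((f x <= g x)%R)%:R : R).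
Proof.
move=> mf mg; have mb := measurable_fun_ler mf mg.
rewrite (_ : (fun _ => _) = \1_((fun x => f x <= g x) @^-1` [set true])).
  apply: measurable_indic; rewrite -[X in measurable X]setTI; exact: mb.
apply/funext => x; rewrite indicE; case E : (f x <= g x).
  by rewrite mem_set.
by rewrite memNset//= E.
Qed.

Section ContinuousRepresentative.
Context (R : realType) (d : measure_display) (V : measurableNormedModType R d).
Variables (mu : {sigma_finite_measure set V -> \bar R}) (k : nat).
Variables (p : nat -> V -> R) (e : nat -> V) (lo hi : nat -> R) (D : set V).
Hypothesis H : box_space mu k p e lo hi D.
Local Notation L := (leb R).

Lemma box_compactD : compact D.
Proof.
rewrite (_ : D = [set v | forall i, (i < k)%N -> lo i <= p i v <= hi i]).
  exact: (box_compact H).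
by apply/seteqP; split => v /(box_mem H).
Qed.

Lemma box_measurable : measurable D.
Proof.
rewrite -[D]setCK; apply: measurableC; apply: (box_open_measurable H).
apply: closed_openC; apply: compact_closed box_compactD.
exact: norm_hausdorff.
Qed.

Lemma box_indic : (\1_D : V -> R) = (fun v => \prod_(i < k) \1_(`[lo i, hi i]%classic) (p i v)).
Proof.
apply/funext => v; rewrite indicE; have [Dv|nDv] := boolP (v \in D).
  rewrite big1// => i _; rewrite indicE mem_set//= in_itv/=.
  by move/set_mem: Dv => /(box_mem H)/(_ i (ltn_ord i)).
have : ~ (forall i, (i < k)%N -> lo i <= p i v <= hi i).
  by move=> /(box_mem H) /mem_set; exact/negP.
move=> /existsNP[i] /not_implyP[ik /negP hv].
rewrite (bigD1 (Ordinal ik))//= indicE memNset ?mul0r//= in_itv/=; exact/negP.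
Qed.

Lemma box_indic_intble : intble mu (\1_D : V -> R).
Proof.
rewrite box_indic.
have [] // := box_prod H (h := fun i => \1_(`[lo i, hi i]%classic)) _.
by move=> i _; exact: itv_intble.
Qed.

Section Kernel.
Variable w : nat -> nat -> R -> R.
Hypothesis tw : forall i, (i < k)%N -> test1 (lo i) (hi i) (w i).

(* Integrating the derivative of a function against [fun s => kern true i y s],
   and the function itself against [fun s => kern false i y s], and adding the
   two gives the value of the function at [y]. *)
Definition kern (b : bool) i (y s : R) : R :=
  if b then prim (w i) s - (y <= s)%R%:R else w i 0%N s.

Lemma prim_cont i : (i < k)%N -> continuous (prim (w i)).
Proof.
move=> ik x; apply/differentiable_continuous/derivable1_diffP.
by have [] := prim_derive x (tw ik).
Qed.

Lemma prim_meas i : (i < k)%N -> measurable_fun [set: measurableTypeR R] (prim (w i)).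
Proof. by move=> ik; apply: cont_meas; exact: prim_cont. Qed.

Lemma kern_meas b i : (i < k)%N ->
  measurable_fun [set: measurableTypeR R * measurableTypeR R] (fun z => kern b i z.1 z.2).
Proof.
move=> ik; rewrite /kern; case: b.
  apply: measurable_funB; first exact: (measurableT_comp (prim_meas ik)).
  by apply: meas_ler; [exact: measurable_fst|exact: measurable_snd].
apply: (measurableT_comp (f := w i 0%N)) => //.
exact: (cont_meas (derivatives_cont (tw ik).1)).
Qed.

Lemma kern_bounded i : exists M : R, 0 <= M /\ ((i < k)%N -> forall b y s, `|kern b i y s| <= M).
Proof.
have [ik|_] := boolP (i < k)%N; last by exists 0.
have [M M0 hM] := test1_bounded 0 (tw ik).
have iw := test1_intble 0 (tw ik).
pose P := \int[L]_t `|w i 0%N t|.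
have P0 : 0 <= P by apply: Rintegral_ge0.
have hP s : `|prim (w i) s| <= P.
  rewrite primE.
  have i1 : intble L (fun t => \1_(`]-oo, s]%classic) t * w i 0%N t).
    apply: (@eq_intble _ _ _ L (fun t => w i 0%N t * \1_(`]-oo, s]%classic) t)).
      by move=> t; rewrite mulrC.
    apply: (@intble_bM _ _ _ _ _ _ 1 iw).
      exact: measurable_indic.
    by move=> t; rewrite indicE; case: (_ \in _); rewrite ?normr1 ?normr0.
  rewrite (le_trans (le_norm_RI i1))//; apply: le_Rintegral => //.
  - exact: integrable_norm i1.
  - exact: integrable_norm iw.
  - move=> t _; rewrite normrM ler_piMl// indicE.
    by case: (_ \in _); rewrite ?normr1 ?normr0.
exists (P + 1 + M); split; first by rewrite !addr_ge0// ltW.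
move=> _ [] y s; rewrite /kern.
  rewrite (le_trans (ler_normB _ _))// -addrA lerD ?hP//.
  case: (y <= s); rewrite ?normr1 ?normr0 ?lerDl ?addr_ge0//; exact: ltW.
by rewrite (le_trans (hM s))// lerDr addr_ge0.
Qed.

Lemma kern_cvg (b : bool) i (u : nat -> R) (y s : R) : (b -> y != s) -> u n @[n --> \oo] --> y ->
  kern b i (u n) s @[n --> \oo] --> kern b i y s.
Proof.
rewrite /kern; case: b => ys uy; last exact: cvg_cst.
apply: cvgB; first exact: cvg_cst.
apply: cvg_near_cst; have [sy|ys'|E] := ltgtP y s; last by rewrite E eqxx in ys; have := ys isT.
  near=> n; suff -> : u n <= s by [].
  by apply: ltW; near: n; exact: (cvgr_lt _ uy).
near=> n; rewrite leNgt; suff -> : s < u n by [].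
by near: n; exact: (cvgr_gt _ uy).
Unshelve. all: by end_near. Qed.

Definition box_kern (J : {set 'I_k}) (z s : V) : R :=
  \prod_(i < k) kern (i \in J) i (p i z) (p i s).

Lemma box_kern_meas J :
  measurable_fun [set: V * V] (fun z => box_kern J z.1 z.2).
Proof.
apply: measurable_prod => i _.
have mpi := coord_measurable H (ltn_ord i).
apply: (measurableT_comp (kern_meas (i \in J) (ltn_ord i))
  (g := fun z : V * V => (p i z.1, p i z.2))).
by apply: measurable_fun_pair; exact: (measurableT_comp mpi).
Qed.

Lemma box_kern_bounded J : exists M : R, forall z s : V, `|box_kern J z s| <= M.
Proof.
have [M hM] := choice kern_bounded.
exists (\prod_(i < k) M i) => z s; rewrite normr_prod; apply: ler_prod => i _.
by rewrite normr_ge0 (hM i).2.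
Qed.

(** In [z] the kernel jumps only where [s] shares a coordinate with [z]. By [box_null] such [s] form
    a null set, and the kernel is bounded, so dominated convergence applies. *)
Lemma box_kern_cvg J (g : V -> R) : intble mu g ->
  continuous (fun z => \int[mu]_s (g s * box_kern J z s)).
Proof.
move=> ig z; apply: seq_cvg_at => u uz.
have [M hM] := box_kern_bounded J.
have mk y : measurable_fun setT (fun s => g s * box_kern J y s).
  apply: measurable_funM; first exact: intble_meas ig.
  exact: (meas_sec1 y (box_kern_meas J)).
have [] // := @DCT _ _ _ mu (fun n s => g s * box_kern J (u n) s)
   (fun s => g s * box_kern J z s) (fun s => M * `|g s|) (fun n => mk (u n)) (mk z) _ _ _.
- have : {ae mu, forall s, forall i : 'I_k, p i s != p i z}.
    by apply: ae_forall => i; exact: (box_null H _ (ltn_ord i)).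
  apply: filterS => s hs; apply: cvgMr.
  apply: (cvg_big (@mul_continuous R)) => i _; apply: kern_cvg.
    by move=> _; rewrite eq_sym.
  by apply: continuous_cvg => //; exact: (box_cont H (ltn_ord i)).
- exact/intbleZ/integrable_norm.
- by move=> n s; rewrite normrM mulrC ler_wpM2r.
Qed.

(** The adjoint of the kernel: integrated in its first variable against a test function, the
    discontinuous kernel becomes a test function of [s], to which a weak derivative can be applied.
    The indicator of y <= s turns [h] into its primitive, whence the corrector. *)
Lemma kern_integral (b : bool) i h s : (i < k)%N -> test1 (lo i) (hi i) h ->
  \int[L]_t w i 0%N t = 1 ->
  intble L (fun y => h 0%N y * kern b i y s) /\
  \int[L]_y (h 0%N y * kern b i y s) =
    if b then corrector (w i) h 0 s else (\int[L]_t h 0%N t) * w i 0%N s.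
Proof.
move=> ik th w1; have ih := test1_intble 0 th.
have [M [_ hM]] := kern_bounded i.
have ihk : intble L (fun y => h 0%N y * kern b i y s).
  apply: (intble_bM ih _ (fun y => hM ik b y s)).
  exact: (meas_sec2 s (kern_meas b ik)).
split=> //; move: ihk; rewrite /kern; case: b => ihk; last by rewrite (RIZr _ ih).
have ihi : intble L (fun y => h 0%N y * (y <= s)%R%:R).
  apply: (@intble_bM _ _ _ _ _ _ 1 ih); first by apply: meas_ler.
  by move=> y; case: (y <= s); rewrite ?normr1 ?normr0.
rewrite /corrector (primE h) -(RIZr _ ih).
transitivity (\int[L]_y (h 0%N y * prim (w i) s - h 0%N y * (y <= s)%R%:R)).
  by apply: eq_Rintegral => y _; rewrite mulrBr.
rewrite RIB//; last first.
  apply: (@eq_intble _ _ _ L (fun y => prim (w i) s * h 0%N y)); last exact: intbleZ.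
  by move=> y; rewrite mulrC.
congr (_ - _); apply: eq_Rintegral => y _; rewrite mulrC indicE; congr (_ * _).
by rewrite mem_setE in_itv.
Qed.

End Kernel.

(** Each subset of the coordinates is a subsequence of the basis, so [H1] supplies the mixed
    derivative along it. *)
Lemma mask_basis (J : {set 'I_k}) :
  subseq [seq e j | j <- [seq val i | i <- enum J]] [seq e i | i <- iota 0 k].
Proof.
apply: map_subseq; rewrite -val_enum_ord; apply: map_subseq.
by rewrite enumT {1}/enum_mem; exact: filter_subseq.
Qed.

(** By [box_sep] it suffices to pair [G] and [f] with products of bumps b_i. Fubini moves the
    kernels onto the bumps: the term of J pairs the derivative of [f] along J with the corrector of
    b_i for i in J and with c_i w_i otherwise. Moving the derivative back onto the test function
    leaves [f] paired with the product of b_i - c_i w_i over J and c_i w_i off J. Summed over J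
    these products give the product of the b_i. *)
Theorem box_continuous_representative (f : V -> R) :
  L2 mu D f -> H1 mu D [seq e i | i <- iota 0 k] f ->
  exists G : V -> R, continuous G /\ ae_eq mu D f G.
Proof.
move=> l2f h1f.
have /choice[w hw] : forall i, exists w, (i < k)%N ->
    test1 (lo i) (hi i) w /\ \int[L]_t w 0%N t = 1.
  move=> i; have [ik|_] := boolP (i < k)%N; last by exists (fun _ _ => 0).
  by have [w hw] := unit_test1 (box_lt H ik); exists w.
have tw i : (i < k)%N -> test1 (lo i) (hi i) (w i) by move=> /hw[].
have w1 i : (i < k)%N -> \int[L]_t w i 0%N t = 1 by move=> /hw[].
have /choice[fJ hfJ] := fun J => h1f _ (mask_basis J).
have iD := box_indic_intble.
have igJ J : intble mu (fJ J \_ D) by apply: L2_intble (hfJ J).1.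
have ig : intble mu (f \_ D) by exact: L2_intble.
pose G z := \sum_(J : {set 'I_k}) \int[mu]_s ((fJ J \_ D) s * box_kern w J z s).
have cG : continuous G.
  have cJ J := @box_kern_cvg w tw J _ (igJ J).
  exact: (@continuous_big R _ _ _ predT (@add_continuous R) V _ _ (fun J _ => cJ J)).
exists G; split=> //.
have mG := box_cont_measurable H cG.
have mD : measurable_fun setT (\1_D : V -> R) by exact: measurable_indic box_measurable.
have [M M0 hM] := @compact_cont_bounded _ _ _ _ box_compactD (continuous_subspaceT cG).
have iGD : intble mu (fun z => G z * \1_D z).
  apply: (intble_le _ _ (intbleZ M iD)); first exact: measurable_funM.
  move=> z; rewrite indicE; have [/set_mem Dz|_] := boolP (z \in D).
    by rewrite !mulr1 hM.
  by rewrite !mulr0 normr0.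
have ih : intble mu (fun z => G z * \1_D z - (f \_ D) z) by exact: intbleB.
suff : {ae mu, forall z, G z * \1_D z - (f \_ D) z = 0}.
  apply: filterS => z /= + Dz; rewrite indicE patchE mem_set// mulr1.
  by move=> /subr0_eq.
apply: (box_sep H ih).
  move=> z nDz; rewrite indicE patchE memNset// mulr0 subr0//.
move=> idx.
pose b i := bumps (lo i) (hi i) (idx i).
have tb i : test1 (lo i) (hi i) (b i) by exact: bumps_test1.
pose ch := pd k p b (fun=> 0%N).
have cch : continuous ch by apply: (pd_cont H) => i _; exact: (tb i).1.
have mch := box_cont_measurable H cch.
have bch z : `|ch z| <= 1.
  rewrite normr_prod; apply: prodr_ile1 => i _; rewrite normr_ge0/=.
  have i0 : 0 < (idx i).1.+1%:R^-1 :> R by rewrite invr_gt0 ltr0n.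
  have /andP[b0 b1] := bump0_ge0 (lo i + (idx i).1.+1%:R^-1)
    (Num.min (hi i) (ratr (idx i).2) - (idx i).1.+1%:R^-1) (p i z) i0.
  by rewrite ger0_norm.
have ich : intble mu ch.
  by have [] // := box_prod H (h := fun i => b i 0%N) (fun i _ => test1_intble 0 (tb i)).
have chD z : \1_D z * ch z = ch z.
  rewrite indicE; have [_|nD] := boolP (z \in D); first by rewrite mul1r.
  rewrite mul0r; have : ~ (forall i, (i < k)%N -> lo i <= p i z <= hi i).
    by move=> /(box_mem H) /mem_set; exact/negP.
  move=> /existsNP[i] /not_implyP[ik /negP hz].
  rewrite /ch /pd (bigD1 (Ordinal ik))//=.
  have [_ [P [Q [lP Qh ->]]]] := tb i; first by rewrite mul0r.
  apply: contra hz => /andP[h1 h2].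
  by rewrite (le_trans (ltW lP) h1) (le_trans h2 (ltW Qh)).
have bpd h al : (forall i, (i < k)%N -> test1 (lo i) (hi i) (h i)) ->
    measurable_fun setT (pd k p h al) /\ exists Mh : R, forall z, `|pd k p h al z| <= Mh.
  move=> th; split.
    by apply: (box_cont_measurable H); apply: (pd_cont H) => i /th[].
  have : forall i, exists Mi : R, (i < k)%N -> forall x, `|h i (al i) x| <= Mi.
    move=> i; have [ik|_] := boolP (i < k)%N; last by exists 0.
    by have [Mi _ hMi] := test1_bounded (al i) (th i ik); exists Mi.
  move=> /choice[Mi hMi]; exists (\prod_(i < k) Mi i) => z.
  by rewrite normr_prod; apply: ler_prod => i _; rewrite normr_ge0 hMi.
(* The factors of the test function belonging to J; in the second branch the summand with
   coefficient 0 again fits [derivatives_lin]. *)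
pose ze (J : {set 'I_k}) (i : nat) : nat -> R -> R := if i \in [seq val j | j <- enum J]
  then corrector (w i) (b i)
  else fun n x => (\int[L]_t b i 0%N t) * w i n x + 0 * w i n x.
have memJ (J : {set 'I_k}) (i : 'I_k) : (val i \in [seq val j | j <- enum J]) = (i \in J).
  by rewrite mem_map ?mem_enum//; exact: val_inj.
have tze J i : (i < k)%N -> test1 (lo i) (hi i) (ze J i).
  move=> ik; rewrite /ze; case: ifPn => _.
    exact: corrector_test1 (tw i ik) (w1 i ik) (tb i).
  split; first by apply: derivatives_lin; exact: (tw i ik).1.
  have [_ [P [Q [lP Qh w0]]]] := tw i ik.
  by exists P, Q; split => // n x /w0 ->; rewrite !mulr0 addr0.
have step J : \int[mu]_z (ch z * \int[mu]_s ((fJ J \_ D) s * box_kern w J z s)) =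
    \int[mu]_s ((f \_ D) s * \prod_(i < k) (if i \in J then b i 0%N (p i s) -
        (\int[L]_t b i 0%N t) * w i 0%N (p i s) else (\int[L]_t b i 0%N t) * w i 0%N (p i s))).
  have [MK hMK] := box_kern_bounded tw J.
  have mK := box_kern_meas tw J.
  have i2 : intble (prodm mu mu) (fun z => ch z.1 * (fJ J \_ D) z.2 * box_kern w J z.1 z.2).
    exact: (intble_bM (intble_prod ich (igJ J)) mK (fun z => hMK z.1 z.2)).
  transitivity (\int[mu]_z \int[mu]_s (ch z * (fJ J \_ D) s * box_kern w J z s)).
    apply: eq_Rintegral => z _; rewrite -RIZ.
      by apply: eq_Rintegral => s _; rewrite mulrA.
    exact: (intble_bM (igJ J) (meas_sec1 z mK) (hMK z)).
  rewrite (RI_fubini1 i2) -(RI_fubini2 i2)/=.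
  transitivity (\int[mu]_s ((fJ J \_ D) s * pd k p (ze J) (fun=> 0%N) s)).
    apply: eq_Rintegral => s _.
    have hk i : (i < k)%N -> forall bb : bool, _ :=
      fun ik bb => kern_integral tw bb (p i s) ik (tb i) (w1 i ik).
    pose hh i y := b i 0%N y * kern w (i \in [seq val j | j <- enum J]) i y (p i s).
    have [ihh ehh] := box_prod H (h := hh) (fun i ik => (hk i ik _).1).
    transitivity (\int[mu]_z ((fJ J \_ D) s * \prod_(i < k) hh i (p i z))).
      apply: eq_Rintegral => z _; rewrite /hh big_split/= [X in X * _]mulrC -mulrA.
      congr (_ * (_ * _)); apply: eq_bigr => i _.
      by rewrite memJ.
    rewrite RIZ// ehh /pd; congr (_ * _); apply: eq_bigr => i _.
    rewrite (hk i (ltn_ord i) _).2 /ze; case: ifP => // _.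
    by rewrite mul0r addr0.
  have [_ [_ _ wd]] := hfJ J.
  have := wd _ (pd_test H (tze J)).
  have Jk : all (fun i => i < k)%N [seq val i | i <- enum J].
    by apply/allP => _ /mapP[i _ ->]; exact: ltn_ord.
  rewrite (RI_restrict mu D f) (RI_restrict mu D (fJ J)).
  rewrite (pd_iter H _ Jk (fun i ik => (tze J i ik).1)).
  rewrite !size_map -cardE => wdJ.
  have -> : \int[mu]_s ((fJ J \_ D) s * pd k p (ze J) (fun=> 0%N) s) =
     (-1) ^+ #|J| * \int[mu]_z ((f \_ D) z * pd k p (ze J)
       (fun i => (0 + count_mem i [seq val i | i <- enum J])%N) z).
    by rewrite wdJ mulrA -exprMn mulrNN mulr1 expr1n mul1r.
  rewrite -RIZ; last first.
    have [mpd [Mp hMp]] := bpd (ze J) (fun i => (0 + count_mem i [seq val i | i <- enum J])%N) (tze J).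
    exact: (intble_bM ig mpd hMp).
  (* The sign [(-1) ^+ #|J|] is distributed over J: the corrector has derivative c_i w_i - b_i, and
     -1 times it is the factor wanted. [count_mem] is 1 on J and 0 off it. *)
  apply: eq_Rintegral => s _; rewrite mulrCA; congr (_ * _).
  rewrite -prodr_const /pd big_mkcond -big_split/=; apply: eq_bigr => i _.
  rewrite add0n count_uniq_mem ?map_inj_uniq ?enum_uniq//; last exact: val_inj.
  rewrite /ze memJ; case: ifP => iJ /=; last by rewrite mul1r mul0r addr0.
  by rewrite mulN1r opprB.
transitivity (\int[mu]_z (ch z * G z) - \int[mu]_z (ch z * (f \_ D) z)).
  rewrite -RIB.
  - apply: eq_Rintegral => z _; rewrite mulrBl -mulrA; congr (_ - _).
      by rewrite -/(pd k p b (fun=> 0%N) z) -/ch chD mulrC.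
    by rewrite mulrC.
  - apply: (eq_intble (f := fun z => G z * \1_D z * ch z)).
      by move=> z; rewrite -mulrA chD mulrC.
    exact: (intble_bM iGD mch bch).
  - apply: (eq_intble (f := fun z => (f \_ D) z * ch z)).
      by move=> z; rewrite mulrC.
    exact: (intble_bM ig mch bch).
apply/eqP; rewrite subr_eq0; apply/eqP.
rewrite /G; under eq_Rintegral do rewrite mulr_sumr.
rewrite RI_sum; last first.
  move=> J _.
  have [MK hMK] := box_kern_bounded tw J.
  have mK := box_kern_meas tw J.
  have i2 : intble (prodm mu mu) (fun z => ch z.1 * (fJ J \_ D) z.2 * box_kern w J z.1 z.2).
    exact: (intble_bM (intble_prod ich (igJ J)) mK (fun z => hMK z.1 z.2)).
  apply: (eq_intble _ (intble_pint i2)) => z /=.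
  rewrite -RIZ; last exact: (intble_bM (igJ J) (meas_sec1 z mK) (hMK z)).
  by apply: eq_Rintegral => s _; rewrite mulrA.
rewrite (eq_bigr _ (fun J _ => step J)) -RI_sum; last first.
  move=> J _.
  (* Each summand is itself a tensor product of test functions, hence measurable and bounded. *)
  pose th i : nat -> R -> R := if i \in [seq val j | j <- enum J]
    then fun n x => 1 * b i n x + (- \int[L]_t b i 0%N t) * w i n x
    else fun n x => (\int[L]_t b i 0%N t) * w i n x + 0 * w i n x.
  have tth i : (i < k)%N -> test1 (lo i) (hi i) (th i).
    move=> ik; rewrite /th; case: ifPn => _; split.
    - by apply: derivatives_lin; [exact: (tb i).1|exact: (tw i ik).1].
    - have [_ [P [Q [lP Qh w0]]]] := tw i ik; have [_ [P' [Q' [lP' Qh' b0]]]] := tb i.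
      exists (Num.min P P'), (Num.max Q Q'); split; rewrite ?lt_min ?gt_max ?lP ?Qh//.
      move=> n x; rewrite ge_min le_max => hx; rewrite w0 ?b0 ?mulr0 ?addr0//.
        by apply: contra hx => /andP[-> ->]; rewrite !orbT.
      by apply: contra hx => /andP[-> ->].
    - by apply: derivatives_lin; exact: (tw i ik).1.
    - have [_ [P [Q [lP Qh w0]]]] := tw i ik.
      by exists P, Q; split => // n x /w0 ->; rewrite !mulr0 addr0.
  have [mpd [Mp hMp]] := bpd th (fun=> 0%N) tth.
  apply: (eq_intble _ (intble_bM ig mpd hMp)) => z; congr (_ * _).
  apply: eq_bigr => i _; rewrite /th memJ; case: ifP => _.
    by rewrite mul1r mulNr.
  by rewrite mul0r addr0.
(* Expanding the product of (b_i - c_i w_i) + c_i w_i over subsets J, read backwards. *)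
apply: eq_Rintegral => z _; rewrite -mulr_sumr -bigA_distr mulrC; congr (_ * _).
by apply: eq_bigr => i _; rewrite /= subrK.
Qed.

End ContinuousRepresentative.

(** * Absolute continuity along slices *)

Definition swap12 (A B : Type) (z : A * B) : B * A := (z.2, z.1).

Lemma mpres_swap12 d1 d2 (T1 : measurableType d1) (T2 : measurableType d2) (R : realType)
  (m1 : {sigma_finite_measure set T1 -> \bar R}) (m2 : {sigma_finite_measure set T2 -> \bar R}) :
  measure_preserving (prodm m1 m2) (prodm m2 m1) (@swap12 T1 T2).
Proof.
have mm : measurable_fun [set: T1 * T2] (@swap12 T1 T2).
  by apply: measurable_fun_pair; [exact: measurable_snd|exact: measurable_fst].
apply: (mpres_rect mm) => A B mA mB.
have -> : @swap12 T1 T2 @^-1` (A `*` B) = B `*` A.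
  by apply/seteqP; split=> -[x y] [].
by rewrite -[LHS]/(prodm m1 m2 (B `*` A)) prodm_rect// muleC.
Qed.

Lemma intble_pint2 d1 d2 (T1 : measurableType d1) (T2 : measurableType d2) (R : realType)
  (m1 : {sigma_finite_measure set T1 -> \bar R}) (m2 : {sigma_finite_measure set T2 -> \bar R})
  (f : T1 * T2 -> R) : intble (prodm m1 m2) f -> intble m2 (fun y => \int[m1]_x f (x, y)).
Proof. by move=> jf; exact: (intble_pint (mpres_intble (mpres_swap12 m2 m1) jf)). Qed.

Section Line.
Variable R : realType.
Local Notation L := (leb R).
Implicit Types (c d x y s t : R) (phi dphi g f : R -> R).

(** What integration by parts along a line uses of a test function; the slices y -> phi(x, y) of a
    two-variable test function have these properties, as do one-variable test functions. *)
Definition bfun c d phi dphi := [/\ forall y, is_derive y 1 phi (dphi y),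
  continuous dphi, forall y, ~~ (c < y < d) -> phi y = 0 &
  forall y, ~~ (c <= y <= d) -> dphi y = 0].

Lemma test1_bfun c d h : test1 c d h -> bfun c d (h 0%N) (h 1%N).
Proof.
move=> [dh [p [q [cp qd h0]]]]; split.
- by move=> y; exact: dh.
- exact: derivatives_cont dh.
- move=> y hy; apply: h0; apply: contra hy => /andP[py yq].
  by rewrite (lt_le_trans cp py) (le_lt_trans yq qd).
- move=> y hy; apply: h0; apply: contra hy => /andP[py yq].
  by rewrite (le_trans (ltW cp) py) (le_trans yq (ltW qd)).
Qed.

Lemma cont_supp_intble c d f : continuous f -> (forall y, ~~ (c <= y <= d) -> f y = 0) ->
  intble L f.
Proof.
move=> cf f0.
have [M M0 hM] := @compact_cont_bounded _ _ _ f (@segment_compact R c d) (continuous_subspaceT cf).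
apply: (@intble_le _ _ _ L _ (fun x => M * \1_`[c, d] x)).
- exact: (cont_meas cf).
- move=> x; have [xpq|/f0 ->] := boolP (c <= x <= d); last first.
    by rewrite normr0 mulr_ge0 ?indic_ge0// ltW.
  by rewrite indicE mem_set/= ?in_itv// mulr1 hM//= in_itv.
- exact/intbleZ/itv_intble.
Qed.

Lemma meas_geR s : measurable_fun [set: measurableTypeR R] (fun y => (s <= y)%R%:R : R).
Proof. by apply: meas_ler. Qed.

Lemma meas_leR s : measurable_fun [set: measurableTypeR R] (fun y => (y <= s)%R%:R : R).
Proof. by apply: meas_ler. Qed.

Lemma natb_le1 (b : bool) : `|b%:R : R| <= 1.
Proof. by case: b; rewrite ?normr1 ?normr0. Qed.

Lemma ae_neq s : {ae L, forall y, y != s}.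
Proof.
exists [set s]; split => //; first exact: lebesgue_measure_set1.
by move=> x /= /negP; rewrite negbK => /eqP.
Qed.

Lemma bfun_intble c d phi dphi : bfun c d phi dphi -> intble L dphi.
Proof. by move=> [_ cd _ d0]; exact: cont_supp_intble cd d0. Qed.

Lemma bfun_prim c d phi dphi s : c <= d -> bfun c d phi dphi ->
  \int[L]_y (dphi y * (y <= s)%R%:R) = phi s.
Proof.
move=> lcd B; have [dph cd p0 d0] := B; have id := bfun_intble B.
have pE x : prim (fun=> dphi) x = \int[L]_y (dphi y * (y <= x)%R%:R).
  rewrite primE; apply: eq_Rintegral => y _; rewrite mulrC indicE; congr (_ * _).
  by rewrite mem_setE in_itv.
rewrite -pE; have dprim x := prim_derive_cont (h := fun=> dphi) x cd id.
have cst0 x : is_derive x 1 (prim (fun=> dphi) - phi) 0.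
  have := is_deriveB (dprim x) (dph x); by rewrite subrr.
have := is_derive_0_is_cst s (c - 1) cst0.
rewrite -[LHS]/(prim _ s - phi s) -[RHS]/(prim _ (c - 1) - phi (c - 1)).
have -> : phi (c - 1) = 0.
  by apply: p0; apply/negP => /andP[]; rewrite ltrBrDr; lra.
have -> : prim (fun=> dphi) (c - 1) = 0.
  rewrite pE -[RHS](RI0 L); apply: eq_Rintegral => y _.
  have [yc|_] := leP y (c - 1); last by rewrite mulr0.
  by rewrite d0 ?mul0r//; apply/negP => /andP[]; lra.
by rewrite subrr => /subr0_eq.
Qed.

Lemma bfun_tail c d phi dphi s : c <= d -> bfun c d phi dphi ->
  \int[L]_y (dphi y * (s <= y)%R%:R) = - phi s.
Proof.
move=> lcd B; have id := bfun_intble B; have [_ _ p0 d0] := B.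
have tot : \int[L]_y dphi y = 0.
  rewrite -[RHS](p0 d) ?ltxx ?andbF// -(bfun_prim d lcd B); apply: eq_Rintegral => y _.
  have [yd|dy] := leP y d; first by rewrite mulr1.
  by rewrite mulr0 d0//; apply/negP => /andP[]; rewrite (leNgt y) dy.
have ib t : intble L (fun y => dphi y * (y <= t)%R%:R).
  by apply: (intble_bM id (meas_leR t) (fun y => natb_le1 _)).
rewrite -(bfun_prim s lcd B) -[RHS]add0r -tot -RIB//.
apply: RI_ae.
- by apply: measurable_funM; [exact: intble_meas id|exact: meas_geR].
- by apply: measurable_funB; [exact: intble_meas id|exact: intble_meas (ib s)].
- apply: filterS (ae_neq s); first exact: (ae_filter_ringOfSetsType L).
  move=> y ys; have [sy|sy|E] := ltgtP s y.
  + by rewrite mulr1 mulr0 subr0.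
  + by rewrite mulr1 mulr0 subrr.
  + by rewrite E eqxx in ys.
Qed.

Lemma bfun_bounded c d phi dphi : bfun c d phi dphi ->
  exists M : R, forall y, `|phi y| <= M /\ `|dphi y| <= M.
Proof.
move=> [dph cd p0 d0].
have cphi : continuous phi.
  by move=> x; apply/differentiable_continuous/derivable1_diffP; have [] := dph x.
have [M M0 hM] := @compact_cont_bounded _ _ _ phi (@segment_compact R c d) (continuous_subspaceT cphi).
have [M' M'0 hM'] := @compact_cont_bounded _ _ _ dphi (@segment_compact R c d) (continuous_subspaceT cd).
exists (M + M') => y; have [ycd|ycd] := boolP (c <= y <= d).
  split; first by rewrite (le_trans (hM y _)) ?lerDl ?ltW//= in_itv.
  by rewrite (le_trans (hM' y _)) ?lerDr ?ltW//= in_itv.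
rewrite d0// p0 ?normr0 ?addr_ge0 ?ltW//.
by apply: contra ycd => /andP[/ltW -> /ltW ->].
Qed.

Lemma bfun_meas c d phi dphi : bfun c d phi dphi ->
  measurable_fun [set: measurableTypeR R] phi /\ measurable_fun [set: measurableTypeR R] dphi.
Proof.
move=> [dph cd p0 d0]; split; last exact: cont_meas.
apply: cont_meas => x.
by apply/differentiable_continuous/derivable1_diffP; have [] := dph x.
Qed.

(** Fubini replaces the product rule for absolutely continuous functions. With f written as A plus
    the primitive of g, the integral of [dphi] over y >= max(q, s) is -phi(max(q, s)). For s > q
    this cancels the term g phi; for s <= q it is -phi(q), and together with A it assembles the
    value of f at q. *)
Lemma slice_tail c d phi dphi A f g q : c <= d -> c <= q <= d -> bfun c d phi dphi ->
  intble L f -> intble L g -> (forall y, ~~ (c <= y <= d) -> f y = 0) ->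
  {ae L, forall y, c <= y <= d -> f y = A + \int[L]_s (g s * (s <= y)%R%:R)} ->
  \int[L]_y ((q <= y)%R%:R * (f y * dphi y + g y * phi y)) =
  - ((A + \int[L]_s (g s * (s <= q)%R%:R)) * phi q).
Proof.
move=> lcd qcd B jf jg f0 hf.
have [M hM] := bfun_bounded B; have [mphi mdphi] := bfun_meas B.
have id := bfun_intble B; have [_ _ p0 d0] := B.
have i2 : intble (prodm L L) (fun z => dphi z.1 * g z.2 * ((z.2 <= z.1)%R%:R * (q <= z.1)%R%:R)).
  apply: (@intble_bM _ _ _ _ _ _ 1 (intble_prod id jg)).
    apply: measurable_funM; apply: meas_ler => //.
  by move=> z; rewrite normrM mulr_ile1// natb_le1.
have ipg := intble_pint i2.
have iA : intble L (fun y => A * (dphi y * (q <= y)%R%:R)).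
  by apply: intbleZ; apply: (intble_bM id (meas_geR q) (fun y => natb_le1 _)).
have igp : intble L (fun y => g y * ((q <= y)%R%:R * phi y)).
  apply: (@intble_bM _ _ _ _ _ _ M jg); first by apply: measurable_funM => //; exact: meas_geR.
  move=> y; have [h _] := hM y; case: (q <= y); rewrite ?(mul1r, mul0r)// normr0.
  exact: le_trans h.
have ifd : intble L (fun y => f y * dphi y) by apply: (intble_bM jf mdphi (fun y => (hM y).2)).
transitivity (\int[L]_y (A * (dphi y * (q <= y)%R%:R) +
    \int[L]_s (dphi y * g s * ((s <= y)%R%:R * (q <= y)%R%:R)) + g y * ((q <= y)%R%:R * phi y))).
  apply: RI_ae.
  - apply: measurable_funM; first exact: meas_geR.
    apply: measurable_funD; first exact: intble_meas ifd.
    by apply: measurable_funM => //; exact: intble_meas jg.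
  - apply: measurable_funD; last exact: intble_meas igp.
    by apply: measurable_funD; [exact: intble_meas iA|exact: intble_meas ipg].
  - apply: filterS hf; first exact: (ae_filter_ringOfSetsType L).
    move=> y hy; rewrite mulrDr; congr (_ + _); last by rewrite mulrCA.
    have -> : \int[L]_s (dphi y * g s * ((s <= y)%R%:R * (q <= y)%R%:R)) =
        dphi y * (q <= y)%R%:R * \int[L]_s (g s * (s <= y)%R%:R).
      rewrite -RIZ; last by apply: (intble_bM jg (meas_leR y) (fun s => natb_le1 _)).
      by apply: eq_Rintegral => s _; ring.
    have [ycd|ycd] := boolP (c <= y <= d); last by rewrite d0//; ring.
    by rewrite hy//; ring.
rewrite RID//; last exact: intbleD.
rewrite RID// RIZ; last by apply: (intble_bM id (meas_geR q) (fun y => natb_le1 _)).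
rewrite (bfun_tail q lcd B) (RI_fubini1 i2) -(RI_fubini2 i2)/=.
have E s : \int[L]_y (dphi y * g s * ((s <= y)%R%:R * (q <= y)%R%:R)) =
    g s * - phi (Num.max q s).
  rewrite -(bfun_tail _ lcd B) -RIZ; last by apply: (intble_bM id (meas_geR _) (fun y => natb_le1 _)).
  apply: eq_Rintegral => y _; rewrite ge_max.
  by case: (q <= y); case: (s <= y); rewrite /=; ring.
under [X in _ + X + _]eq_Rintegral do rewrite E.
have iE : intble L (fun s => g s * - phi (Num.max q s)).
  by apply: (eq_intble _ (intble_pint2 i2)) => s; exact: E.
rewrite -addrA -RID//.
rewrite (_ : \int[L]_x _ = \int[L]_x (g x * (x <= q)%R%:R * - phi q)).
  rewrite RIZr; last by apply: (intble_bM jg (meas_leR _) (fun y => natb_le1 _)).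
  ring.
apply: RI_ae.
- by apply: measurable_funD; [exact: intble_meas iE|exact: intble_meas igp].
- apply: measurable_funM => //; apply: measurable_funM; first exact: intble_meas jg.
  exact: meas_leR.
- apply: filterS (ae_neq q); first exact: (ae_filter_ringOfSetsType L).
  move=> y ys; have [sy|sy|E'] := ltgtP q y; rewrite /=.
  + by ring.
  + by ring.
  + by rewrite E' eqxx in ys.
Qed.

(** The tail from [c] is the whole integral, because [f] and [g] vanish off [c, d], and it is 0
    because phi(c) = 0. The head is thus minus the tail from [q]. *)
Lemma slice_head c d phi dphi A f g q : c <= d -> c <= q <= d -> bfun c d phi dphi ->
  intble L f -> intble L g -> (forall y, ~~ (c <= y <= d) -> f y = 0) ->
  (forall y, ~~ (c <= y <= d) -> g y = 0) ->
  {ae L, forall y, c <= y <= d -> f y = A + \int[L]_s (g s * (s <= y)%R%:R)} ->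
  \int[L]_y ((y <= q)%R%:R * (f y * dphi y + g y * phi y)) =
  (A + \int[L]_s (g s * (s <= q)%R%:R)) * phi q.
Proof.
move=> lcd qcd B jf jg f0 g0 hf.
have ccd : c <= c <= d by rewrite lexx.
have [M hM] := bfun_bounded B; have [mphi mdphi] := bfun_meas B.
have [_ _ p0 d0] := B.
have H1 := slice_tail lcd qcd B jf jg f0 hf.
have H2 := slice_tail lcd ccd B jf jg f0 hf.
have ix : intble L (fun y => f y * dphi y + g y * phi y).
  by apply: intbleD; [exact: (intble_bM jf mdphi (fun y => (hM y).2))|
    exact: (intble_bM jg mphi (fun y => (hM y).1))].
have it t : intble L (fun y => (t <= y)%R%:R * (f y * dphi y + g y * phi y)).
  apply: (eq_intble _ (intble_bM ix (meas_geR t) (fun y => natb_le1 _))) => y.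
  by rewrite mulrC.
rewrite -[RHS]opprK -H1 -[RHS]add0r.
have {1}-> : 0 = \int[L]_y ((c <= y)%R%:R * (f y * dphi y + g y * phi y)).
  by rewrite H2 (p0 c) ?ltxx// mulr0 oppr0.
rewrite -RIB//; apply: RI_ae.
- by apply: measurable_funM; [exact: meas_leR|exact: intble_meas ix].
- by apply: measurable_funB; exact: intble_meas (it _).
- apply: filterS (ae_neq q); first exact: (ae_filter_ringOfSetsType L).
  move=> y ys; have [ycd|ycd] := boolP (c <= y <= d); last by rewrite f0// g0//; ring.
  have /andP[-> _] := ycd.
  have [sy|sy|E'] := ltgtP q y; rewrite /=.
  + by ring.
  + by ring.
  + by rewrite E' eqxx in ys.
Qed.

End Line.

Lemma ae_within_cont_eq0 (R : realType) (c d : R) (H : R -> R) : c < d ->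
  {within `[c, d], continuous H} -> {ae leb R, forall y, c <= y <= d -> H y = 0} ->
  forall y, c <= y <= d -> H y = 0.
Proof.
move=> cd cH [N [mN N0 hN]] y /andP[cy yd]; apply: contrapT => /eqP Hy.
have Hy0 : 0 < `|H y| by rewrite normr_gt0.
have yin : `[c, d]%classic y by rewrite /= in_itv/= cy.
move/subspace_continuousP : cH => /(_ y yin) /cvgrPdist_lt/(_ _ Hy0).
rewrite /within/= => /nbhs_ballP[r /= r0 hr].
pose lft := Num.max c (y - r); pose rgt := Num.min d (y + r).
have IN : `]lft, rgt[%classic `<=` N.
  move=> x; rewrite /= in_itv/= /lft /rgt gt_max lt_min => /andP[/andP[cx rx] /andP[xd xr]].
  apply: hN => /=; rewrite (ltW cx) (ltW xd) => /(_ isT) Hx.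
  have bx : ball y r x by rewrite -ball_normE/= ltr_norml; lra.
  have xin : x \in `[c, d] by rewrite in_itv/= !ltW.
  have h : `|H y - H x| < `|H y| := hr x bx xin.
  by rewrite Hx subr0 ltxx in h.
have : (leb R `]lft, rgt[%classic <= leb R N)%E.
  by apply: le_measure; rewrite ?inE//; exact: measurable_itv.
have pos : lft < rgt by rewrite /lft /rgt gt_max !lt_min; lra.
rewrite N0 /= lebesgue_measure_itv/= lte_fin pos -EFinD lee_fin.
by rewrite leNgt subr_gt0 pos.
Qed.

Lemma prim_le_cont (R : realType) (g : R -> R) : intble (leb R) g ->
  continuous (fun y : R => \int[leb R]_s (g s * (s <= y)%R%:R)).
Proof.
move=> jg y; apply: (@seq_cvg_at R R) => u uy.
have [] // := @DCT _ _ _ (leb R) (fun n s => g s * (s <= u n)%R%:R)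
   (fun s => g s * (s <= y)%R%:R) (fun s => `|g s|) _ _ _ _ _.
- by move=> n; apply: measurable_funM; [exact: intble_meas jg|exact: meas_leR].
- by apply: measurable_funM; [exact: intble_meas jg|exact: meas_leR].
- apply: filterS (ae_neq y); first exact: (ae_filter_ringOfSetsType (leb R)).
  move=> s sy; apply: cvgMr; apply: cvg_near_cst.
  have [sy'|ys|E] := ltgtP s y; last by rewrite E eqxx in sy.
    near=> n; suff -> : s <= u n by [].
    by apply: ltW; near: n; exact: (cvgr_gt _ uy).
  near=> n; rewrite leNgt; suff -> : u n < s by [].
  by near: n; exact: (cvgr_lt _ uy).
- exact: integrable_norm jg.
- by move=> n s; rewrite normrM ler_piMr// natb_le1.
Unshelve. all: by end_near. Qed.

(** * Weak derivatives restricted to lines in the last variable *)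

Section Slices.
Context (R : realType) (d : measure_display) (Z : measurableNormedModType R d).
Variables (mZ : {sigma_finite_measure set Z -> \bar R}) (k : nat).
Variables (p : nat -> Z -> R) (e : nat -> Z) (lo hi : nat -> R) (DZ : set Z).
Hypothesis HZ : box_space mZ k p e lo hi DZ.
Hypothesis lohi : lo k < hi k.
Local Notation L := (leb R).
Local Notation mu := (prodm mZ L).

Variables (f g : Z * measurableTypeR R -> R).
Hypotheses (jf : intble mu f) (jg : intble mu g).
Hypothesis f0 : forall v y, ~ (DZ v /\ lo k <= y <= hi k) -> f (v, y) = 0.
Hypothesis g0 : forall v y, ~ (DZ v /\ lo k <= y <= hi k) -> g (v, y) = 0.

Definition tensor (h : nat -> nat -> R -> R) (n : nat) (z : Z * measurableTypeR R) :=
  (\prod_(i < k) h i 0%N (p i z.1)) * h k n z.2.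

Hypothesis weak_fg : forall h, (forall i, (i < k.+1)%N -> test1 (lo i) (hi i) (h i)) ->
  \int[mu]_z (f z * tensor h 1 z) = - \int[mu]_z (g z * tensor h 0 z).

Let Pg v y := \int[L]_s (g (v, s) * (s <= y)%R%:R).
Let Ik y : R := \1_(`[lo k, hi k]%classic) y.

Let i3 : intble (prodm mu L) (fun z => g (z.1.1, z.2) * Ik z.1.2 * (z.2 <= z.1.2)%R%:R).
Proof.
apply: (@intble_bM _ _ _ _ _ _ 1); last by move=> z; exact: natb_le1.
  have iI : intble L Ik by exact: itv_intble.
  exact: (mpres_intble (mpres_swap23 mZ L L) (intble_prod jg iI)).
by apply: meas_ler; [exact: measurable_snd|exact: (measurableT_comp measurable_snd measurable_fst)].
Qed.

(** To the right of the interval the primitive [Pg] is constant in [y], so it is made integrable by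
    the indicator [Ik]. *)
Let iPg : intble mu (fun z => Pg z.1 z.2 * Ik z.2).
Proof.
apply: (eq_intble _ (intble_pint i3)) => z /=; rewrite /Pg /Ik indicE.
case: (_ \in _); last first.
  rewrite /= mulr0 -[RHS](RI0 L); apply: eq_Rintegral => s _.
  by rewrite mulr0 mul0r.
by rewrite /= mulr1; apply: eq_Rintegral => s _; rewrite mulr1.
Qed.

Let Ik_in y : lo k <= y <= hi k -> Ik y = 1.
Proof. by move=> h; rewrite /Ik indicE mem_set//= in_itv. Qed.

Let Ik_out y : ~~ (lo k <= y <= hi k) -> Ik y = 0.
Proof. by move=> h; rewrite /Ik indicE memNset//= in_itv; exact/negP. Qed.

(** The du Bois-Reymond argument with parameters. [F], which is [f] minus the primitive of [g], is
    annihilated by the y-derivative of every test product. Since b differs from a multiple of [w] by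
    such a derivative, pairing [F] with b is the same as pairing with b the weighted mean [AF] of
    [F] against [w]. Hence [F] equals [AF], which is independent of y. *)
Lemma slices_ac : {ae mZ, forall v, exists A, {ae L, forall y, lo k <= y <= hi k ->
  f (v, y) = A + \int[L]_s (g (v, s) * (s <= y)%R%:R)}}.
Proof.
have [w [tw w1]] := unit_test1 lohi.
pose F z := f z - Pg z.1 z.2 * Ik z.2.
have iF : intble mu F by apply: intbleB jf iPg.
have mtest h n : test1 (lo k) (hi k) h -> measurable_fun setT (fun z : Z * measurableTypeR R => h n z.2).
  by move=> th; apply: (measurableT_comp (cont_meas (derivatives_cont th.1))).
have btest h n : test1 (lo k) (hi k) h -> exists M : R, forall z : Z * measurableTypeR R, `|h n z.2| <= M.
  by move=> th; have [M _ hM] := test1_bounded n th; exists M => z.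
have iFt h n : test1 (lo k) (hi k) h -> intble mu (fun z => F z * h n z.2).
  by move=> th; have [M hM] := btest h n th; exact: (intble_bM iF (mtest h n th) hM).
pose AF v := \int[L]_t (F (v, t) * w 0%N t).
have iAF : intble mZ AF by exact: (intble_pint (iFt w 0%N tw)).
have iI : intble L Ik by exact: itv_intble.
have iF' : intble mu (fun z => F z - AF z.1 * Ik z.2) by apply: (intbleB iF (intble_prod iAF iI)).
have sep : {ae mu, forall z, F z - AF z.1 * Ik z.2 = 0}.
  apply: (box_sep (box_spaceS HZ lohi) iF').
    move=> [v y] nD.
    have fvy : f (v, y) = 0.
      by apply: f0 => -[Dv yk]; apply: nD; split => //=; rewrite in_itv.
    have [Dv|nDv] := pselect (DZ v).
      rewrite /F /= fvy Ik_out ?mulr0 ?subr0//.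
      by apply/negP => yk; apply: nD; split => //=; rewrite in_itv.
    have Pg0 t : Pg v t = 0.
      rewrite /Pg -[RHS](RI0 L); apply: eq_Rintegral => s _.
      by rewrite g0 ?mul0r// => -[].
    have F0 t : F (v, t) = 0.
      by rewrite /F /= Pg0 mul0r subr0 f0// => -[].
    rewrite F0 /= /AF (_ : \int[L]_t _ = 0) ?mul0r ?subr0//.
    by rewrite -[RHS](RI0 L); apply: eq_Rintegral => t _; rewrite F0 mul0r.
  move=> idx.
  pose b i := bumps (lo i) (hi i) (idx i).
  have tb i : test1 (lo i) (hi i) (b i) by exact: bumps_test1.
  pose ch := pd k p b (fun=> 0%N).
  have mch : measurable_fun setT ch.
    by apply: (box_cont_measurable HZ); apply: (pd_cont HZ) => i _; exact: (tb i).1.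
  have bch z : `|ch z| <= 1.
    rewrite normr_prod; apply: prodr_ile1 => i _; rewrite normr_ge0/=.
    have i0 : 0 < (idx i).1.+1%:R^-1 :> R by rewrite invr_gt0 ltr0n.
    have /andP[b0 b1] := bump0_ge0 (lo i + (idx i).1.+1%:R^-1)
      (Num.min (hi i) (ratr (idx i).2) - (idx i).1.+1%:R^-1) (p i z) i0.
    by rewrite ger0_norm.
  have mch1 : measurable_fun setT (fun z : Z * measurableTypeR R => ch z.1).
    exact: (measurableT_comp mch).
  have bch1 (z : Z * measurableTypeR R) : `|ch z.1| <= 1 by [].
  pose ce := \int[L]_t b k 0%N t.
  (* The difference to be shown zero becomes minus the pairing of [F] with the derivative of [Ph],
     times the factor [ch] in the other variables. *)
  have [Ph [tPh PhE]] : exists Ph, test1 (lo k) (hi k) Ph /\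
      forall y, Ph 1%N y = ce * w 0%N y - b k 0%N y.
    by exists (corrector w (b k)); split=> //; exact: corrector_test1.
  have iFtc h n : test1 (lo k) (hi k) h -> intble mu (fun z => F z * h n z.2 * ch z.1).
    by move=> th; exact: (intble_bM (iFt h n th) mch1 bch1).
  have iAFc : intble mZ (fun v => AF v * ch v) by exact: (intble_bM iAF mch bch).
  have IkE h n y : test1 (lo k) (hi k) h -> Ik y * h n y = h n y.
    move=> th; have [yk|yk] := boolP (lo k <= y <= hi k); first by rewrite Ik_in// mul1r.
    rewrite Ik_out// mul0r; have [_ [P [Q [lP Qh ->]]]] := th => //.
    by apply: contra yk => /andP[h1 h2]; rewrite (le_trans (ltW lP) h1) (le_trans h2 (ltW Qh)).
  transitivity (\int[mu]_z (F z * b k 0%N z.2 * ch z.1 - AF z.1 * ch z.1 * b k 0%N z.2)).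
    apply: eq_Rintegral => z _; rewrite big_ord_recr/= ltnn.
    rewrite (_ : \prod_(i < k) _ = ch z.1); last first.
      by apply: eq_bigr => i _; rewrite ltn_ord.
    rewrite -/(b k) mulrBl; congr (_ - _); first by ring.
    by rewrite -[in RHS](IkE (b k) 0%N z.2 (tb k)); ring.
  have ibk := test1_intble 0 (tb k).
  rewrite RIB; [|exact: (iFtc (b k) 0%N (tb k))|exact: (intble_prod iAFc ibk)].
  rewrite (RI_prod iAFc ibk) -/ce.
  have -> : \int[mZ]_v (AF v * ch v) = \int[mu]_z (F z * w 0%N z.2 * ch z.1).
    rewrite -(RI_fubini1 (iFtc w 0%N tw)); apply: RI_ae.
    - exact: intble_meas iAFc.
    - exact: intble_meas (intble_pint (iFtc w 0%N tw)).
    - apply: filterS (intble_sec1 (iFt w 0%N tw)) => v iv.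
      exact: (esym (RIZr (ch v) iv)).
  rewrite -RIZr; last exact: iFtc.
  rewrite -RIB; [|exact: iFtc|]; last first.
    apply: (eq_intble _ (intbleZ ce (iFtc w 0%N tw))) => z.
    by rewrite mulrC.
  transitivity (\int[mu]_z (- (F z * Ph 1%N z.2 * ch z.1))).
    by apply: eq_Rintegral => z _; rewrite PhE; ring.
  rewrite RIN; last exact: iFtc.
  apply/eqP; rewrite oppr_eq0; apply/eqP.
  have ifh : intble mu (fun z => f z * Ph 1%N z.2 * ch z.1).
    have [M hM] := btest Ph 1%N tPh.
    exact: (intble_bM (intble_bM jf (mtest Ph 1%N tPh) hM) mch1 bch1).
  have igh : intble mu (fun z => g z * Ph 0%N z.2 * ch z.1).
    have [M hM] := btest Ph 0%N tPh.
    exact: (intble_bM (intble_bM jg (mtest Ph 0%N tPh) hM) mch1 bch1).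
  have iPh : intble mu (fun z => Pg z.1 z.2 * Ik z.2 * Ph 1%N z.2 * ch z.1).
    have [M hM] := btest Ph 1%N tPh.
    exact: (intble_bM (intble_bM iPg (mtest Ph 1%N tPh) hM) mch1 bch1).
  transitivity (\int[mu]_z (f z * Ph 1%N z.2 * ch z.1 - Pg z.1 z.2 * Ik z.2 * Ph 1%N z.2 * ch z.1)).
    by apply: eq_Rintegral => z _; rewrite /F; ring.
  rewrite RIB//.
  (* The primitive of [g] has weak derivative [g]: after exchanging s and y, the integral of Ph'
     over y >= s is -Ph(s). *)
  have -> : \int[mu]_z (Pg z.1 z.2 * Ik z.2 * Ph 1%N z.2 * ch z.1) =
      - \int[mu]_z (g z * Ph 0%N z.2 * ch z.1).
    have [M hM] := btest Ph 1%N tPh.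
    pose X (z : Z * measurableTypeR R * measurableTypeR R) :=
      g (z.1.1, z.2) * Ik z.1.2 * (z.2 <= z.1.2)%R%:R * Ph 1%N z.1.2 * ch z.1.1.
    have iX : intble (prodm mu L) X.
      apply: (@intble_bM _ _ _ _ _ _ 1).
      - apply: (@intble_bM _ _ _ _ _ _ M i3); last by move=> z; exact: hM.
        exact: (measurableT_comp (mtest Ph 1%N tPh)).
      - exact: (measurableT_comp mch1).
      - by move=> z; exact: bch.
    transitivity (\int[mu]_z \int[L]_s X (z, s)).
      apply: RI_ae; [exact: intble_meas iPh|exact: intble_meas (intble_pint iX)|].
      apply: filterS (intble_sec1 i3) => -[v y] iv; rewrite /X /=.
      transitivity (\int[L]_s (g (v, s) * Ik y * (s <= y)%R%:R) * (Ph 1%N y * ch v)).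
        rewrite mulrA; congr (_ * _ * _); rewrite /Pg /Ik indicE.
        case: (_ \in _); last first.
          rewrite /= mulr0 -[LHS](RI0 L); apply: eq_Rintegral => s _.
          by rewrite mulr0 mul0r.
        by rewrite /= mulr1; apply: eq_Rintegral => s _; rewrite mulr1.
      by rewrite -(RIZr _ iv); apply: eq_Rintegral => s _; rewrite /= mulrA.
    rewrite (RI_fubini1 iX) -(mpres_RI (mpres_swap23 mZ L L) iX).
    have iX' := mpres_intble (mpres_swap23 mZ L L) iX.
    rewrite -(RI_fubini1 iX') -RIN//; apply: eq_Rintegral => -[v s] _; rewrite /X /swap23/=.
    have iP1 : intble L (fun y => Ph 1%N y * (s <= y)%R%:R).
      apply: (@intble_bM _ _ _ L _ _ 1 (test1_intble 1 tPh)); first exact: meas_geR.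
      by move=> y; exact: natb_le1.
    transitivity (\int[L]_y (g (v, s) * ch v * (Ph 1%N y * (s <= y)%R%:R))).
      by apply: eq_Rintegral => y _; rewrite -[in RHS](IkE Ph 1%N y tPh); ring.
    rewrite RIZ// (bfun_tail s (ltW lohi) (test1_bfun tPh)); ring.
  rewrite opprK.
  pose hh i := if (i < k)%N then b i else Ph.
  have thh i : (i < k.+1)%N -> test1 (lo i) (hi i) (hh i).
    rewrite /hh ltnS leq_eqVlt => /orP[/eqP ->|ik]; first by rewrite ltnn.
    by rewrite ik.
  have tE n z : tensor hh n z = Ph n z.2 * ch z.1.
    rewrite /tensor /hh ltnn mulrC; congr (_ * _).
    by apply: eq_bigr => i _; rewrite ltn_ord.
  have := weak_fg thh.
  under eq_Rintegral do rewrite tE mulrA.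
  move=> ->; under eq_Rintegral do rewrite tE mulrA.
  by rewrite addNr.
apply: filterS (ae_prod1 sep) => v hv.
exists (AF v); apply: filterS hv => y + yk.
rewrite /F /= Ik_in// !mulr1 => /subr0_eq /eqP.
by rewrite subr_eq => /eqP ->.
Qed.

Variables (G phi dphi : Z * measurableTypeR R -> R) (U q : Z -> R) (M : R).
Hypothesis mG : measurable_fun setT G.
Hypothesis fG : {ae mu, forall z, DZ z.1 -> lo k <= z.2 <= hi k -> f z = G z}.
Hypothesis cG : forall v, DZ v -> {within `[lo k, hi k], continuous (fun y => G (v, y))}.
Hypotheses (mU : measurable_fun setT U) (mq : measurable_fun setT q).
Hypothesis U0 : forall v, ~ DZ v -> U v = 0.
Hypothesis qin : forall v, DZ v -> lo k <= q v <= hi k.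
Hypotheses (mphi : measurable_fun setT phi) (mdphi : measurable_fun setT dphi).
Hypothesis bphi : forall z, `|phi z| <= M.
Hypothesis bdphi : forall z, `|dphi z| <= M.
Hypothesis Bphi : forall v, DZ v ->
  bfun (lo k) (hi k) (fun y => phi (v, y)) (fun y => dphi (v, y)).
Hypothesis jUf : intble mu (fun z => U z.1 * f z).
Hypothesis jUg : intble mu (fun z => U z.1 * g z).

(** The Boolean stands for the kernel index, [true] for 1 and [false] for 2: [side b nu y] selects
    nu <= y, the range of the integral from c to y, or y <= nu, the range from y to d. *)
Definition side (b : bool) (x y : R) : R := (if b then x <= y else y <= x)%R%:R.

Lemma side_le1 b x y : `|side b x y| <= 1.
Proof. exact: natb_le1. Qed.

(** Integration by parts on almost every line, cut at [q v], followed by Fubini. [U] is constant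
    along each line and so plays no part in the differentiation. The sign is -1 when the lower end
    of the half-line is the boundary and +1 when the upper end is. *)
Lemma slices_jump b : [/\ intble mZ (fun v => U v * G (v, q v) * phi (v, q v)),
  intble mu (fun z => U z.1 * side b (q z.1) z.2 * (f z * dphi z + g z * phi z)) &
  \int[mu]_z (U z.1 * side b (q z.1) z.2 * (f z * dphi z + g z * phi z)) =
  (-1) ^+ b * \int[mZ]_v (U v * G (v, q v) * phi (v, q v))].
Proof.
have jX : intble mu (fun z => U z.1 * side b (q z.1) z.2 * (f z * dphi z + g z * phi z)).
  have ms : measurable_fun setT (fun z : Z * measurableTypeR R => side b (q z.1) z.2).
    have mq1 : measurable_fun setT (fun z : Z * measurableTypeR R => q z.1).
      exact: (measurableT_comp mq).
    by rewrite /side; case: b; apply: meas_ler => //; exact: measurable_snd.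
  have j1 : intble mu (fun z => U z.1 * f z * dphi z + U z.1 * g z * phi z).
    by apply: intbleD; [exact: (intble_bM jUf)|exact: (intble_bM jUg)].
  apply: (eq_intble _ (intble_bM j1 ms (fun z => side_le1 b _ _))) => z; ring.
have mR : measurable_fun setT (fun v => U v * G (v, q v) * phi (v, q v)).
  have mvq : measurable_fun setT (fun v : Z => (v, q v)) by apply: measurable_fun_pair.
  apply: measurable_funM; first apply: measurable_funM => //.
    exact: (measurableT_comp mG).
  exact: (measurableT_comp mphi).
have E : {ae mZ, forall v, \int[L]_y (U v * side b (q v) y *
    (f (v, y) * dphi (v, y) + g (v, y) * phi (v, y))) =
    (-1) ^+ b * (U v * G (v, q v) * phi (v, q v))}.
  have := ae_and (ae_and slices_ac (ae_prod1 fG)) (ae_and (intble_sec1 jf) (intble_sec1 jg)).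
  apply: filterS => v [[[A hA] hG] [jfv jgv]].
  have [Dv|nDv] := pselect (DZ v); last first.
    rewrite U0// !mul0r mulr0 -[RHS](RI0 L); apply: eq_Rintegral => y _.
    by rewrite !mul0r.
  (* Both sides are continuous on the closed interval and agree almost everywhere on it, so they
     also agree at the single point [q v]. *)
  have GA y : lo k <= y <= hi k -> G (v, y) = A + \int[L]_s (g (v, s) * (s <= y)%R%:R).
    move=> yk; apply/subr0_eq; move: y yk.
    apply: (ae_within_cont_eq0 lohi).
      move=> x; apply: cvgB; first exact: (cG Dv).
      apply: cvgD; first exact: cvg_cst.
      exact: (continuous_subspaceT (prim_le_cont jgv)).
    have := ae_and hA hG; apply: filterS => y [h1 h2] yk.
    by rewrite -(h2 Dv yk) h1// subrr.
  rewrite GA ?qin//.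
  have f0' y : ~~ (lo k <= y <= hi k) -> f (v, y) = 0.
    by move=> /negP yk; apply: f0 => -[].
  have g0' y : ~~ (lo k <= y <= hi k) -> g (v, y) = 0.
    by move=> /negP yk; apply: g0 => -[].
  have lck := ltW lohi.
  transitivity (U v * \int[L]_y (side b (q v) y *
    (f (v, y) * dphi (v, y) + g (v, y) * phi (v, y)))).
    rewrite -RIZ; first by apply: eq_Rintegral => y _; rewrite mulrA.
    have jY : intble L (fun y => f (v, y) * dphi (v, y) + g (v, y) * phi (v, y)).
      apply: intbleD.
        exact: (intble_bM jfv (meas_sec1 v mdphi) (fun y => bdphi (v, y))).
      exact: (intble_bM jgv (meas_sec1 v mphi) (fun y => bphi (v, y))).
    have ms : measurable_fun [set: measurableTypeR R] (side b (q v)).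
      by rewrite /side; case: b {jX}; [exact: meas_geR|exact: meas_leR].
    by apply: (eq_intble _ (intble_bM jY ms (side_le1 b (q v)))) => y; rewrite mulrC.
  rewrite /side; case: b {jX}.
    rewrite (slice_tail lck (qin Dv) (Bphi Dv) jfv jgv f0' hA); ring.
  rewrite (slice_head lck (qin Dv) (Bphi Dv) jfv jgv f0' g0' hA); ring.
have jR : intble mZ (fun v => U v * G (v, q v) * phi (v, q v)).
  apply: (intble_ae mR _ (intbleZ ((-1) ^+ b) (intble_pint jX))).
  by apply: filterS E => v /= ->; rewrite mulrA -expr2 sqrr_sign mul1r.
split=> //; rewrite -RIZ// -(RI_fubini1 jX); apply: RI_ae => //.
  exact: intble_meas (intble_pint jX).
by apply: measurable_funM.
Qed.

End Slices.

Definition rot3 (A B C : Type) (w : A * B * C) : B * C * A := (w.1.2, w.2, w.1.1).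

Lemma mpres_rot3 d1 d2 d3 (A : measurableType d1) (B : measurableType d2)
  (C : measurableType d3) (R : realType) (m1 : {sigma_finite_measure set A -> \bar R})
  (m2 : {sigma_finite_measure set B -> \bar R}) (m3 : {sigma_finite_measure set C -> \bar R}) :
  measure_preserving (prodm (prodm m1 m2) m3) (prodm (prodm m2 m3) m1) (@rot3 A B C).
Proof.
exact: (mpres_comp (mpres_prod m3 (mpres_swap12 m1 m2)) (mpres_swap23 m2 m1 m3)).
Qed.

Lemma weak_derivative_pd (R : realType) (d : measure_display) (V : measurableNormedModType R d)
  (mu : {sigma_finite_measure set V -> \bar R}) (k : nat) (p : nat -> V -> R) (e : nat -> V)
  (lo hi : nat -> R) (D : set V) (j : nat) (F F' : V -> R) (h : nat -> nat -> R -> R) :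
  box_space mu k p e lo hi D -> (j < k)%N -> weak_derivative mu D [:: e j] F F' ->
  (forall i, (i < k)%N -> test1 (lo i) (hi i) (h i)) ->
  \int[mu]_z ((F \_ D) z * pd k p h (bump_at j (fun=> 0%N)) z) =
  - \int[mu]_z ((F' \_ D) z * pd k p h (fun=> 0%N) z).
Proof.
move=> H jk [_ _ wd] th; have := wd _ (pd_test H th).
rewrite -[iter_derive _ _]/('D_(e j) (pd k p h (fun=> 0%N))) (pd_D H)//; last by move=> i /th[].
by rewrite (RI_restrict mu D F) (RI_restrict mu D F') expr1 mulN1r.
Qed.

Lemma pd_bounded (R : realType) (d : measure_display) (V : measurableNormedModType R d)
  (k : nat) (p : nat -> V -> R) (lo hi : nat -> R)
  (h : nat -> nat -> R -> R) al : (forall i, (i < k)%N -> test1 (lo i) (hi i) (h i)) ->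
  exists M : R, forall v, `|pd k p h al v| <= M.
Proof.
move=> th; have /choice[M hM] : forall i, exists B : R, (i < k)%N ->
    forall x, `|h i (al i) x| <= B.
  move=> i; have [ik|_] := boolP (i < k)%N; last by exists 0.
  by have [B _ hB] := test1_bounded (al i) (th i ik); exists B.
exists (\prod_(i < k) M i) => v; rewrite normr_prod; apply: ler_prod => i _.
by rewrite normr_ge0 hM.
Qed.

(** * Boundary terms after moving y to the last place *)

Section Jump.
Context (R : realType) (dZ dV : measure_display).
Context (Z : measurableNormedModType R dZ) (V : measurableNormedModType R dV).
Variables (mZ : {sigma_finite_measure set Z -> \bar R}) (k : nat).
Variables (p : nat -> Z -> R) (e : nat -> Z) (lo hi : nat -> R) (DZ : set Z).
Hypothesis HZ : box_space mZ k p e lo hi DZ.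
Hypothesis lohi : lo k < hi k.
Variables (mV : {sigma_finite_measure set V -> \bar R}) (l : nat).
Variables (pV : nat -> V -> R) (eV : nat -> V) (loV hiV : nat -> R) (D : set V).
Hypothesis HV : box_space mV l pV eV loV hiV D.
Local Notation L := (leb R).
Local Notation mu := (prodm mZ L).

Variables (T : Z * measurableTypeR R -> V) (j : nat).
Hypothesis mT : measure_preserving mu mV T.
Hypothesis jl : (j < l)%N.
Hypothesis DT : forall v y, D (T (v, y)) <-> DZ v /\ lo k <= y <= hi k.
Hypothesis cT : forall v, continuous (fun y => T (v, y)).
Hypothesis testT : forall h, (forall i, (i < k.+1)%N -> test1 (lo i) (hi i) (h i)) ->
  exists h', [/\ forall i, (i < l)%N -> test1 (loV i) (hiV i) (h' i),
    forall z, pd l pV h' (bump_at j (fun=> 0%N)) (T z) = tensor k p h 1 z &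
    forall z, pd l pV h' (fun=> 0%N) (T z) = tensor k p h 0 z].

Variables (F F' G : V -> R).
Hypotheses (F2 : L2 mV D F) (F2' : L2 mV D F').
Hypothesis wF : weak_derivative mV D [:: eV j] F F'.
Hypothesis GF : continuous_representative mV D F G.

Variables (phi dphi : Z * measurableTypeR R -> R) (U q : Z -> R) (M : R).
Hypotheses (mU : measurable_fun setT U) (mq : measurable_fun setT q).
Hypothesis jU : intble mZ (fun v => U v ^+ 2).
Hypothesis U0 : forall v, ~ DZ v -> U v = 0.
Hypothesis qin : forall v, DZ v -> lo k <= q v <= hi k.
Hypotheses (mphi : measurable_fun setT phi) (mdphi : measurable_fun setT dphi).
Hypothesis bphi : forall z, `|phi z| <= M.
Hypothesis bdphi : forall z, `|dphi z| <= M.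
Hypothesis Bphi : forall v, DZ v ->
  bfun (lo k) (hi k) (fun y => phi (v, y)) (fun y => dphi (v, y)).

(** Pointwise |U E| <= U^2 + E^2; as [U] does not depend on [y], its square is first cut off by the
    indicator of the interval. *)
Let prod_intble E : L2 mV D E -> intble mu (fun z => U z.1 * (E \_ D) (T z)).
Proof.
move=> E2; pose Ik : R -> R := \1_(`[lo k, hi k]%classic).
have jX : intble mu (fun z => U z.1 ^+ 2 * Ik z.2 + (E \_ D) (T z) ^+ 2).
  apply: intbleD; first exact: (intble_prod jU (itv_intble _ _)).
  exact: (mpres_intble mT (L2_sqr E2)).
have mX : measurable_fun setT (fun z => U z.1 * (E \_ D) (T z)).
  apply: measurable_funM; first exact: (measurableT_comp mU).
  exact: (measurableT_comp (L2_meas E2) mT.1).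
apply: (intble_le mX _ jX) => -[v y] /=; rewrite /Ik indicE.
have [yk|yk] := boolP (lo k <= y <= hi k); last first.
  rewrite memNset ?mulr0/=; last by rewrite in_itv/=; exact/negP.
  rewrite patchN ?mulr0 ?normr0 ?add0r ?sqr_ge0//.
  by apply/negP => /set_mem/DT[_]; exact/negP.
rewrite mem_set/= ?in_itv//= mulr1 normrM.
rewrite -(real_normK (num_real (U v))) -(real_normK (num_real ((E \_ D) _))).
by have := sqr_ge0 (`|U v| - `|(E \_ D) (T (v, y))|); have := normr_ge0 (U v);
  have := normr_ge0 ((E \_ D) (T (v, y))); nra.
Qed.

(** [T] is a permutation of coordinates that takes the variable of differentiation from the last
    place to its place in [V]. By [testT] it matches product test functions on both sides, so the
    weak derivative on [V] becomes the hypothesis of [slices_jump]. *)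
Lemma jump b : [/\ intble mZ (fun v => U v * (G \_ D) (T (v, q v)) * phi (v, q v)),
  intble mu (fun z => U z.1 * side b (q z.1) z.2 *
     ((F \_ D) (T z) * dphi z + (F' \_ D) (T z) * phi z)) &
  \int[mu]_z (U z.1 * side b (q z.1) z.2 *
     ((F \_ D) (T z) * dphi z + (F' \_ D) (T z) * phi z)) =
  (-1) ^+ b * \int[mZ]_v (U v * (G \_ D) (T (v, q v)) * phi (v, q v))].
Proof.
have iD := box_indic_intble HV.
have jF := mpres_intble mT (L2_intble iD F2).
have jF' := mpres_intble mT (L2_intble iD F2').
have out (E : V -> R) v (y : measurableTypeR R) : ~ (DZ v /\ lo k <= y <= hi k) -> (E \_ D) (T (v, y)) = 0.
  by move=> h; rewrite patchN//; apply/negP => /set_mem/DT.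
have [cG FG] := GF.
apply: (@slices_jump _ _ _ mZ k p e lo hi DZ HZ lohi (fun z => (F \_ D) (T z))
  (fun z => (F' \_ D) (T z)) jF jF' (out F) (out F') _ (fun z => (G \_ D) (T z)) phi dphi
  U q M) => //.
- move=> h th; have [h' [th' E1 E0]] := testT th.
  under eq_Rintegral do rewrite -E1.
  under [in RHS]eq_Rintegral do rewrite -E0.
  have jpd (E : V -> R) al : L2 mV D E -> intble mV (fun v => (E \_ D) v * pd l pV h' al v).
    move=> E2; have [B hB] := pd_bounded pV al th'.
    apply: (intble_bM (L2_intble iD E2) _ hB).
    by apply: (box_cont_measurable HV); apply: (pd_cont HV) => i /th'[].
  rewrite (mpres_RI mT (jpd F _ F2)) (mpres_RI mT (jpd F' _ F2')).
  exact: weak_derivative_pd HV jl wF th'.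
- apply: (measurableT_comp _ mT.1); apply/(measurable_restrictT _ (box_measurable HV)).
  exact: (box_within_measurable HV (box_measurable HV) cG).
- have := mpres_ae mT FG; apply: filterS => -[v y] /= h Dv yk.
  by rewrite !patchE; case: ifPn => // /set_mem /h.
- move=> v Dv; apply/subspace_continuousP => y yk.
  have Dy t : `[lo k, hi k]%classic t -> D (T (v, t)).
    by rewrite /= in_itv/= => tk; apply/DT.
  have GD t : `[lo k, hi k]%classic t -> (G \_ D) (T (v, t)) = G (T (v, t)).
    by move=> /Dy Dt; rewrite patchE mem_set.
  rewrite -[X in _ --> X]/((G \_ D) (T (v, y))) GD//.
  have cGy := (subspace_continuousP _ _).1 cG _ (Dy y yk).
  have cTw : T (v, t) @[t --> within `[lo k, hi k] (nbhs y)] --> within D (nbhs (T (v, y))).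
    move=> P hP; have h2 : nbhs (y : R) (fun t => D (T (v, t)) -> P (T (v, t))) := cT hP.
    by apply: (@filterS R (nbhs y) _ _ _ _ h2) => t ht tk; apply: ht; exact: Dy.
  apply: cvg_trans (cvg_comp _ _ cTw cGy).
  apply: near_eq_cvg; near=> t; rewrite /= -[RHS]/((G \_ D) (T (v, t))) GD//; near: t.
  exact: withinT.
- exact: prod_intble.
- exact: prod_intble.
Unshelve. all: by end_near. Qed.

End Jump.

(** * Traces of the kernels on the diagonal *)

Section Concrete.
Variables (R : realType) (a b c d : R).
Hypotheses (hab : a < b) (hcd : c < d).
Local Notation mR := (measurableTypeR R).
Local Notation L := (leb R).
Local Notation M2 := (prodm L L).
Local Notation M3 := (prodm M2 L).
Local Notation M4 := (prodm M3 L).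

Definition crd1 (i : nat) (v : mR) : R := v.
Definition crd2 (i : nat) (v : mR * mR) : R := if (i < 1)%N then crd1 i v.1 else v.2.
Definition crd3 (i : nat) (v : mR * mR * mR) : R := if (i < 2)%N then crd2 i v.1 else v.2.
Definition crd4 (i : nat) (v : mR * mR * mR * mR) : R := if (i < 3)%N then crd3 i v.1 else v.2.
Definition bas1 (i : nat) : mR := 1.
Definition bas2 (i : nat) : mR * mR := if (i < 1)%N then (bas1 i, 0) else (0, 1).
Definition bas3 (i : nat) : mR * mR * mR := if (i < 2)%N then (bas2 i, 0) else (0, 1).
Definition bas4 (i : nat) : mR * mR * mR * mR := if (i < 3)%N then (bas3 i, 0) else (0, 1).

Section Boxes.
Variables lo hi : nat -> R.
Hypothesis lohi : forall i, lo i < hi i.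

Definition ibox2 := `[lo 0%N, hi 0%N] `*` `[lo 1%N, hi 1%N].
Definition ibox3 := ibox2 `*` `[lo 2%N, hi 2%N].
Definition ibox4 := ibox3 `*` `[lo 3%N, hi 3%N].

Lemma box_space2 : box_space M2 2 crd2 bas2 lo hi ibox2.
Proof. exact: (box_spaceS (box_space1 (lohi 0%N)) (lohi 1%N)). Qed.

Lemma box_space3 : box_space M3 3 crd3 bas3 lo hi ibox3.
Proof. exact: (box_spaceS box_space2 (lohi 2%N)). Qed.

Lemma box_space4 : box_space M4 4 crd4 bas4 lo hi ibox4.
Proof. exact: (box_spaceS box_space3 (lohi 3%N)). Qed.

End Boxes.

(* [s] tells which coordinates range over [c, d] rather than [a, b]. *)
Definition lows (s : seq bool) (i : nat) := if nth false s i then c else a.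
Definition highs (s : seq bool) (i : nat) := if nth false s i then d else b.

Lemma lows_highs s i : lows s i < highs s i.
Proof. by rewrite /lows /highs; case: nth. Qed.

Lemma sp_xy s : box_space M2 2 crd2 bas2 (lows [:: false, true & s])
  (highs [:: false, true & s]) (box_xy a b c d).
Proof. exact: (box_space2 (lows_highs _)). Qed.

Lemma sp_xynu : box_space M3 3 crd3 bas3 (lows [:: false; true; true])
  (highs [:: false; true; true]) (box_xynu a b c d).
Proof. exact: (box_space3 (lows_highs _)). Qed.

Lemma sp_xytheta : box_space M3 3 crd3 bas3 (lows [:: false; true; false])
  (highs [:: false; true; false]) (box_xytheta a b c d).
Proof. exact: (box_space3 (lows_highs _)). Qed.

Lemma sp_xthetanu : box_space M3 3 crd3 bas3 (lows [:: false; false; true; true])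
  (highs [:: false; false; true; true]) (`[a, b] `*` `[a, b] `*` `[c, d]).
Proof. exact: (box_space3 (lows_highs _)). Qed.

Lemma sp_xythetanu : box_space M4 4 crd4 bas4 (lows [:: false; true; false; true])
  (highs [:: false; true; false; true]) (box_xythetanu a b c d).
Proof. exact: (box_space4 (lows_highs _)). Qed.

Lemma test2_interior (z : mR * mR) : (box_xy a b c d)° z -> c < z.2 < d.
Proof.
case: z => x y; move=> [[/= P Q] [Px Qy] PQ].
have {}Qy : nbhs y `[c, d]%classic.
  apply: filterS Qy => t Qt.
  by have [] := PQ (x, t) (conj (nbhs_singleton Px) Qt).
move: Qy => /nbhs_ballP[r /= r0 hr].
have r2 : 0 < r / 2 by rewrite divr_gt0.
have : `[c, d]%classic (y - r / 2).
  by apply: hr; rewrite -ball_normE/= ltr_norml; lra.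
have : `[c, d]%classic (y + r / 2).
  by apply: hr; rewrite -ball_normE/= ltr_norml; lra.
by rewrite /= !in_itv/=; lra.
Qed.

Variable phi : mR * mR -> R.
Hypothesis tphi : @test_function R _ (mR * mR)%type (box_xy a b c d) phi.
Local Notation dphi := ('D_((0, 1) : mR * mR) phi).

Lemma test2_cont : continuous phi /\ continuous dphi.
Proof.
have [sphi _] := tphi; split; first exact: (sphi [::]).1.
exact: (sphi [:: (0, 1)]).1.
Qed.

Lemma phi_out z : ~ box_xy a b c d z -> phi z = 0 /\ dphi z = 0.
Proof.
have [_ [K [cK KD K0]]] := tphi => nz.
have nK : ~ K z by move=> /KD /interior_subset.
split; first exact: K0.
have clK : closed K by apply: compact_closed cK; exact: norm_hausdorff.
have nb : {near nbhs (z : mR * mR), phi =1 cst 0}.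
  have : nbhs (z : mR * mR) (~` K) by apply: open_nbhs_nbhs; split => //; exact: closed_openC.
  by apply: filterS => t /= /K0.
by rewrite (near_eq_derive _ nb) derive_cst.
Qed.

Lemma test2_bfun x : bfun c d (fun y => phi (x, y)) (fun y => dphi (x, y)).
Proof.
have [sphi [K [cK KD K0]]] := tphi; have [cp cd] := test2_cont.
have pair_cont (y : mR) : (fun y : mR => (x, y)) @ y --> (x, y).
  by apply: (@cvg_pair _ _ _ (nbhs y) (nbhs x) (nbhs y)); [exact: cvg_cst|exact: cvg_id].
split.
- move=> y; have dp := (sphi [::]).2 (x, y) (0, 1).
  have E : (fun h : R => h^-1 *: (((fun y => phi (x, y)) \o shift y) (h *: 1) - phi (x, y))) =
     (fun h => h^-1 *: ((phi \o shift (x, y)) (h *: (0, 1)) - phi (x, y))).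
    apply/funext => h /=; congr (_ *: (phi _ - _)).
    rewrite -[RHS]/(h *: (0 : R) + x, h *: (1 : R) + y).
    by rewrite scaler0 add0r.
  by constructor; [rewrite /derivable E|rewrite /derive E].
- by move=> y; apply: (@continuous_comp _ _ _ (fun y => (x, y)) dphi); [exact: pair_cont|exact: cd].
- move=> y yn; apply: K0 => Kxy; have := test2_interior (KD _ Kxy).
  exact/negP.
- move=> y yn; have nD : ~ box_xy a b c d (x, y).
    by move=> [_ /=]; rewrite in_itv/=; exact/negP.
  by case: (phi_out nD).
Qed.

Lemma phi_bounded : exists M, forall z, `|phi z| <= M /\ `|dphi z| <= M.
Proof.
have [cp cd] := test2_cont.
have [M1 M10 h1] := compact_cont_bounded (box_compactD (sp_xy [::])) (continuous_subspaceT cp).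
have [M2' M20 h2] := compact_cont_bounded (box_compactD (sp_xy [::])) (continuous_subspaceT cd).
exists (M1 + M2') => z; have [zD|/phi_out[-> ->]] := pselect (box_xy a b c d z); last first.
  by rewrite normr0; split; rewrite addr_ge0// ltW.
by split; [rewrite (le_trans (h1 _ zD))// lerDl ltW|rewrite (le_trans (h2 _ zD))// lerDr ltW].
Qed.

Lemma phi_meas : measurable_fun setT phi /\ measurable_fun setT dphi.
Proof.
by have [cp cd] := test2_cont; split; exact: (box_cont_measurable (sp_xy [::])).
Qed.

Variable U : mR * mR -> R.
Hypotheses (mU : measurable_fun setT U) (jU : intble M2 (fun v => U v ^+ 2)).
Hypothesis U0 : forall v, ~ box_xy a b c d v -> U v = 0.

(** The lines have parameters (x, nu), the weight is U(x, nu), and the cut is at y = nu, that is [q]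
    is [snd]. *)
Lemma jump3 (F F' G : mR * mR * mR -> R) s :
  L2 M3 (box_xynu a b c d) F -> L2 M3 (box_xynu a b c d) F' ->
  weak_derivative M3 (box_xynu a b c d) (dy3 R) F F' ->
  continuous_representative M3 (box_xynu a b c d) F G ->
  intble M2 (fun v => U v * (G \_ (box_xynu a b c d)) (v.1, v.2, v.2) * phi v) /\
  \int[M3]_w (U (w.1.1, w.2) * side s w.2 w.1.2 *
     ((F \_ (box_xynu a b c d)) w * dphi w.1 + (F' \_ (box_xynu a b c d)) w * phi w.1)) =
  (-1) ^+ s * \int[M2]_v (U v * (G \_ (box_xynu a b c d)) (v.1, v.2, v.2) * phi v).
Proof.
move=> F2 F2' wF GF.
have [M hM] := phi_bounded; have [mphi mdphi] := phi_meas.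
have mT := mpres_swap23 L L L.
(* [h] is indexed by (x, nu, y) and [h'] by (x, y, nu). *)
pose h' (h : nat -> nat -> R -> R) i := h (nth 0%N [:: 0; 2; 1]%N i).
have [||||||||||jG jX jE] := @jump _ _ _ _ _ M2 2 crd2 bas2 _ _ _ (sp_xy [:: true]) (lows_highs _ _)
  M3 3 crd3 bas3 _ _ _ sp_xynu (@swap23 mR mR mR) 1 mT isT _ _ _ F F' G F2 F2' wF GF
  (fun z => phi (z.1.1, z.2)) (fun z => dphi (z.1.1, z.2)) U snd M mU _ jU U0 _ _ _ _ _ _ s.
- move=> [x nu] y; rewrite /box_xynu /box_xy /swap23/= !in_itv/=; split.
    by case=> -[/= -> -> ->].
  by case=> -[/= -> ->] ->.
- move=> [x nu] y; apply: (@cvg_pair _ _ _ (nbhs (y : mR)) (nbhs ((x, y : mR) : mR * mR)) (nbhs nu)).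
    by apply: (@cvg_pair _ _ _ (nbhs (y : mR)) (nbhs x) (nbhs (y : mR))); [exact: cvg_cst|exact: cvg_id].
  exact: cvg_cst.
- move=> h th; exists (h' h); split.
  + by move=> [|[|[|//]]] _; [exact: (th 0%N)|exact: (th 2%N)|exact: (th 1%N)].
  + by move=> -[[x nu] y]; rewrite /pd /tensor !big_ord_recr !big_ord0/= /h' /crd3 /crd2 /bump_at/=; ring.
  + by move=> -[[x nu] y]; rewrite /pd /tensor !big_ord_recr !big_ord0/= /h' /crd3 /crd2 /bump_at/=; ring.
- exact: measurable_snd.
- by move=> v [_ /=]; rewrite in_itv.
- apply: (measurableT_comp mphi); apply: measurable_fun_pair; last exact: measurable_snd.
  exact: (measurableT_comp measurable_fst measurable_fst).
- apply: (measurableT_comp mdphi); apply: measurable_fun_pair; last exact: measurable_snd.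
  exact: (measurableT_comp measurable_fst measurable_fst).
- by move=> z; exact: (hM _).1.
- by move=> z; exact: (hM _).2.
- move=> v _; exact: test2_bfun.
split.
  by apply: eq_intble jG => -[x nu].
transitivity (\int[M3]_w (U w.1 * side s w.1.2 w.2 *
  ((F \_ (box_xynu a b c d)) (swap23 w) * dphi (w.1.1, w.2) +
   (F' \_ (box_xynu a b c d)) (swap23 w) * phi (w.1.1, w.2)))).
  rewrite -(mpres_RI mT jX); apply: eq_Rintegral => -[[x y] nu] _ //.
rewrite jE; congr (_ * _); apply: eq_Rintegral => -[x nu] _ //.
Qed.

Lemma side_meas d1 (X : measurableType d1) (f g : X -> R) s :
  measurable_fun setT f -> measurable_fun setT g -> measurable_fun setT (fun z => side s (f z) (g z)).
Proof. by move=> mf mg; rewrite /side; case: s; exact: meas_ler. Qed.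

Lemma jump4 (F F' G : mR * mR * mR * mR -> R) s s' :
  L2 M4 (box_xythetanu a b c d) F -> L2 M4 (box_xythetanu a b c d) F' ->
  weak_derivative M4 (box_xythetanu a b c d) (dy4 R) F F' ->
  continuous_representative M4 (box_xythetanu a b c d) F G ->
  intble M3 (fun w => U (w.2, w.1.2) * side s w.2 w.1.1 *
    (G \_ (box_xythetanu a b c d)) (w, w.1.2) * phi w.1) /\
  \int[M4]_w (U (w.1.2, w.2) * side s w.1.2 w.1.1.1 * side s' w.2 w.1.1.2 *
     ((F \_ (box_xythetanu a b c d)) w * dphi w.1.1 +
      (F' \_ (box_xythetanu a b c d)) w * phi w.1.1)) =
  (-1) ^+ s' * \int[M3]_w (U (w.2, w.1.2) * side s w.2 w.1.1 *
    (G \_ (box_xythetanu a b c d)) (w, w.1.2) * phi w.1).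
Proof.
move=> F2 F2' wF GF.
have [M hM] := phi_bounded; have [mphi mdphi] := phi_meas.
(* [mT] sends (x, theta, nu, y) to (x, y, theta, nu), and [mS] is for its inverse. *)
have mT : measure_preserving M4 M4 (fun z => (swap23 (swap23 z).1, (swap23 z).2)).
  exact: (mpres_comp (mpres_swap23 M2 L L) (mpres_prod L (mpres_swap23 L L L))).
have mS : measure_preserving M4 M4 (fun w => swap23 (swap23 w.1, w.2)).
  exact: (mpres_comp (mpres_prod L (mpres_swap23 L L L)) (mpres_swap23 M2 L L)).
pose h' (h : nat -> nat -> R -> R) i := h (nth 0%N [:: 0; 3; 1; 2]%N i).
(* U(theta, nu) does not depend on x, so its square is integrable over (x, theta, nu) only after a
   cut-off in x. The cut-off is absorbed afterwards by kernels that vanish outside the box, see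
   [IaE]. *)
pose Ia : mR -> R := \1_(`[a, b]%classic).
have mx : measurable_fun setT (fun v : mR * mR * mR => v.1.1).
  exact: (measurableT_comp measurable_fst measurable_fst).
have mth : measurable_fun setT (fun v : mR * mR * mR => v.1.2).
  exact: (measurableT_comp measurable_snd measurable_fst).
have mU1 : measurable_fun setT (fun v : mR * mR * mR => U (v.1.2, v.2)).
  apply: (measurableT_comp mU); apply: measurable_fun_pair mth _.
  exact: measurable_snd.
have ms : measurable_fun setT (fun v : mR * mR * mR => side s v.1.2 v.1.1).
  exact: side_meas.
have mIa : measurable_fun setT Ia by exact: intble_meas (itv_intble a b).
pose U4 (v : mR * mR * mR) := U (v.1.2, v.2) * Ia v.1.1 * side s v.1.2 v.1.1.
have mU4 : measurable_fun setT U4.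
  apply: measurable_funM ms; apply: measurable_funM mU1 _.
  exact: (measurableT_comp mIa mx).
have jU4 : intble M3 (fun v => U4 v ^+ 2).
  have jX := mpres_intble (mpres_rot3 L L L) (intble_prod jU (itv_intble a b)).
  have mU42 : measurable_fun setT (fun v => U4 v ^+ 2) by exact: measurable_funX.
  apply: (intble_le mU42 _ jX) => -[[x th] nu]; rewrite /U4 /rot3 /Ia /= indicE.
  rewrite ger0_norm ?sqr_ge0// !exprMn.
  have [_|_] := boolP (x \in _); last by rewrite /= expr0n/= mulr0 mul0r.
  by rewrite /= expr1n !mulr1 ler_piMr ?sqr_ge0// /side; case: (if s then _ else _); rewrite ?expr1n ?expr0n.
have U40 v : ~ (`[a, b] `*` `[a, b] `*` `[c, d]) v -> U4 v = 0.
  case: v => [[x th] nu] nv; rewrite /U4 /Ia /= indicE.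
  have [/set_mem xab|_] := boolP (x \in _); last by rewrite /= mulr0 mul0r.
  by rewrite U0 ?mul0r// => -[h1 h2]; apply: nv.
have [||||||||||jG jX jE] := @jump _ _ _ _ _ M3 3 crd3 bas3 _ _ _ sp_xthetanu (lows_highs _ _)
  M4 4 crd4 bas4 _ _ _ sp_xythetanu _ 1 mT isT _ _ _ F F' G F2 F2' wF GF
  (fun z => phi (z.1.1.1, z.2)) (fun z => dphi (z.1.1.1, z.2)) U4 snd M mU4 _ jU4 U40 _ _ _ _ _ _ s'.
- move=> [[x th] nu] y; rewrite /box_xythetanu /box_xytheta /box_xy /swap23/= !in_itv/=; split.
    by case=> -[[/= -> -> -> ->]].
  by case=> -[[/= -> -> ->] ->].
- move=> [[x th] nu] y.
  apply: (@cvg_pair _ _ _ (nbhs (y : mR)) (nbhs ((x, (y : mR), th) : mR * mR * mR)) (nbhs nu)); last exact: cvg_cst.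
  apply: (@cvg_pair _ _ _ (nbhs (y : mR)) (nbhs ((x, y : mR) : mR * mR)) (nbhs th)); last exact: cvg_cst.
  by apply: (@cvg_pair _ _ _ (nbhs (y : mR)) (nbhs x) (nbhs (y : mR))); [exact: cvg_cst|exact: cvg_id].
- move=> h th; exists (h' h); split.
  + by move=> [|[|[|[|//]]]] _; [exact: (th 0%N)|exact: (th 3%N)|exact: (th 1%N)|exact: (th 2%N)].
  + by move=> -[[[x t] nu] y]; rewrite /pd /tensor !big_ord_recr !big_ord0/= /h' /crd4 /crd3 /crd2 /bump_at/=; ring.
  + by move=> -[[[x t] nu] y]; rewrite /pd /tensor !big_ord_recr !big_ord0/= /h' /crd4 /crd3 /crd2 /bump_at/=; ring.
- exact: measurable_snd.
- by move=> v [_ /=]; rewrite in_itv.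
- apply: (measurableT_comp mphi); apply: measurable_fun_pair; last exact: measurable_snd.
  exact: (measurableT_comp mx measurable_fst).
- apply: (measurableT_comp mdphi); apply: measurable_fun_pair; last exact: measurable_snd.
  exact: (measurableT_comp mx measurable_fst).
- by move=> z; exact: (hM _).1.
- by move=> z; exact: (hM _).2.
- move=> v _; exact: test2_bfun.
have IaE (E : mR * mR * mR * mR -> R) w : Ia w.1.1.1 * (E \_ (box_xythetanu a b c d)) w =
    (E \_ (box_xythetanu a b c d)) w.
  rewrite patchE; case: ifPn => [/set_mem[[[xab _] _] _]|_]; last by rewrite mulr0.
  by rewrite /Ia indicE mem_set ?mul1r.
have mW := mpres_swap23 L L L.
have GE w : U4 (swap23 w) * (G \_ (box_xythetanu a b c d)) (w, w.1.2) * phi w.1 =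
    U (w.2, w.1.2) * side s w.2 w.1.1 * (G \_ (box_xythetanu a b c d)) (w, w.1.2) * phi w.1.
  by rewrite -[in RHS]IaE /U4 /=; ring.
have jG' := mpres_intble mW jG.
split.
  by apply: (eq_intble _ jG') => -[[x y] th]; rewrite -GE.
transitivity (\int[M4]_z (U4 z.1 * side s' z.1.2 z.2 *
  ((F \_ (box_xythetanu a b c d)) (swap23 (swap23 z).1, (swap23 z).2) * dphi (z.1.1.1, z.2) +
   (F' \_ (box_xythetanu a b c d)) (swap23 (swap23 z).1, (swap23 z).2) * phi (z.1.1.1, z.2)))).
  rewrite -(mpres_RI mS jX); apply: eq_Rintegral => -[[[x y] th] nu] _.
  rewrite /swap23 /U4 /=; set F1 := (F \_ _) _; set F1' := (F' \_ _) _.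
  have E1 := IaE F (x, y, th, nu); have E2 := IaE F' (x, y, th, nu).
  rewrite /= -/F1 in E1; rewrite /= -/F1' in E2.
  by rewrite -{1}E1 -{1}E2; ring.
rewrite jE; congr (_ * _); rewrite -(mpres_RI mW jG); apply: eq_Rintegral => -[[x y] th] _.
exact: GE.
Qed.

End Concrete.

(** * Partial integral operators *)

Section PartialIntegrals.
Variables (R : realType) (a b c d : R).
Local Notation mR := (measurableTypeR R).
Local Notation L := (leb R).
Local Notation M2 := (prodm L L).
Local Notation M3 := (prodm M2 L).
Local Notation M4 := (prodm M3 L).

Lemma leb2E : leb2 = M2 :> {measure set (mR * mR)%type -> \bar R}.
Proof. reflexivity. Qed.

Lemma leb3E : leb3 = M3 :> {measure set (mR * mR * mR)%type -> \bar R}.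
Proof. reflexivity. Qed.

Lemma leb4E : leb4 = M4 :> {measure set (mR * mR * mR * mR)%type -> \bar R}.
Proof.
exact: (congr1 (fun mu : {measure set (mR * mR * mR)%type -> \bar R} =>
  product_measure1 mu L : {measure set (mR * mR * mR * mR)%type -> \bar R}) leb3E).
Qed.

Section Total.
Variables (A0 : mR * mR -> R) (A1 A2 : bool -> mR * mR * mR -> R).
Variable A3 : bool -> bool -> mR * mR * mR * mR -> R.

(** The shape of an entry of the 2D-PI operator once the ranges of integration are moved into the
    integrands: a multiplier, four single and four double partial integrals over the whole line,
    indexed by Booleans as in [side]. *)
Definition total z := A0 z +
  \sum_(s : bool) (\int[L]_t A1 s (z, t) + \int[L]_t A2 s (z, t)) +
  \sum_(s : bool) \sum_(s' : bool) \int[L]_t \int[L]_t' A3 s s' (z, t, t').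

Lemma totalE z : total z = A0 z + \int[L]_t A1 true (z, t) + \int[L]_t A1 false (z, t) +
  \int[L]_t A2 true (z, t) + \int[L]_t A2 false (z, t) +
  \int[L]_t \int[L]_t' A3 true true (z, t, t') + \int[L]_t \int[L]_t' A3 false true (z, t, t') +
  \int[L]_t \int[L]_t' A3 true false (z, t, t') + \int[L]_t \int[L]_t' A3 false false (z, t, t').
Proof.
have shape (t0 t1 t1' t2 t2' t3 t4 t5 t6 : R) : t0 + t1 + t1' + t2 + t2' + t3 + t4 + t5 + t6 =
    t0 + (t1 + t2 + (t1' + t2')) + (t3 + t5 + (t4 + t6)) by ring.
by rewrite shape /total !big_bool.
Qed.

Hypotheses (j0 : intble M2 A0) (j1 : forall s, intble M3 (A1 s)).
Hypotheses (j2 : forall s, intble M3 (A2 s)) (j3 : forall s s', intble M4 (A3 s s')).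

Lemma total_intble : intble M2 total.
Proof.
apply: intbleD; first apply: intbleD j0 _; apply: intble_sum => s _.
  by apply: intbleD; exact: intble_pint.
by apply: intble_sum => s' _; exact: (intble_pint (intble_pint (j3 s s'))).
Qed.

Lemma total_RI (psi : mR * mR -> R) (M : R) :
  measurable_fun setT psi -> (forall z, `|psi z| <= M) ->
  \int[M2]_z (total z * psi z) = \int[M2]_z (A0 z * psi z) +
  \sum_(s : bool) (\int[M3]_w (A1 s w * psi w.1) + \int[M3]_w (A2 s w * psi w.1)) +
  \sum_(s : bool) \sum_(s' : bool) \int[M4]_w (A3 s s' w * psi w.1.1).
Proof.
move=> mpsi bpsi.
have mul (g : mR * mR -> R) : intble M2 g -> intble M2 (fun z => g z * psi z).
  by move=> jg; exact: (intble_bM jg mpsi bpsi).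
have mpsi1 : measurable_fun setT (fun w : mR * mR * mR => psi w.1).
  exact: (measurableT_comp mpsi measurable_fst).
have mul1 (g : mR * mR * mR -> R) : intble M3 g -> intble M3 (fun w => g w * psi w.1).
  by move=> jg; exact: (intble_bM jg mpsi1 (fun w => bpsi w.1)).
have mul2 (g : mR * mR * mR * mR -> R) : intble M4 g -> intble M4 (fun w => g w * psi w.1.1).
  move=> jg; apply: (intble_bM jg _ (fun w => bpsi w.1.1)).
  exact: (measurableT_comp mpsi1 measurable_fst).
have pint (g : mR * mR * mR -> R) : intble M3 g ->
    \int[M2]_z ((\int[L]_t g (z, t)) * psi z) = \int[M3]_w (g w * psi w.1).
  move=> jg; rewrite -(RI_fubini1 (mul1 _ jg)); apply: RI_ae.
  - exact: intble_meas (mul _ (intble_pint jg)).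
  - exact: intble_meas (intble_pint (mul1 _ jg)).
  - by apply: filterS (intble_sec1 jg) => z jz; rewrite -RIZr.
have pint2 (g : mR * mR * mR * mR -> R) : intble M4 g ->
    \int[M2]_z ((\int[L]_t \int[L]_t' g (z, t, t')) * psi z) = \int[M4]_w (g w * psi w.1.1).
  move=> jg; rewrite (pint _ (intble_pint jg)) -(RI_fubini1 (mul2 _ jg)); apply: RI_ae.
  - exact: intble_meas (mul1 _ (intble_pint jg)).
  - exact: intble_meas (intble_pint (mul2 _ jg)).
  - by apply: filterS (intble_sec1 jg) => z jz; rewrite -RIZr.
pose Q0 z := A0 z * psi z.
pose Q1 s z := (\int[L]_t A1 s (z, t)) * psi z.
pose Q2 s z := (\int[L]_t A2 s (z, t)) * psi z.
pose Q3 s s' z := (\int[L]_t \int[L]_t' A3 s s' (z, t, t')) * psi z.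
have k1 s : intble M2 (Q1 s) by exact: (mul _ (intble_pint (j1 s))).
have k2 s : intble M2 (Q2 s) by exact: (mul _ (intble_pint (j2 s))).
have k3 s s' : intble M2 (Q3 s s') by exact: (mul _ (intble_pint (intble_pint (j3 s s')))).
have k12 (s : bool) : true -> intble M2 (fun z => Q1 s z + Q2 s z) by move=> _; exact: intbleD.
have k33 (s : bool) : true -> intble M2 (fun z => \sum_(s' : bool) Q3 s s' z).
  by move=> _; apply: intble_sum.
transitivity (\int[M2]_z (Q0 z + \sum_(s : bool) (Q1 s z + Q2 s z) +
    \sum_(s : bool) \sum_(s' : bool) Q3 s s' z)).
  apply: eq_Rintegral => z _; rewrite /total 2!mulrDl; congr (_ + _ + _).
    by rewrite mulr_suml; apply: eq_bigr => s _; rewrite mulrDl.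
  by rewrite mulr_suml; apply: eq_bigr => s _; rewrite mulr_suml.
have kS : intble M2 (fun z => \sum_(s : bool) (Q1 s z + Q2 s z)) by apply: intble_sum.
have kSS : intble M2 (fun z => \sum_(s : bool) \sum_(s' : bool) Q3 s s' z) by apply: intble_sum.
rewrite (RID (intbleD (mul _ j0) kS) kSS) (RID (mul _ j0) kS) (RI_sum _ k12) (RI_sum _ k33).
congr (_ + _ + _); apply: eq_bigr => s _.
  by rewrite (RID (k1 s) (k2 s)) /Q1 /Q2 !pint.
by rewrite RI_sum//; apply: eq_bigr => s' _; rewrite /Q3 pint2.
Qed.

End Total.

Section Entries.
Variables (n m : nat) (K : kernels2D R n m) (U : 'I_m -> mR * mR -> R) (i : 'I_n).

Definition ker1 (s : bool) := if s then k10 K else k20 K.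
Definition ker2 (s : bool) := if s then k01 K else k02 K.
Definition ker3 (s s' : bool) :=
  if s then (if s' then k11 K else k12 K) else (if s' then k21 K else k22 K).

Definition term0 (k : 'I_m) (z : mR * mR) :=
  ((fun z => k00 K z i k) \_ (box_xy a b c d)) z * U k z.
Definition term1 s (k : 'I_m) (w : mR * mR * mR) :=
  ((fun w => ker1 s w i k) \_ (box_xytheta a b c d)) w *
  (U k (w.2, w.1.2) * side s w.2 w.1.1).
Definition term2 s (k : 'I_m) (w : mR * mR * mR) :=
  ((fun w => ker2 s w i k) \_ (box_xynu a b c d)) w *
  (U k (w.1.1, w.2) * side s w.2 w.1.2).
Definition term3 s s' (k : 'I_m) (w : mR * mR * mR * mR) :=
  ((fun w => ker3 s s' w i k) \_ (box_xythetanu a b c d)) w *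
  (U k (w.1.2, w.2) * side s w.1.2 w.1.1.1 * side s' w.2 w.1.1.2).

Definition entry := total (fun z => \sum_k term0 k z) (fun s w => \sum_k term1 s k w)
  (fun s w => \sum_k term2 s k w) (fun s s' w => \sum_k term3 s s' k w).

End Entries.

Lemma RI_side (f g : R -> R) (lo hi x : R) s : lo <= x <= hi ->
  (forall t, lo <= t <= hi -> g t = f t * side s t x) ->
  (forall t, ~~ (lo <= t <= hi) -> g t = 0) ->
  \int[L]_(t in (if s then `[lo, x]%classic else `[x, hi]%classic)) f t = \int[L]_t g t.
Proof.
move=> /andP[lx xh] gf g0; rewrite [LHS]Rintegral_mkcond; apply: eq_Rintegral => t _.
rewrite patchE; have [tin|tout] := boolP (lo <= t <= hi).
  rewrite gf// /side; move/andP: tin => [lt th]; case: s {gf}.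
    rewrite (_ : (t \in _) = (t <= x)); last first.
      by apply/idP/idP => [/set_mem|tx]; rewrite ?inE /= in_itv/= ?lt// => /andP[].
    by case: ifP => _; rewrite ?mulr1 ?mulr0.
  rewrite (_ : (t \in _) = (x <= t)); last first.
    by apply/idP/idP => [/set_mem|tx]; rewrite ?inE /= in_itv/= ?th ?andbT// => /andP[].
  by case: ifP => _; rewrite ?mulr1 ?mulr0.
rewrite g0// ifF//; apply/negP => /set_mem; case: s {gf} => /=; rewrite in_itv/= => /andP[t1 t2].
  by move/negP: tout; rewrite t1 (le_trans t2 xh).
by move/negP: tout; rewrite t2 (le_trans lx t1).
Qed.

(** Valid at every point of the box, because each side is the same integral up to extending
    integrands by 0. *)
Lemma PI2D_entry n m (K : kernels2D R n m) (u : R * R -> 'cV[R]_m) i j z :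
  box_xy a b c d z -> PI2D a b c d K u z i j =
  entry K (fun k => (fun z => u z k j) \_ (box_xy a b c d)) i z.
Proof.
case: z => x y [/= xab ycd]; move: (xab) (ycd); rewrite !in_itv/= => xab' ycd'.
pose U k : mR * mR -> R := (fun z => u z k j) \_ (box_xy a b c d).
have UE k (z : mR * mR) : a <= z.1 <= b -> c <= z.2 <= d -> U k z = u z k j.
  by move=> h1 h2; rewrite /U patchE mem_set//; split; rewrite /= in_itv.
have U0 k (z : mR * mR) : ~~ ((a <= z.1 <= b) && (c <= z.2 <= d)) -> U k z = 0.
  move=> h; rewrite /U patchE memNset// => -[/=]; rewrite !in_itv/= => h1 h2.
  by rewrite h1 h2 in h.
have E1 s : integral_mx (if s then `[a, x]%classic else `[x, b]%classic)
    (fun t => ker1 K s (x, y, t) *m u (t, y)) i j = \int[L]_t \sum_k term1 K U i s k (x, y, t).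
  rewrite mxE; apply: RI_side => // t tab.
    rewrite mxE mulr_suml; apply: eq_bigr => k _.
    by rewrite /term1 /= UE// patchE mem_set ?mulrA.
  by rewrite big1// => k _; rewrite /term1 U0 ?mul0r ?mulr0//= negb_and tab.
have E2 s : integral_mx (if s then `[c, y]%classic else `[y, d]%classic)
    (fun t => ker2 K s (x, y, t) *m u (x, t)) i j = \int[L]_t \sum_k term2 K U i s k (x, y, t).
  rewrite mxE; apply: RI_side => // t tab.
    rewrite mxE mulr_suml; apply: eq_bigr => k _.
    by rewrite /term2 /= UE// patchE mem_set ?mulrA.
  by rewrite big1// => k _; rewrite /term2 U0 ?mul0r ?mulr0//= negb_and tab orbT.
have E3 s s' : integral_mx (if s then `[a, x]%classic else `[x, b]%classic)
    (fun t => integral_mx (if s' then `[c, y]%classic else `[y, d]%classic)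
      (fun t' => ker3 K s s' (x, y, t, t') *m u (t, t'))) i j =
    \int[L]_t \int[L]_t' \sum_k term3 K U i s s' k (x, y, t, t').
  rewrite mxE; apply: RI_side => // t tab; last first.
    rewrite -[RHS](RI0 L); apply: eq_Rintegral => t' _.
    by rewrite big1// => k _; rewrite /term3 U0 ?mul0r ?mulr0//= negb_and tab.
  pose g t' := \sum_k ((fun w => ker3 K s s' w i k) \_ (box_xythetanu a b c d)) (x, y, t, t') *
    (U k (t, t') * side s' t' y).
  transitivity (\int[L]_t' (g t' * side s t x)).
    apply: eq_Rintegral => t' _.
    by rewrite mulr_suml; apply: eq_bigr => k _; rewrite /term3 /=; ring.
  (* The factor is 0 or 1, so it leaves the integral whether or not [g] is integrable. *)
  transitivity ((\int[L]_t' g t') * side s t x).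
    rewrite /side; case: (if s then _ else _); rewrite ?mulr1 ?mulr0.
      by apply: eq_Rintegral => t' _; rewrite mulr1.
    by rewrite -[RHS](RI0 L); apply: eq_Rintegral => t' _; rewrite mulr0.
  congr (_ * _); rewrite mxE; apply/esym; apply: RI_side => // t' tcd.
    rewrite mxE mulr_suml; apply: eq_bigr => k _.
    by rewrite UE// patchE mem_set ?mulrA.
  by rewrite /g big1// => k _; rewrite U0 ?mul0r ?mulr0//= negb_and tcd orbT.
have addE (A B : 'cV[R]_n) : (A + B) i j = A i j + B i j by rewrite mxE.
transitivity (\sum_k term0 K U i k (x, y) +
  \int[L]_t \sum_k term1 K U i true k (x, y, t) + \int[L]_t \sum_k term1 K U i false k (x, y, t) +
  \int[L]_t \sum_k term2 K U i true k (x, y, t) + \int[L]_t \sum_k term2 K U i false k (x, y, t) +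
  \int[L]_t \int[L]_t' \sum_k term3 K U i true true k (x, y, t, t') +
  \int[L]_t \int[L]_t' \sum_k term3 K U i false true k (x, y, t, t') +
  \int[L]_t \int[L]_t' \sum_k term3 K U i true false k (x, y, t, t') +
  \int[L]_t \int[L]_t' \sum_k term3 K U i false false k (x, y, t, t')).
  rewrite /PI2D 8!addE; do ![apply: (f_equal2 +%R)].
  - rewrite mxE; apply: eq_bigr => k _; rewrite /term0 UE// patchE mem_set//.
  - exact: (E1 true).
  - exact: (E1 false).
  - exact: (E2 true).
  - exact: (E2 false).
  - exact: (E3 true true).
  - exact: (E3 false true).
  - exact: (E3 true false).
  - exact: (E3 false false).
by rewrite /entry totalE.
Qed.

(** |E W| <= E^2 + W^2 on [D]. In the applications [W] is [u] seen as a function of more variables,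
    and [J] is the indicator in the missing variables that makes W^2 integrable. *)
Lemma intble_mul_sqr dT (T : measurableNormedModType R dT) (mu : {measure set T -> \bar R})
  (D : set T) (E W J : T -> R) :
  L2 mu D E -> measurable_fun setT W -> intble mu (fun z => W z ^+ 2 * J z) ->
  (forall z, 0 <= J z) -> (forall z, D z -> J z = 1) -> intble mu (fun z => (E \_ D) z * W z).
Proof.
move=> E2 mW jW J0 J1; have mE := L2_meas E2.
have mX : measurable_fun setT (fun z => (E \_ D) z * W z) by exact: measurable_funM.
apply: (intble_le mX _ (intbleD (L2_sqr E2) jW)) => z; rewrite normrM patchE.
case: ifPn => [/set_mem/J1 ->|_]; last by rewrite normr0 mul0r expr0n add0r mulr_ge0 ?sqr_ge0.
rewrite mulr1 -(real_normK (num_real (E z))) -(real_normK (num_real (W z))).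
by have := sqr_ge0 (`|E z| - `|W z|); have := normr_ge0 (E z); have := normr_ge0 (W z); nra.
Qed.

Section Lifts.
Variable U : mR * mR -> R.
Hypotheses (mU : measurable_fun setT U) (jU : intble M2 (fun v => U v ^+ 2)).

Let Ind (lo hi : R) : mR -> R := \1_(`[lo, hi]%classic).

Let Ind1 lo hi x : lo <= x <= hi -> Ind lo hi x = 1.
Proof. by move=> h; rewrite /Ind indicE mem_set//= in_itv. Qed.

Lemma intble_lift0 E : L2 M2 (box_xy a b c d) E ->
  intble M2 (fun z => (E \_ (box_xy a b c d)) z * U z).
Proof.
move=> E2; apply: (@intble_mul_sqr _ _ _ _ _ U (fun=> 1) E2 mU) => //.
by apply: eq_intble jU => z; rewrite mulr1.
Qed.

Lemma intble_lift1 s (E : mR * mR * mR -> R) : L2 M3 (box_xytheta a b c d) E ->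
  intble M3 (fun w => (E \_ (box_xytheta a b c d)) w * (U (w.2, w.1.2) * side s w.2 w.1.1)).
Proof.
move=> E2.
have mx : measurable_fun setT (fun w : mR * mR * mR => w.1.1).
  exact: (measurableT_comp measurable_fst measurable_fst).
have my : measurable_fun setT (fun w : mR * mR * mR => w.1.2).
  exact: (measurableT_comp measurable_snd measurable_fst).
have mUw : measurable_fun setT (fun w : mR * mR * mR => U (w.2, w.1.2)).
  by apply: (measurableT_comp mU); apply: measurable_fun_pair my; exact: measurable_snd.
have mT : measure_preserving M3 M3 (fun w => ((w.2, w.1.2), w.1.1)).
  exact: (mpres_comp (mpres_rot3 L L L) (mpres_prod L (mpres_swap12 L L))).
have jW := mpres_intble mT (intble_prod jU (itv_intble a b)).
have jEU : intble M3 (fun w => (E \_ (box_xytheta a b c d)) w * U (w.2, w.1.2)).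
  apply: (@intble_mul_sqr _ _ _ _ _ _ (fun w => Ind a b w.1.1) E2 mUw jW) => //.
  by move=> w [[xab _] _]; apply: Ind1; move: xab; rewrite /= in_itv.
have ms : measurable_fun setT (fun w : mR * mR * mR => side s w.2 w.1.1).
  by apply: side_meas mx; exact: measurable_snd.
by apply: (eq_intble _ (intble_bM jEU ms (fun w => side_le1 s _ _))) => w; rewrite mulrA.
Qed.

Lemma intble_lift2 s (E : mR * mR * mR -> R) : L2 M3 (box_xynu a b c d) E ->
  intble M3 (fun w => (E \_ (box_xynu a b c d)) w * (U (w.1.1, w.2) * side s w.2 w.1.2)).
Proof.
move=> E2.
have mx : measurable_fun setT (fun w : mR * mR * mR => w.1.1).
  exact: (measurableT_comp measurable_fst measurable_fst).
have my : measurable_fun setT (fun w : mR * mR * mR => w.1.2).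
  exact: (measurableT_comp measurable_snd measurable_fst).
have mUw : measurable_fun setT (fun w : mR * mR * mR => U (w.1.1, w.2)).
  by apply: (measurableT_comp mU); apply: (measurable_fun_pair mx); exact: measurable_snd.
have jW := mpres_intble (mpres_swap23 L L L) (intble_prod jU (itv_intble c d)).
have jEU : intble M3 (fun w => (E \_ (box_xynu a b c d)) w * U (w.1.1, w.2)).
  apply: (@intble_mul_sqr _ _ _ _ _ _ (fun w => Ind c d w.1.2) E2 mUw jW) => //.
  by move=> w [[_ ycd] _]; apply: Ind1; move: ycd; rewrite /= in_itv.
have ms : measurable_fun setT (fun w : mR * mR * mR => side s w.2 w.1.2).
  by apply: side_meas my; exact: measurable_snd.
by apply: (eq_intble _ (intble_bM jEU ms (fun w => side_le1 s _ _))) => w; rewrite mulrA.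
Qed.

Lemma intble_lift3 s s' (E : mR * mR * mR * mR -> R) : L2 M4 (box_xythetanu a b c d) E ->
  intble M4 (fun w => (E \_ (box_xythetanu a b c d)) w *
    (U (w.1.2, w.2) * side s w.1.2 w.1.1.1 * side s' w.2 w.1.1.2)).
Proof.
move=> E2.
have mx : measurable_fun setT (fun w : mR * mR * mR * mR => w.1.1.1).
  exact: (measurableT_comp measurable_fst (measurableT_comp measurable_fst measurable_fst)).
have my : measurable_fun setT (fun w : mR * mR * mR * mR => w.1.1.2).
  exact: (measurableT_comp measurable_snd (measurableT_comp measurable_fst measurable_fst)).
have mth : measurable_fun setT (fun w : mR * mR * mR * mR => w.1.2).
  exact: (measurableT_comp measurable_snd measurable_fst).
have mUw : measurable_fun setT (fun w : mR * mR * mR * mR => U (w.1.2, w.2)).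
  by apply: (measurableT_comp mU); apply: (measurable_fun_pair mth); exact: measurable_snd.
have jW := mpres_intble (mpres_rot3 M2 L L)
  (intble_prod jU (intble_prod (itv_intble a b) (itv_intble c d))).
have jEU : intble M4 (fun w => (E \_ (box_xythetanu a b c d)) w * U (w.1.2, w.2)).
  apply: (@intble_mul_sqr _ _ _ _ _ _ (fun w => Ind a b w.1.1.1 * Ind c d w.1.1.2)
    E2 mUw jW) => [w|]; first by rewrite mulr_ge0.
  move=> w [[[xab ycd] _] _]; rewrite /= in_itv/= in xab.
  by rewrite /= in_itv/= in ycd; rewrite !Ind1// mulr1.
have ms : measurable_fun setT (fun w : mR * mR * mR * mR => side s w.1.2 w.1.1.1) by exact: side_meas.
have ms' : measurable_fun setT (fun w : mR * mR * mR * mR => side s' w.2 w.1.1.2).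
  by apply: side_meas my; exact: measurable_snd.
have j1 := intble_bM jEU ms (fun w => side_le1 s _ _).
by apply: (eq_intble _ (intble_bM j1 ms' (fun w => side_le1 s' _ _))) => w; rewrite !mulrA.
Qed.

End Lifts.

Section EntryIntegral.
Variables (n m : nat) (U : 'I_m -> mR * mR -> R) (i : 'I_n).
Hypothesis mU : forall k, measurable_fun setT (U k).
Hypothesis jU : forall k, intble M2 (fun v => U k v ^+ 2).

Section Single.
Variable K : kernels2D R n m.
Hypothesis hK : in_N2D a b c d K.

Let entries_L2 : [/\ forall k, L2 M2 (box_xy a b c d) (fun z => k00 K z i k),
  forall s k, L2 M3 (box_xytheta a b c d) (fun z => ker1 K s z i k),
  forall s k, L2 M3 (box_xynu a b c d) (fun z => ker2 K s z i k) &
  forall s s' k, L2 M4 (box_xythetanu a b c d) (fun z => ker3 K s s' z i k)].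
Proof.
move: hK; rewrite /in_N2D leb4E leb3E leb2E => -[h0 [h01 h02] [h10 h20] [h11 h12] [h21 h22]].
by split=> [k|[] k|[] k|[] [] k]; rewrite /=; auto.
Qed.

Lemma term0_intble k : intble M2 (term0 K U i k).
Proof. by have [h _ _ _] := entries_L2; exact: (intble_lift0 (mU k) (jU k) (h k)). Qed.
Lemma term1_intble s k : intble M3 (term1 K U i s k).
Proof. by have [_ h _ _] := entries_L2; exact: (intble_lift1 (mU k) (jU k) s (h s k)). Qed.
Lemma term2_intble s k : intble M3 (term2 K U i s k).
Proof. by have [_ _ h _] := entries_L2; exact: (intble_lift2 (mU k) (jU k) s (h s k)). Qed.
Lemma term3_intble s s' k : intble M4 (term3 K U i s s' k).
Proof. by have [_ _ _ h] := entries_L2; exact: (intble_lift3 (mU k) (jU k) s s' (h s s' k)). Qed.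

Lemma entry_intble : intble M2 (entry K U i).
Proof.
by apply: total_intble => *; apply: intble_sum => k _;
  [exact: term0_intble|exact: term1_intble|exact: term2_intble|exact: term3_intble].
Qed.

Variables (psi : mR * mR -> R) (M : R).
Hypotheses (mpsi : measurable_fun setT psi) (bpsi : forall z, `|psi z| <= M).

Let mpsi1 : measurable_fun setT (fun w : mR * mR * mR => psi w.1).
Proof. exact: (measurableT_comp mpsi measurable_fst). Qed.
Let mpsi2 : measurable_fun setT (fun w : mR * mR * mR * mR => psi w.1.1).
Proof. exact: (measurableT_comp mpsi1 measurable_fst). Qed.

Lemma term0_mul_intble k : intble M2 (fun z => term0 K U i k z * psi z).
Proof. exact: (intble_bM (term0_intble k) mpsi bpsi). Qed.
Lemma term1_mul_intble s k : intble M3 (fun w => term1 K U i s k w * psi w.1).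
Proof. exact: (intble_bM (term1_intble s k) mpsi1 (fun w => bpsi w.1)). Qed.
Lemma term2_mul_intble s k : intble M3 (fun w => term2 K U i s k w * psi w.1).
Proof. exact: (intble_bM (term2_intble s k) mpsi1 (fun w => bpsi w.1)). Qed.
Lemma term3_mul_intble s s' k : intble M4 (fun w => term3 K U i s s' k w * psi w.1.1).
Proof. exact: (intble_bM (term3_intble s s' k) mpsi2 (fun w => bpsi w.1.1)). Qed.

Lemma entry_RI : \int[M2]_z (entry K U i z * psi z) = \sum_k (
  \int[M2]_z (term0 K U i k z * psi z) +
  \sum_(s : bool) (\int[M3]_w (term1 K U i s k w * psi w.1) +
    \int[M3]_w (term2 K U i s k w * psi w.1)) +
  \sum_(s : bool) \sum_(s' : bool) \int[M4]_w (term3 K U i s s' k w * psi w.1.1)).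
Proof.
rewrite (total_RI _ _ _ _ mpsi bpsi); last 4 first.
- by apply: intble_sum => k _; exact: term0_intble.
- by move=> s; apply: intble_sum => k _; exact: term1_intble.
- by move=> s; apply: intble_sum => k _; exact: term2_intble.
- by move=> s s'; apply: intble_sum => k _; exact: term3_intble.
rewrite [RHS]big_split/= [X in _ = X + _]big_split/=; congr (_ + _ + _).
- rewrite -RI_sum => [|k _]; last exact: term0_mul_intble.
  by apply: eq_Rintegral => z _; rewrite mulr_suml.
- rewrite [RHS]exchange_big/=; apply: eq_bigr => s _; rewrite [RHS]big_split/=; congr (_ + _).
    rewrite -RI_sum => [|k _]; last exact: term1_mul_intble.
    by apply: eq_Rintegral => z _; rewrite mulr_suml.
  rewrite -RI_sum => [|k _]; last exact: term2_mul_intble.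
  by apply: eq_Rintegral => z _; rewrite mulr_suml.
- rewrite [RHS]exchange_big/=; apply: eq_bigr => s _.
  rewrite [RHS]exchange_big/=; apply: eq_bigr => s' _.
  rewrite -RI_sum => [|k _]; last exact: term3_mul_intble.
  by apply: eq_Rintegral => z _; rewrite mulr_suml.
Qed.

End Single.

End EntryIntegral.

End PartialIntegrals.

(** * Integration by parts for the whole operator *)

Section Duality.
Variables (R : realType) (a b c d : R).
Hypotheses (hab : a < b) (hcd : c < d).
Local Notation mR := (measurableTypeR R).
Local Notation L := (leb R).
Local Notation M2 := (prodm L L).
Local Notation M3 := (prodm M2 L).
Local Notation M4 := (prodm M3 L).

Variables (n m : nat) (N M : kernels2D R n m).
Hypothesis hN : in_N2D a b c d N.
Hypothesis h00 : ae_eq leb2 (box_xy a b c d) (k00 N) (cst 0).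
Hypothesis h10 : ae_eq leb3 (box_xytheta a b c d) (k10 N) (cst 0).
Hypothesis h20 : ae_eq leb3 (box_xytheta a b c d) (k20 N) (cst 0).
Hypothesis hM : y_derivative_kernels a b c d N M.

Variable U : 'I_m -> mR * mR -> R.
Hypothesis mU : forall k, measurable_fun setT (U k).
Hypothesis jU : forall k, intble M2 (fun v => U k v ^+ 2).
Hypothesis U0 : forall k v, ~ box_xy a b c d v -> U k v = 0.

Variable phi : mR * mR -> R.
Hypothesis tphi : @test_function R _ (mR * mR)%type (box_xy a b c d) phi.
Local Notation dphi := ('D_((0, 1) : mR * mR) phi).

Variable i : 'I_n.
Local Notation tm0 K := (term0 a b c d K U i).
Local Notation tm1 K := (term1 a b c d K U i).
Local Notation tm2 K := (term2 a b c d K U i).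
Local Notation tm3 K := (term3 a b c d K U i).

Let hM2 : in_N2D a b c d M. Proof. by case: hM. Qed.

(** Term by term, a kernel of [N] against [dphi] plus the matching kernel of [M] against [phi] is a
    signed boundary integral: [Q2] for single and [Q3] for double integrals in nu. The boundary
    integrals of index [true] carry the sign -1, those of index [false] the sign +1. By [Q0] and
    [Q1] the multiplier and theta-integral parts of [M], built from the jumps, are the [true]
    integrals minus the [false] ones, so everything cancels. *)
Lemma entry_weak :
  \int[M2]_z (entry a b c d N U i z * dphi z) = - \int[M2]_z (entry a b c d M U i z * phi z).
Proof.
have [B hB] := phi_bounded hab hcd tphi; have [mphi mdphi] := phi_meas hab hcd tphi.
have bphi z : `|phi z| <= B by exact: (hB z).1.
have bdphi z : `|dphi z| <= B by exact: (hB z).2.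
rewrite (entry_RI i mU jU hN mdphi bdphi) (entry_RI i mU jU hM2 mphi bphi) -sumrN.
apply: eq_bigr => k _.
move: (hM); rewrite /y_derivative_kernels /in_N2D /diagonal_jump3 /diagonal_jump4 leb4E leb3E leb2E.
move=> [[_ [M01 M02] _ [M11 M12] [M21 M22]] [dj0 dj1 dj2] [w01 w02] [w11 w12] [w21 w22]].
move: (hN); rewrite /in_N2D leb4E leb3E leb2E => -[_ [N01 N02] _ [N11 N12] [N21 N22]].
have T0N : \int[M2]_z (tm0 N k z * dphi z) = 0.
  rewrite -[RHS](RI0 M2); apply: RI_ae; [|exact: measurable_cst|].
    exact: intble_meas (term0_mul_intble i mU jU hN mdphi bdphi k).
  apply: filterS h00 => z hz; rewrite /term0 patchE; case: ifPn => [/set_mem/hz ->|_].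
    by rewrite /= mxE !mul0r.
  by rewrite !mul0r.
have T1N s : \int[M3]_w (tm1 N s k w * dphi w.1) = 0.
  rewrite -[RHS](RI0 M3); apply: RI_ae; [|exact: measurable_cst|].
    exact: intble_meas (term1_mul_intble i mU jU hN mdphi bdphi s k).
  have hs : ae_eq leb3 (box_xytheta a b c d) (ker1 N s) (cst 0) by case: s.
  apply: filterS hs => w hw; rewrite /term1 patchE; case: ifPn => [/set_mem/hw ->|_].
    by rewrite /= mxE !mul0r.
  by rewrite !mul0r.
have [G1 [G2 [G1F G2F dJ]]] := dj0.
pose g (s : bool) (w : mR * mR * mR) : R := (if s then G1 else G2) w i k.
have cg s : continuous_representative M3 (box_xynu a b c d) (fun w => ker2 N s w i k) (g s).
  by case: s; [exact: G1F|exact: G2F].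
have E2 s : L2 M3 (box_xynu a b c d) (fun w => ker2 N s w i k).
  by case: s; [exact: N01|exact: N02].
have E2' s : L2 M3 (box_xynu a b c d) (fun w => ker2 M s w i k).
  by case: s; [exact: M01|exact: M02].
have w2 s : weak_derivative M3 (box_xynu a b c d) (dy3 R) (fun w => ker2 N s w i k)
    (fun w => ker2 M s w i k).
  by case: s; [exact: w01|exact: w02].
have q2 s := jump3 hab hcd tphi (mU k) (jU k) (U0 k) s (E2 s) (E2' s) (w2 s) (cg s).
pose A s := \int[M2]_v (U k v * (g s \_ (box_xynu a b c d)) (v.1, v.2, v.2) * phi v).
have Q2 s : \int[M3]_w (tm2 N s k w * dphi w.1) + \int[M3]_w (tm2 M s k w * phi w.1) =
   (-1) ^+ s * A s.
  rewrite -(q2 s).2 -RID; last 2 first.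
  - exact: (term2_mul_intble i mU jU hN mdphi bdphi).
  - exact: (term2_mul_intble i mU jU hM2 mphi bphi).
  by apply: eq_Rintegral => w _; rewrite /term2; ring.
have Q0 : \int[M2]_z (tm0 M k z * phi z) = A true - A false.
  rewrite /A -RIB; [|exact: (q2 true).1|exact: (q2 false).1]; apply: RI_ae.
  - exact: intble_meas (term0_mul_intble i mU jU hM2 mphi bphi k).
  - exact: intble_meas (intbleB (q2 true).1 (q2 false).1).
  apply: filterS dJ => z hz; rewrite /term0 patchE; case: ifPn => [/set_mem zD|zD].
    rewrite hz// !patchE mem_set; last by case: zD.
    by rewrite /g !mxE; ring.
  by rewrite U0; [ring|move=> /mem_set; exact/negP].
have [G11 [G12 [G11F G12F dJ1]]] := dj1.
have [G21 [G22 [G21F G22F dJ2]]] := dj2.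
pose g4 (s s' : bool) (w : mR * mR * mR * mR) : R :=
  (if s then (if s' then G11 else G12) else (if s' then G21 else G22)) w i k.
have cg4 s s' : continuous_representative M4 (box_xythetanu a b c d)
    (fun w => ker3 N s s' w i k) (g4 s s').
  by case: s s' => -[]; [exact: G11F|exact: G12F|exact: G21F|exact: G22F].
have E3 s s' : L2 M4 (box_xythetanu a b c d) (fun w => ker3 N s s' w i k).
  by case: s s' => -[]; [exact: N11|exact: N12|exact: N21|exact: N22].
have E3' s s' : L2 M4 (box_xythetanu a b c d) (fun w => ker3 M s s' w i k).
  by case: s s' => -[]; [exact: M11|exact: M12|exact: M21|exact: M22].
have w3 s s' : weak_derivative M4 (box_xythetanu a b c d) (dy4 R) (fun w => ker3 N s s' w i k)
    (fun w => ker3 M s s' w i k).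
  by case: s s' => -[]; [exact: w11|exact: w12|exact: w21|exact: w22].
have q3 s s' := jump4 hab hcd tphi (mU k) (jU k) (U0 k) s s' (E3 s s') (E3' s s') (w3 s s') (cg4 s s').
pose B4 s s' := \int[M3]_w (U k (w.2, w.1.2) * side s w.2 w.1.1 *
    (g4 s s' \_ (box_xythetanu a b c d)) (w, w.1.2) * phi w.1).
have Q3 s s' : \int[M4]_w (tm3 N s s' k w * dphi w.1.1) + \int[M4]_w (tm3 M s s' k w * phi w.1.1) =
   (-1) ^+ s' * B4 s s'.
  rewrite -(q3 s s').2 -RID; last 2 first.
  - exact: (term3_mul_intble i mU jU hN mdphi bdphi).
  - exact: (term3_mul_intble i mU jU hM2 mphi bphi).
  by apply: eq_Rintegral => w _; rewrite /term3; ring.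
have Q1 s : \int[M3]_w (tm1 M s k w * phi w.1) = B4 s true - B4 s false.
  rewrite /B4 -RIB; [|exact: (q3 s true).1|exact: (q3 s false).1]; apply: RI_ae.
  - exact: intble_meas (term1_mul_intble i mU jU hM2 mphi bphi s k).
  - exact: intble_meas (intbleB (q3 s true).1 (q3 s false).1).
  have hs : ae_eq leb3 (box_xytheta a b c d) (fun w => ker1 M s w i k)
      (fun w => g4 s true (w, w.1.2) - g4 s false (w, w.1.2)).
    case: s; [apply: filterS dJ1|apply: filterS dJ2]; move=> -[[x y] th] hw /hw;
    by rewrite /ker1/= => ->; rewrite !mxE.
  apply: filterS hs => w hw; rewrite /term1 patchE; case: ifPn => [/set_mem wD|wD].
    rewrite hw// !patchE mem_set; last by case: wD => -[].
    ring.
  have nD : (w, w.1.2) \notin box_xythetanu a b c d.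
    by apply: contra wD => /set_mem[wD _]; exact: mem_set.
  by rewrite !patchE (negbTE nD) mulr0 !mul0r subr0.
have S2 s : \int[M3]_w (tm2 N s k w * dphi w.1) =
    (-1) ^+ s * A s - \int[M3]_w (tm2 M s k w * phi w.1) by rewrite -Q2 addrK.
have S3 s s' : \int[M4]_w (tm3 N s s' k w * dphi w.1.1) =
    (-1) ^+ s' * B4 s s' - \int[M4]_w (tm3 M s s' k w * phi w.1.1) by rewrite -Q3 addrK.
rewrite !big_bool/= T0N !T1N !S2 !S3 Q0 !Q1 /= !expr1 !expr0.
clearbody A B4; ring.
Qed.

End Duality.

(** * Matrix-valued kernels, existence of the derivative kernels, and the conclusion *)

Section Matrices.
Context (R : realType) (d : measure_display) (V : measurableNormedModType R d) (n m : nat).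
Variables (mu : {sigma_finite_measure set V -> \bar R}) (k : nat).
Variables (p : nat -> V -> R) (e : nat -> V) (lo hi : nat -> R) (D : set V).
Hypothesis H : box_space mu k p e lo hi D.

Lemma box_cont_L2 (f : V -> R) : continuous f -> L2 mu D f.
Proof.
move=> cf; have mD := box_measurable H.
have mf : measurable_fun setT (f \_ D).
  by apply/(measurable_restrictT _ mD); exact: measurable_funTS (box_cont_measurable H cf).
apply: (L2_intro mf).
have [M M0 hM] := compact_cont_bounded (box_compactD H) (continuous_subspaceT cf).
have mf2 : measurable_fun setT (fun z => (f \_ D) z ^+ 2) by exact: measurable_funX.
apply: (intble_le mf2 _ (intbleZ (M ^+ 2) (box_indic_intble H))) => z.
rewrite ger0_norm ?sqr_ge0// patchE indicE; case: ifPn => [zD|_]; last by rewrite expr0n mulr0.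
by rewrite mulr1 -(real_normK (num_real (f z))) lerXn2r ?nnegrE ?normr_ge0 ?(ltW M0)// hM//; exact: set_mem.
Qed.

Lemma H1mx_continuous_representative (F : V -> 'M[R]_(n, m)) : L2mx mu D F ->
  H1mx mu D [seq e i | i <- iota 0 k] F -> exists G : V -> 'M[R]_(n, m),
    (forall i j, continuous (fun z => G z i j)) /\ continuous_representative_mx mu D F G.
Proof.
move=> F2 FH; have /choice[g hg] : forall ij : 'I_n * 'I_m, exists g : V -> R,
    continuous g /\ ae_eq mu D (fun z => F z ij.1 ij.2) g.
  by move=> ij; exact: (box_continuous_representative H (F2 ij.1 ij.2) (FH ij.1 ij.2)).
pose G z : 'M[R]_(n, m) := \matrix_(i, j) g (i, j) z.
have GE i j : (fun z => G z i j) = g (i, j) by apply/funext => z; rewrite mxE.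
exists G; split=> i j; have [cg ag] := hg (i, j); first by rewrite GE.
by split; rewrite GE; [exact: continuous_subspaceT|exact: ag].
Qed.

Lemma H1mx_derivative (F : V -> 'M[R]_(n, m)) E s : subseq s E -> H1mx mu D E F ->
  exists F', L2mx mu D F' /\ weak_derivative_mx mu D s F F'.
Proof.
move=> sE FH; have /choice[g hg] : forall ij : 'I_n * 'I_m, exists g : V -> R,
    L2 mu D g /\ weak_derivative mu D s (fun z => F z ij.1 ij.2) g.
  by move=> ij; exact: (FH ij.1 ij.2 s sE).
pose G z : 'M[R]_(n, m) := \matrix_(i, j) g (i, j) z.
have GE i j : (fun z => G z i j) = g (i, j) by apply/funext => z; rewrite mxE.
by exists G; split=> i j; rewrite GE; case: (hg (i, j)).
Qed.

End Matrices.

Section Conclusion.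
Variables (R : realType) (a b c d : R).
Hypotheses (hab : a < b) (hcd : c < d).
Local Notation mR := (measurableTypeR R).
Local Notation L := (leb R).
Local Notation M2 := (prodm L L).
Local Notation M3 := (prodm M2 L).
Local Notation M4 := (prodm M3 L).
Variables (n m : nat).
Implicit Types K N M : kernels2D R n m.

Section PI.
Variable u : R * R -> 'cV[R]_m.
Hypothesis hu : L2mx leb2 (box_xy a b c d) u.
Variables (i : 'I_n) (j : 'I_1).

Let U k : mR * mR -> R := (fun z => u z k j) \_ (box_xy a b c d).
Let mU k : measurable_fun setT (U k). Proof. exact: L2_meas (hu k j). Qed.
Let jU k : intble M2 (fun v => U k v ^+ 2). Proof. exact: L2_sqr (hu k j). Qed.
Let U0 k v : ~ box_xy a b c d v -> U k v = 0.
Proof. by move=> nD; rewrite /U patchE memNset. Qed.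

Lemma PI2D_locally_integrable K : in_N2D a b c d K ->
  locally_integrable_on M2 (box_xy a b c d) (fun z => PI2D a b c d K u z i j).
Proof.
move=> hK; have je := entry_intble i mU jU hK.
have mD : measurable (box_xy a b c d : set (mR * mR)) by exact: box_measurable (sp_xy hab hcd [::]).
have E z : box_xy a b c d z -> entry a b c d K U i z = PI2D a b c d K u z i j.
  by move=> zD; rewrite PI2D_entry.
split.
  apply: (eq_measurable_fun (entry a b c d K U i)); first by move=> z /set_mem/E.
  exact: measurable_funTS (intble_meas je).
move=> C cC CD; have mC : measurable C.
  rewrite -[C]setCK; apply: measurableC; apply: (box_open_measurable (sp_xy hab hcd [::])).
  by apply: closed_openC; apply: compact_closed cC; exact: norm_hausdorff.
apply: (@eq_integrable _ _ _ M2 _ mC (EFin \o entry a b c d K U i)).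
  by move=> z /set_mem/CD/interior_subset zD; rewrite /= E.
exact: (integrableS measurableT mC _ je).
Qed.

Lemma PI2D_RI K (psi : mR * mR -> R) : (forall z, ~ box_xy a b c d z -> psi z = 0) ->
  \int[M2]_(z in box_xy a b c d) (PI2D a b c d K u z i j * psi z) =
  \int[M2]_z (entry a b c d K U i z * psi z).
Proof.
move=> psi0; rewrite (RI_restrict M2 (box_xy a b c d) (fun z => PI2D a b c d K u z i j)).
apply: eq_Rintegral => z _; have [zD|nD] := pselect (box_xy a b c d z).
  by rewrite patchE mem_set// PI2D_entry.
by rewrite psi0// !mulr0.
Qed.

End PI.

Lemma PI2D_weak_derivative N M (u : R * R -> 'cV[R]_m) : in_N2D a b c d N ->
  ae_eq leb2 (box_xy a b c d) (k00 N) (cst 0) ->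
  ae_eq leb3 (box_xytheta a b c d) (k10 N) (cst 0) ->
  ae_eq leb3 (box_xytheta a b c d) (k20 N) (cst 0) ->
  y_derivative_kernels a b c d N M -> L2mx leb2 (box_xy a b c d) u ->
  weak_derivative_mx leb2 (box_xy a b c d) (dy2 R) (PI2D a b c d N u) (PI2D a b c d M u).
Proof.
move=> hN h00 h10 h20 hM hu i j; have hM2 : in_N2D a b c d M by case: hM.
split; [exact: (PI2D_locally_integrable hu i j hN)|exact: (PI2D_locally_integrable hu i j hM2)|].
move=> phi tphi; rewrite expr1 mulN1r.
have out := phi_out tphi.
have RN := PI2D_RI u i j N (fun z nz => (out z nz).2).
have RM := PI2D_RI u i j M (fun z nz => (out z nz).1).
rewrite -[iter_derive _ _]/('D_((0, 1) : mR * mR) phi).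
apply: etrans RN _; apply: etrans (congr1 -%R (esym RM)).
apply: (entry_weak hab hcd hN h00 h10 h20 hM _ _ _ tphi).
- by move=> k; exact: L2_meas (hu k j).
- by move=> k; exact: L2_sqr (hu k j).
- by move=> k v nD; rewrite patchE memNset.
Qed.

Lemma cont_pair (X Y Z : normedModType R) (f : X -> Y) (g : X -> Z) :
  continuous f -> continuous g -> continuous (fun x => (f x, g x)).
Proof. by move=> cf cg x; apply: cvg_pair; [exact: cf|exact: cg]. Qed.

(** The representatives are continuous on the whole space, so their traces on nu = y are continuous,
    hence square-integrable on the compact boxes. The remaining kernels are the weak y-derivatives
    provided by [H1] for the one-element subsequence. *)
Lemma y_derivative_kernels_exist N : in_N2D a b c d N ->
  H1mx M3 (box_xynu a b c d) (basis3 R) (k01 N) ->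
  H1mx M3 (box_xynu a b c d) (basis3 R) (k02 N) ->
  H1mx M4 (box_xythetanu a b c d) (basis4 R) (k11 N) ->
  H1mx M4 (box_xythetanu a b c d) (basis4 R) (k12 N) ->
  H1mx M4 (box_xythetanu a b c d) (basis4 R) (k21 N) ->
  H1mx M4 (box_xythetanu a b c d) (basis4 R) (k22 N) ->
  exists M, y_derivative_kernels a b c d N M.
Proof.
move=> [_ [N01 N02] _ [N11 N12] [N21 N22]] h01 h02 h11 h12 h21 h22.
have S3 := sp_xynu hab hcd; have S4 := sp_xythetanu hab hcd.
have s3 : subseq (dy3 R) (basis3 R) by rewrite sub1seq /basis3 !inE eqxx orbT.
have s4 : subseq (dy4 R) (basis4 R) by rewrite sub1seq /basis4 !inE eqxx orbT.
have [g01 [c01 r01]] := H1mx_continuous_representative S3 N01 h01.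
have [g02 [c02 r02]] := H1mx_continuous_representative S3 N02 h02.
have [g11 [c11 r11]] := H1mx_continuous_representative S4 N11 h11.
have [g12 [c12 r12]] := H1mx_continuous_representative S4 N12 h12.
have [g21 [c21 r21]] := H1mx_continuous_representative S4 N21 h21.
have [g22 [c22 r22]] := H1mx_continuous_representative S4 N22 h22.
have [f01 [l01 w01]] := @H1mx_derivative R _ _ n m M3 _ _ (basis3 R) (dy3 R) s3 h01.
have [f02 [l02 w02]] := @H1mx_derivative R _ _ n m M3 _ _ (basis3 R) (dy3 R) s3 h02.
have [f11 [l11 w11]] := @H1mx_derivative R _ _ n m M4 _ _ (basis4 R) (dy4 R) s4 h11.
have [f12 [l12 w12]] := @H1mx_derivative R _ _ n m M4 _ _ (basis4 R) (dy4 R) s4 h12.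
have [f21 [l21 w21]] := @H1mx_derivative R _ _ n m M4 _ _ (basis4 R) (dy4 R) s4 h21.
have [f22 [l22 w22]] := @H1mx_derivative R _ _ n m M4 _ _ (basis4 R) (dy4 R) s4 h22.
pose d3 (z : mR * mR) : mR * mR * mR := (z.1, z.2, z.2).
pose d4 (z : mR * mR * mR) : mR * mR * mR * mR := (z.1.1, z.1.2, z.2, z.1.2).
have cd3 : continuous d3.
  by move=> z; apply: cont_pair; [apply: cont_pair|] => {}z; [exact: cvg_fst|exact: cvg_snd|exact: cvg_snd].
have cd4 : continuous d4.
  have cf : continuous (fun z : mR * mR * mR => z.1) by move=> z; exact: cvg_fst.
  have cx : continuous (fun z : mR * mR * mR => z.1.1).
    by move=> z; apply: (@continuous_comp _ _ _ fst fst); [exact: cf|exact: cvg_fst].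
  have cy : continuous (fun z : mR * mR * mR => z.1.2).
    by move=> z; apply: (@continuous_comp _ _ _ fst snd); [exact: cf|exact: cvg_snd].
  have ct : continuous (fun z : mR * mR * mR => z.2) by move=> z; exact: cvg_snd.
  exact: (cont_pair (cont_pair (cont_pair cx cy) ct) cy).
have L2d3 (g g' : mR * mR * mR -> 'M[R]_(n, m)) : (forall i j, continuous (fun z => g z i j)) ->
    (forall i j, continuous (fun z => g' z i j)) ->
    L2mx M2 (box_xy a b c d) (fun z => g (d3 z) - g' (d3 z)).
  move=> cg cg' i j; apply: (box_cont_L2 (sp_xy hab hcd [::])) => z.
  rewrite (_ : (fun _ => _) = (fun z => g (d3 z) i j - g' (d3 z) i j)); last first.
    by apply/funext => v; rewrite !mxE.
  by apply: cvgB; [exact: (continuous_comp (@cd3 z) (@cg i j (d3 z)))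
                  |exact: (continuous_comp (@cd3 z) (@cg' i j (d3 z)))].
have L2d4 (g g' : mR * mR * mR * mR -> 'M[R]_(n, m)) : (forall i j, continuous (fun z => g z i j)) ->
    (forall i j, continuous (fun z => g' z i j)) ->
    L2mx M3 (box_xytheta a b c d) (fun z => g (d4 z) - g' (d4 z)).
  move=> cg cg' i j; apply: (box_cont_L2 (sp_xytheta hab hcd)) => z.
  rewrite (_ : (fun _ => _) = (fun z => g (d4 z) i j - g' (d4 z) i j)); last first.
    by apply/funext => v; rewrite !mxE.
  by apply: cvgB; [exact: (continuous_comp (@cd4 z) (@cg i j (d4 z)))
                  |exact: (continuous_comp (@cd4 z) (@cg' i j (d4 z)))].
rewrite /y_derivative_kernels /in_N2D /diagonal_jump3 /diagonal_jump4 leb4E leb3E leb2E.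
exists (Kernels2D (fun z => g01 (d3 z) - g02 (d3 z)) f01 f02 (fun z => g11 (d4 z) - g12 (d4 z))
  (fun z => g21 (d4 z) - g22 (d4 z)) f11 f12 f21 f22).
apply: And5 => //=.
- by split => //; [exact: L2d3|split; exact: L2d4].
- split; [exists g01, g02|exists g11, g12|exists g21, g22]; split => //; exact: ae_eq_refl.
Qed.

End Conclusion.

Theorem lemma7 (R : realType) (a b c d : R) (n m : nat) (N : kernels2D R n m)
    (hab : a < b) (hcd : c < d) (hN : in_N2D a b c d N)
    (h00 : ae_eq leb2 (box_xy a b c d) (k00 N) (cst 0))
    (h10 : ae_eq leb3 (box_xytheta a b c d) (k10 N) (cst 0))
    (h20 : ae_eq leb3 (box_xytheta a b c d) (k20 N) (cst 0))
    (h01 : H1mx leb3 (box_xynu a b c d) (@basis3 R) (k01 N))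
    (h02 : H1mx leb3 (box_xynu a b c d) (@basis3 R) (k02 N))
    (h11 : H1mx leb4 (box_xythetanu a b c d) (@basis4 R) (k11 N))
    (h12 : H1mx leb4 (box_xythetanu a b c d) (@basis4 R) (k12 N))
    (h21 : H1mx leb4 (box_xythetanu a b c d) (@basis4 R) (k21 N))
    (h22 : H1mx leb4 (box_xythetanu a b c d) (@basis4 R) (k22 N)) :
  (exists M : kernels2D R n m, y_derivative_kernels a b c d N M) /\
  forall M : kernels2D R n m, y_derivative_kernels a b c d N M ->
  forall u : R * R -> 'cV[R]_m, L2mx leb2 (box_xy a b c d) u ->
    weak_derivative_mx leb2 (box_xy a b c d) (@dy2 R)
      (PI2D a b c d N u) (PI2D a b c d M u).
Proof.
split; last by move=> M hM u hu; exact: (PI2D_weak_derivative hab hcd hN h00 h10 h20 hM hu).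
rewrite leb3E in h01 h02; rewrite leb4E in h11 h12 h21 h22.
exact: (y_derivative_kernels_exist hab hcd hN h01 h02 h11 h12 h21 h22).
Qed.
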